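(* Let $G$ be a bicyclic graph of order $m$ and let $H$ be a connected graph of order $n$. Then $p(G\Box H)\leq \frac{mn}{2}$.
   Context: All graphs are finite, undirected and simple; the order of a graph is its number of vertices. A bicyclic graph is a connected graph whose number of edges equals its number of vertices plus one. A path decomposition of a graph $X$ is a collection of pairwise edge-disjoint paths of $X$ that together cover all edges of $X$; $p(X)$ denotes the minimum number of paths in a path decomposition of $X$. The cartesian product $G\Box H$ has vertex set $V(G)\times V(H)$, and $(u_1,v_1)$, $(u_2,v_2)$ are adjacent if and only if either $u_1u_2\in E(G)$ and $v_1=v_2$, or $v_1v_2\in E(H)$ and $u_1=u_2$. *)

(* Defs.v *)
From mathcomp Require Import all_boot boolp.

Set Implicit Arguments.
Unset Strict Implicit.
Unset Printing Implicit Defensive.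

Record sgraph := SGraph {
  vertex :> finType;
  adj : rel vertex;
  adj_sym : symmetric adj;
  adj_irrefl : irreflexive adj
}.

Definition edge_set (G : sgraph) : {set {set G}} :=
  [set E : {set G} | [exists x : G, exists y : G, adj x y && (E == [set x; y])]].

Definition connected (G : sgraph) : bool :=
  (0 < #|G|) && [forall x : G, forall y : G, connect (@adj G) x y].

Definition bicyclic (G : sgraph) : bool :=
  connected G && (#|edge_set G| == #|G| + 1).

Section CartesianProduct.
Variables G H : sgraph.

Definition cprod_adj : rel (G * H)%type := fun u v =>
  (adj u.1 v.1 && (u.2 == v.2)) || (adj u.2 v.2 && (u.1 == v.1)).

Lemma cprod_adj_sym : symmetric cprod_adj.
Proof.
move=> u v; rewrite /cprod_adj.
by rewrite (adj_sym u.1) (adj_sym u.2) (eq_sym u.1) (eq_sym u.2).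
Qed.

Lemma cprod_adj_irrefl : irreflexive cprod_adj.
Proof. by move=> u; rewrite /cprod_adj !adj_irrefl. Qed.

Definition cprod : sgraph := SGraph cprod_adj_sym cprod_adj_irrefl.

End CartesianProduct.

Section PathNumber.
Variable G : sgraph.
Implicit Types (s t : seq G) (D : seq (seq G)).

Definition is_path s : bool :=
  if s is x :: s' then path (@adj G) x s' && uniq s else false.

Definition path_edges s : {set {set G}} :=
  if s is x :: s' then [set:: pairmap (fun y z => [set y; z]) x s'] else set0.

(* One-vertex paths are allowed as members of D, possibly repeated; they carry
   no edge, so they do not affect the minimum below. *)
Definition path_decomposition D : bool :=
  [&& all is_path D,
      pairwise (fun s t => [disjoint path_edges s & path_edges t]) D
    & \bigcup_(s <- D) path_edges s == edge_set G].

Definition has_path_decomposition (k : nat) : bool :=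
  `[< exists2 D, path_decomposition D & size D = k >].

Lemma path_edges_edge E : E \in edge_set G ->
  is_path (enum E) /\ path_edges (enum E) = [set E].
Proof.
rewrite inE => /existsP[x /existsP[y /andP[xy /eqP->]]].
have nxy : x != y by apply: contraTneq xy => ->; rewrite adj_irrefl.
have /perm_consP : perm_eq (enum [set x; y]) [:: x; y].
  apply: uniq_perm; rewrite ?enum_uniq //= ?inE ?nxy //.
  by move=> z; rewrite mem_enum !inE.
move=> [i [s [def_s /perm_small_eq sy]]].
have {}sy : s = [:: y] by exact: sy.
subst s; have {i def_s} : enum [set x; y] = [:: x; y] \/ enum [set x; y] = [:: y; x].
  have sz : size (enum [set x; y]) = 2 by rewrite -cardE cards2 nxy.
  case: (enum _) sz def_s => [|a [|b [|c u]]] //= _.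
  by case: i => [|[|i]] /= [-> ->]; [left|right|left].
have set1E (A : {set G}) : [set:: [:: A]] = [set A].
  by apply/setP => B; rewrite !inE.
case=> -> /=; rewrite !inE !andbT set1E; first by rewrite xy nxy.
by rewrite adj_sym xy eq_sym nxy setUC.
Qed.

Lemma has_path_decomposition_ex : exists k, has_path_decomposition k.
Proof.
pose D := [seq enum (E : {set G}) | E <- enum (edge_set G)].
exists (size D); apply/asboolP; exists D => //; apply/and3P; split.
- apply/allP => s /mapP[E]; rewrite mem_enum => /path_edges_edge[pE _] -> //.
- rewrite /D pairwise_map.
  have := enum_uniq (edge_set G); rewrite uniq_pairwise.
  apply: sub_in_pairwise (allss _) => E F; rewrite !mem_enum /=.
  move=> /path_edges_edge[_ ->] /path_edges_edge[_ ->] nEF.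
  by rewrite disjoints1 inE.
- apply/eqP/setP => E; rewrite big_map bigcup_seq.
  apply/bigcupP/idP => [[F]|EG].
    by rewrite mem_enum => FG; have [_ ->] := path_edges_edge FG; rewrite inE => /eqP->.
  by exists E; rewrite ?mem_enum //; have [_ ->] := path_edges_edge EG; rewrite inE.
Qed.

Definition path_number : nat := ex_minn has_path_decomposition_ex.

End PathNumber.

(* Main.v *)
(* By a theorem of Lovasz, H decomposes into paths such that each vertex is an end of
   at most two of them; hence these paths can be oriented so that no two have the same
   first vertex v, and no two the same last vertex sg v.  Above such a path, the copies
   of G at v and at sg v together with the copies of the path form a subdivided prism
   over G, and it suffices to decompose all these prisms into m/2 paths on average.
   This property of G is inherited from pieces of G ("blocks") whose rungs lie over
   disjoint vertex sets.  A path of G is a block at the cost of one path, since one can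
   zigzag along it between the two copies; so a forest costs half its number of vertices
   of odd degree.  A bicyclic graph contains a theta, or two cycles that share at most
   one vertex.  Depending on the parities of the degrees on these cycles, a block of
   cost k made of one or two short paths or of whole cycles can be removed from G so as
   to leave a forest with at least 2k vertices of even degree. *)

Require Import Defs.
From mathcomp Require Import all_boot all_order all_algebra.
From mathcomp Require Import boolp zify.
Import Order.TTheory GRing.Theory Num.Theory.

Set Implicit Arguments.
Unset Strict Implicit.
Unset Printing Implicit Defensive.

(** * Walks *)

(** What shapes the blocks is less their cost than the bound [size L' + size Z <= #|R|]. A zigzag
    splits the edges of a piece of [G] into those run in one copy and those run in the other. At a
    vertex of [H] where one path ends and another starts, the two halves complement each other;
    where no path follows, every segment that a copy misses has to be added as a path of its own. So
    lines and segments together may not outnumber the rungs. A single line with rungs at both ends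
    meets this bound exactly; two lines from a common start exceed it by one, and so missed segments
    are glued together. Gluing requires that they meet only at the point of gluing, hence that rungs
    stand close to the branch vertices. As the rungs of a removed piece must lie where the remaining
    forest has even degree, it is the parities of the neighbours of the branch vertices that decide
    which piece can be removed. *)

Section Link.
Variable T : eqType.
Implicit Types (s t : seq T) (a b x y : T) (D : seq (seq T)).

Definition link x y a b : bool := ((a == x) && (b == y)) || ((a == y) && (b == x)).

(* Edge sets are multisets [T -> T -> nat] throughout; [ed s] is that of the walk [s]. *)
Fixpoint ed s a b : nat :=
  if s is x :: s' then (if s' is y :: _ then link x y a b : nat else 0) + ed s' a b else 0.

Definition decomp (W : T -> T -> nat) D :=
  all uniq D /\ forall a b, \sum_(s <- D) ed s a b = W a b.

Lemma ed_cons2 x y s a b : ed (x :: y :: s) a b = link x y a b + ed (y :: s) a b.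
Proof. by []. Qed.

Lemma linkC x y a b : link x y a b = link y x a b.
Proof. by rewrite /link orbC. Qed.

Lemma link_sym x y a b : link x y a b = link x y b a.
Proof. by rewrite /link orbC andbC (andbC (a == x)). Qed.

Lemma ed_sym s a b : ed s a b = ed s b a.
Proof. by elim: s => // x [|y s] IH //; rewrite !ed_cons2 link_sym IH. Qed.

Lemma ed_cat s x t a b : ed (s ++ x :: t) a b = ed (rcons s x) a b + ed (x :: t) a b.
Proof.
elim: s => [//|y [|z s] IH]; first by rewrite [in RHS]/= !addn0.
by move: IH; rewrite !cat_cons !rcons_cons !ed_cons2 => ->; rewrite addnA.
Qed.

Lemma ed_rcons s x y a b : ed (rcons (rcons s x) y) a b = ed (rcons s x) a b + link x y a b.
Proof. by rewrite -cats1 cat_rcons ed_cat /= !addn0. Qed.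

Lemma ed_rev s a b : ed (rev s) a b = ed s a b.
Proof.
elim: s => // x [|y s] IH //; rewrite ed_cons2 rev_cons.
by move: IH; rewrite rev_cons ed_rcons linkC addnC => ->.
Qed.

Lemma ed_mem s a b : 0 < ed s a b -> a \in s.
Proof.
elim: s => // x [|y s] IH //; rewrite ed_cons2 addn_gt0 lt0b => /orP[|/IH h]; last first.
  by rewrite in_cons h orbT.
by case/orP=> /andP[/eqP-> _]; rewrite !in_cons eqxx ?orbT.
Qed.

Lemma ed_notin s a b : a \notin s -> ed s a b = 0.
Proof. by move=> as_; apply/eqP; rewrite -leqn0 leqNgt; apply: contra as_ => /ed_mem. Qed.

Lemma ed_notinr s a b : b \notin s -> ed s a b = 0.
Proof. by rewrite ed_sym => /ed_notin->. Qed.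

Lemma ed_le1 s a b : uniq s -> ed s a b <= 1.
Proof.
elim: s => // x [|y s] IH // /andP[xs us]; rewrite ed_cons2.
case E: (link x y a b); last by rewrite add0n; exact: IH.
by case/orP: E => /andP[/eqP ax /eqP bx]; [rewrite ed_notin ?ax | rewrite ed_notinr ?bx].
Qed.

Lemma ed_refl s a : uniq s -> ed s a a = 0.
Proof.
elim: s => // x [|y s] IH // /andP[xs us]; rewrite ed_cons2 IH // addn0.
apply/eqP; rewrite eqb0 /link [X in _ || X]andbC orbb.
by apply: contra xs => /andP[/eqP<- /eqP->]; rewrite in_cons eqxx.
Qed.

End Link.

Lemma ed_map (T U : eqType) (f : T -> U) s a b : injective f ->
  ed (map f s) (f a) (f b) = ed s a b.
Proof.
move=> fI; elim: s => // x [|y s] IH //.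
by rewrite !map_cons !ed_cons2 -map_cons IH /link !(inj_eq fI).
Qed.

Lemma link_row (T S : eqType) (x y a c : T) (r i j : S) :
  link (x, r) (y, r) (a, i) (c, j) = [&& i == r, j == r & link x y a c] :> bool.
Proof.
rewrite /link !xpair_eqE.
by case: (i == r); case: (j == r); rewrite ?andbT ?andbF ?orbF.
Qed.

(** * Zigzags *)

Section Zigzag.
Variables (V : eqType) (M : pred V).
Implicit Types (b i j : bool) (x y a c : V) (s : seq V).

(* [zig b x s] runs through the walk [x :: s] inside two parallel copies of it,
   starting in copy [b] and taking the rung to the other copy at each vertex marked
   by [M].  [seg b x s] is the list of the segments of the walk between consecutive
   marked vertices, all but the first being tagged with the copy they are run in. *)
Fixpoint zig b x s : seq (V * bool) :=
  (x, b) :: if s is y :: s' then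
    if M y then (y, b) :: zig (~~ b) y s' else zig b y s' else [::].

Fixpoint seg b x s : seq V * seq (bool * seq V) :=
  if s is y :: s' then
    if M y then ([:: x; y], if s' is [::] then [::] else
      (~~ b, (seg (~~ b) y s').1) :: (seg (~~ b) y s').2)
    else (x :: (seg b y s').1, (seg b y s').2)
  else ([:: x], [::]).

Lemma seg_nil b x : seg b x [::] = ([:: x], [::]). Proof. by []. Qed.

Lemma seg_cons b x y s : seg b x (y :: s) =
  if M y then ([:: x; y], if s is [::] then [::] else
      (~~ b, (seg (~~ b) y s).1) :: (seg (~~ b) y s).2)
    else (x :: (seg b y s).1, (seg b y s).2).
Proof. by []. Qed.

Arguments seg : simpl never.

Definition csum i (l : seq (bool * seq V)) a c := \sum_(z <- l | z.1 == i) ed z.2 a c.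
Definition allseg b x s := (b, (seg b x s).1) :: (seg b x s).2.
(** The edges of the walk that its zigzag runs in copy [i], as [zig_ed] confirms. *)
Definition wcol i b x s := csum i (allseg b x s).

Lemma zig_head b x s : exists t, zig b x s = (x, b) :: t.
Proof. by case: s => [|y s] /=; eexists. Qed.

Lemma zig_cons b x y s : zig b x (y :: s) =
  (x, b) :: (if M y then (y, b) :: zig (~~ b) y s else zig b y s).
Proof. by []. Qed.

Lemma zig_mem b x s p : p \in zig b x s -> p.1 \in x :: s.
Proof.
elim: s b x => [|y s IH] b x; first by rewrite !mem_seq1 => /eqP->.
rewrite zig_cons => /predU1P[->|]; first exact: mem_head.
have k d : p \in zig d y s -> p.1 \in x :: y :: s by move/IH=> h; rewrite in_cons h orbT.
case: (M y); last exact: k.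
by case/predU1P=> [->|/k//]; rewrite in_cons mem_head orbT.
Qed.

Lemma zig_other b x s : uniq (x :: s) -> (x, ~~ b) \notin zig b x s.
Proof.
case: s => [|y s]; first by rewrite /= inE xpair_eqE eqxx; case: b.
rewrite cons_uniq zig_cons => /andP[xys _]; rewrite in_cons xpair_eqE eqxx.
have h d : (x, ~~ b) \notin zig d y s by apply: contra xys => /zig_mem.
have nxy : (x == y) = false by apply: contraNF xys => /eqP->; rewrite inE eqxx.
case: (M y); rewrite ?in_cons ?xpair_eqE ?nxy ?(negPf (h _)) ; by case: b {h}.
Qed.

Lemma zig_uniq b x s : uniq (x :: s) -> uniq (zig b x s).
Proof.
elim: s b x => // y s IH b x; rewrite cons_uniq zig_cons => /andP[xys us].
have h d : (x, b) \notin zig d y s by apply: contra xys => /zig_mem.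
have nxy : (x == y) = false by apply: contraNF xys => /eqP->; rewrite inE eqxx.
case: (M y); rewrite cons_uniq.
  rewrite in_cons xpair_eqE nxy h cons_uniq IH //= andbT.
  by rewrite -{1}(negbK b) zig_other.
by rewrite h IH.
Qed.

Lemma link_rung b y a c i j :
  link (y, b) (y, ~~ b) (a, i) (c, j) = [&& a == y, c == y & i != j] :> bool.
Proof. by rewrite /link !xpair_eqE; case: (a == y); case: (c == y); case: b i j => [] [] []. Qed.

Lemma zig_ed_cons b x y s p q :
  ed (zig b x (y :: s)) p q = link (x, b) (y, b) p q +
     (M y && link (y, b) (y, ~~ b) p q) + ed (zig (b (+) M y) y s) p q.
Proof.
rewrite zig_cons; case: (M y).
  by have [t E] := zig_head (~~ b) y s; rewrite addbT E !ed_cons2 andTb addnA.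
by have [t E] := zig_head b y s; rewrite addbF E ed_cons2 addn0.
Qed.

Lemma seg_head b x s : exists t, (seg b x s).1 = x :: t.
Proof. by case: s => [|y s]; rewrite ?seg_nil ?seg_cons; [|case: (M y)]; eexists. Qed.

Lemma wcol_cons i b x y s a c : wcol i b x (y :: s) a c =
  (b == i) * link x y a c + wcol i (b (+) M y) y s a c.
Proof.
rewrite /wcol /allseg /csum seg_cons; case: (M y) => /=.
  rewrite addbT !big_cons /= !addn0.
  case: s => [|z s]; last by rewrite !big_cons /=; case: (b == i); rewrite ?mul1n ?mul0n ?add0n.
  by rewrite seg_nil !big_nil; case: (b == i); case: (~~ b == i); rewrite /= ?addn0 ?mul1n ?mul0n.
rewrite addbF; have [t E] := seg_head b y s; rewrite E !big_cons /=.
by case: (b == i); rewrite /= ?mul1n ?mul0n ?addnA.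
Qed.

Lemma wcolD b x s a c : wcol false b x s a c + wcol true b x s a c = ed (x :: s) a c.
Proof.
elim: s b x => [|y s IH] b x.
  by rewrite /wcol /csum /allseg seg_nil !big_cons !big_nil /=; case: b.
by rewrite !wcol_cons ed_cons2 -(IH (b (+) M y)); case: (b) => /=; lia.
Qed.

Lemma zig_ed b x s a c i j : uniq (x :: s) ->
  ed (zig b x s) (a, i) (c, j) =
  if i == j then wcol i b x s a c else [&& a == c, a \in s & M a] :> nat.
Proof.
elim: s b x => [|y s IH] b x.
  by move=> _; rewrite /wcol /csum /allseg seg_nil big_cons big_nil /= andbF; case: (i == j); case: (b == i).
rewrite cons_uniq => /andP[_ us]; rewrite zig_ed_cons IH // link_row link_rung wcol_cons.
have [->|nij] := eqVneq i j.
  by rewrite !andbF addn0 eq_sym; case: (b == j); rewrite /= ?mul1n ?mul0n.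
have -> : [&& i == b, j == b & link x y a c] = false by case: i j b nij {IH} => [] [] [].
rewrite in_cons add0n; have [<-|nac] := eqVneq a c; last first.
  rewrite /= addn0; apply/eqP; rewrite eqb0; apply/negP => /and4P[_ /eqP ay /eqP cy _].
  by rewrite ay cy eqxx in nac.
have [->|nay] := eqVneq a y; last by rewrite andbF.
by move: us => /andP[/negPf-> _]; case: (M y).
Qed.

Lemma seg_prefix b x s : exists2 k, (seg b x s).1 = x :: take k s &
  all (predC M) (take k.-1 s).
Proof.
elim: s b x => [|y s IH] b x; first by exists 0.
rewrite seg_cons; case: ifP => My; first by exists 1 => //=; rewrite take0.
have [k -> h] := IH b y; case: k h => [|k] h; last by exists k.+2 => //=; rewrite My.
by exists 1; rewrite //= take0.
Qed.

(** The first segment stops at the first marked vertex, so any marked vertex bounds it. This serves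
    to show that two first segments, which are to be glued, do not meet again. *)
Lemma seg_upto b x s1 y s2 : M y -> {subset (seg b x (s1 ++ y :: s2)).1 <= x :: rcons s1 y}.
Proof.
move=> My; elim: s1 x => [|z s1 IH] x a; rewrite seg_cons ?My //.
case: (M z); first by rewrite !inE => /orP[]->; rewrite ?orbT.
by rewrite inE => /orP[|/IH]; rewrite !inE => ->; rewrite ?orbT.
Qed.

Lemma seg_uniq b x s : uniq (x :: s) -> all uniq [seq z.2 | z <- allseg b x s].
Proof.
elim: s b x => // y s IH b x; rewrite cons_uniq => /andP[xys us].
have := IH (b (+) M y) y us.
have nxy : (x == y) = false by apply: contraNF xys => /eqP->; rewrite inE eqxx.
rewrite /allseg seg_cons; case: (M y) => /=.
  by rewrite addbT !inE nxy; case: (s) => //= ? ? /andP[-> ->].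
rewrite addbF => /andP[u1 ->]; rewrite u1 !andbT.
have [k E _] := seg_prefix b y s; rewrite E in_cons nxy.
by apply: contra xys => /mem_take xs; rewrite inE xs orbT.
Qed.

(** A new segment opens after every marked vertex, except after a marked last one. All comparisons
    of lines and segments with [#|R|] rest on this count. *)
Lemma seg_size b x y s :
  size (seg b x (y :: s)).2 + M (last y s) = count M (y :: s).
Proof.
elim: s b x y => [|z s IH] b x y; first by rewrite seg_cons seg_nil /=; case: (M y).
rewrite [count _ _]/= -/(count M (z :: s)) -(IH (b (+) M y) y) seg_cons.
by case: (M y); rewrite ?addbT ?addbF /= ?addSn ?add1n.
Qed.

End Zigzag.

(** * Blocks *)

Section Decomp.
Variable T : eqType.
Implicit Types (W : T -> T -> nat) (D : seq (seq T)) (s t : seq T).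

Lemma decomp_eq W W' D : (forall a b, W a b = W' a b) -> decomp W D -> decomp W' D.
Proof. by move=> E [u h]; split=> // a b; rewrite h E. Qed.

Lemma decomp_cat W W' D D' : decomp W D -> decomp W' D' ->
  decomp (fun a b => W a b + W' a b) (D ++ D').
Proof.
move=> [u h] [u' h']; split=> [|a b]; first by rewrite all_cat u u'.
by rewrite big_cat /= h h'.
Qed.

Lemma decomp_nil : @decomp T (fun _ _ : T => 0) [::].
Proof. by split=> // a b; rewrite big_nil. Qed.

Lemma decomp1 s : uniq s -> decomp (ed s) [:: s].
Proof. by move=> us; split=> [|a b]; rewrite /= ?us // big_seq1. Qed.

Lemma decomp2 s t : uniq s -> uniq t -> decomp (fun a b => ed s a b + ed t a b) [:: s; t].
Proof. by move=> us ut; exact: (decomp_cat (decomp1 us) (decomp1 ut)). Qed.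

End Decomp.

Section Block.
Variable V : finType.
Implicit Types (W : V -> V -> nat) (R : {set V}) (D Q Z : seq (seq V))
  (ex : seq (bool * seq V)).

(* Copy [false] of [V] carries the edges [W0], copy [true] the edges [W1], and the
   rungs are at [R]. *)
Definition lam W0 W1 R (p q : V * bool) : nat :=
  if p.2 == q.2 then (if p.2 then W1 else W0) p.1 q.1 else (p.1 == q.1) && (p.1 \in R).

(* In the product of [W] with a path system of [H] whose paths run from [v] to [sg v],
   the rungs of the prism are the copies of such a path, copy [false] is at [v] and copy
   [true] at [sg v].  A vertex of [H] that both starts and ends a path receives [W0]
   from the path it starts and [W1] from the one it ends.  The other decompositions
   serve the degenerate cases: [L'] if [sg v] starts no path, [Z] if [v] ends no path,
   [Q] for the vertices that are not the end of any path. *)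
Definition block W R k := exists W0 W1 L L' Z Q,
  [/\ forall a b, W a b = W0 a b + W1 a b,
      decomp (lam W0 W1 R) L /\ size L <= k,
      decomp (lam W0 W R) L' /\ decomp W1 Z,
      size L' + size Z <= #|R| & decomp W Q /\ size Q <= k].

Lemma block_eq W W' R k : (forall a b, W a b = W' a b) -> block W R k -> block W' R k.
Proof.
move=> E [W0 [W1 [L [L' [Z [Q [h1 h2 [h3 h4] h5 [h6 h7]]]]]]]].
exists W0, W1, L, L', Z, Q; split=> //; first by move=> a b; rewrite -E h1.
  by split=> //; apply: decomp_eq h3 => p q; rewrite /lam; case: (_ == _) => //; case: p.2; rewrite ?E.
by split=> //; apply: decomp_eq h6.
Qed.

Lemma lam_add W0 W1 W0' W1' R R' p q : [disjoint R & R'] ->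
  lam W0 W1 R p q + lam W0' W1' R' p q =
  lam (fun a b => W0 a b + W0' a b) (fun a b => W1 a b + W1' a b) (R :|: R') p q.
Proof.
move=> dR; rewrite /lam; case: (p.2 == q.2); first by case: (p.2).
rewrite inE; case: eqP => //= _; case pR: (p.1 \in R) => //=.
by rewrite (disjointFr dR pR).
Qed.

(** Rungs over disjoint sets do not clash, so every clause of [block] is additive, the bound by
    [#|R|] included. *)
Lemma block_add W W' R R' k k' : [disjoint R & R'] -> block W R k -> block W' R' k' ->
  block (fun a b => W a b + W' a b) (R :|: R') (k + k').
Proof.
move=> dR [W0 [W1 [L [L' [Z [Q [h1 [h2 s2] [h3 h4] h5 [h6 s6]]]]]]]].
move=> [X0 [X1 [M [M' [Y [P [g1 [g2 t2] [g3 g4] g5 [g6 t6]]]]]]]].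
exists (fun a b => W0 a b + X0 a b), (fun a b => W1 a b + X1 a b),
  (L ++ M), (L' ++ M'), (Z ++ Y), (Q ++ P); split.
- by move=> a b; rewrite h1 g1; lia.
- split; last by rewrite size_cat; lia.
  by apply: decomp_eq (decomp_cat h2 g2) => p q; rewrite lam_add.
- split; last exact: decomp_cat.
  by apply: decomp_eq (decomp_cat h3 g3) => p q; rewrite lam_add.
- have -> : #|R :|: R'| = #|R| + #|R'|.
    by have := dR; rewrite -leq_card_setU => /eqP.
  by rewrite !size_cat; lia.
- by split; [exact: decomp_cat | rewrite size_cat; lia].
Qed.

Lemma block0 : block (fun _ _ => 0) set0 0.
Proof.
exists (fun _ _ => 0), (fun _ _ => 0), [::], [::], [::], [::]; split=> //.
- by split=> //; apply: decomp_eq (@decomp_nil _) => p q; rewrite /lam inE andbF !if_same.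
- by split; [apply: decomp_eq (@decomp_nil _) => p q; rewrite /lam inE andbF !if_same | exact: decomp_nil].
- by split=> //; exact: decomp_nil.
Qed.

Definition row (i : bool) (z : seq V) : seq (V * bool) := [seq (v, i) | v <- z].

Lemma mem_row i z v j : ((v, j) \in row i z) = (j == i) && (v \in z).
Proof.
apply/mapP/andP => [[w wz [-> ->]]|[/eqP-> vz]]; first by rewrite eqxx.
by exists v.
Qed.

Lemma ed_row i z p q : ed (row i z) p q = if (p.2 == i) && (q.2 == i) then ed z p.1 q.1 else 0.
Proof.
case: p q => a j [c j'] /=; have [->|nj] := eqVneq j i; last first.
  by rewrite ed_notin // mem_row (negPf nj).
have [->|nj] := eqVneq j' i; last by rewrite ed_notinr // mem_row (negPf nj).
by rewrite (@ed_map _ _ (fun v => (v, i)) z a c) // => u w [].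
Qed.

Lemma row_uniq i z : uniq (row i z) = uniq z.
Proof. by rewrite map_inj_uniq // => u w []. Qed.

(** The segments run in copy [false], placed in copy [true]: they are what turns [W1] into [W]
    there. *)
Definition rows (ex : seq (bool * seq V)) := [seq row true z.2 | z <- ex & ~~ z.1].

Lemma rows_sum ex p q : \sum_(l <- rows ex) ed l p q =
  if p.2 && q.2 then csum false ex p.1 q.1 else 0.
Proof.
rewrite big_map big_filter /csum; under eq_bigr => z _ do rewrite ed_row !eqb_id.
case: (p.2 && q.2); last by rewrite big1.
by apply: eq_bigl => z; rewrite eqbF_neg.
Qed.

Lemma rows_uniq ex : all uniq [seq z.2 | z <- ex] -> all uniq (rows ex).
Proof.
move=> /allP u; apply/allP => l /mapP[z]; rewrite mem_filter => /andP[_ zx] ->.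
by rewrite row_uniq; apply: u; exact: map_f.
Qed.

Lemma ones_decomp ex : all uniq [seq z.2 | z <- ex] ->
  decomp (csum true ex) [seq z.2 | z <- ex & z.1].
Proof.
move=> /allP u; split=> [|a b].
  by apply/allP => l /mapP[z]; rewrite mem_filter => /andP[_ zx] ->; apply: u; exact: map_f.
by rewrite big_map big_filter /csum; apply: eq_bigl => z; rewrite eqb_id.
Qed.

Lemma rows_size ex : size (rows ex) + size [seq z.2 | z <- ex & z.1] = size ex.
Proof. by rewrite !size_map !size_filter addnC; exact: count_predC. Qed.

Lemma lam_fill W0 W1 R p q : lam W0 (fun a b => W0 a b + W1 a b) R p q =
  lam W0 W1 R p q + (if p.2 && q.2 then W0 p.1 q.1 else 0).
Proof. by rewrite /lam; case: p.2; case: q.2; rewrite //= ?addn0 // addnC. Qed.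

(** For [L'] the segments tagged [false] are repeated in copy [true], and [Z] consists of the
    segments tagged [true]. Each segment is thus added exactly once, which gives the bound on
    [size L + size ex]. *)
Lemma block_assemble W R k L ex Q :
    decomp (lam (csum false ex) (csum true ex) R) L ->
    all uniq [seq z.2 | z <- ex] ->
    (forall a b, W a b = csum false ex a b + csum true ex a b) ->
    decomp W Q -> size L <= k -> size Q <= k -> size L + size ex <= #|R| ->
  block W R k.
Proof.
move=> dL uex EW dQ sL sQ sz.
exists (csum false ex), (csum true ex), L, (L ++ rows ex), [seq z.2 | z <- ex & z.1], Q.
split=> //; last by rewrite size_cat -addnA rows_size.
split; last exact: ones_decomp.
case: dL => uL hL; split=> [|p q]; first by rewrite all_cat uL rows_uniq.
rewrite big_cat /= hL rows_sum -lam_fill /lam.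
by case: eqP => //= _; case: p.2.
Qed.

(* The exceptional extra path [d :: z] starts where the line [rcons l (d, true)]
   dangles in row [true]; gluing them saves one path. *)
Lemma block_assemble_glue W R k l d z L ex Q :
    decomp (lam (csum false ((false, d :: z) :: ex)) (csum true ((false, d :: z) :: ex)) R)
           (rcons l (d, true) :: L) ->
    all uniq [seq z.2 | z <- (false, d :: z) :: ex] ->
    (forall v, v \in z -> (v, true) \notin l) ->
    (forall a b, W a b = csum false ((false, d :: z) :: ex) a b +
                         csum true ((false, d :: z) :: ex) a b) ->
    decomp W Q -> (size L).+1 <= k -> size Q <= k -> size L + size ex < #|R| ->
  block W R k.
Proof.
set ex' := _ :: ex => dL uex nz EW dQ sL sQ sz.
exists (csum false ex'), (csum true ex'), (rcons l (d, true) :: L),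
  ((rcons l (d, true) ++ row true z) :: L ++ rows ex), [seq z.2 | z <- ex' & z.1], Q.
split=> //; last by rewrite /= size_cat addSn -addnA rows_size.
split; last exact: ones_decomp.
case: dL => /andP[ul uL] hL; move: (uex) => /= /andP[/andP[dz uz] uex2]; split=> [|p q].
  have uR : all uniq (rows ex) by apply: rows_uniq.
  have {}uL : all uniq L by [].
  rewrite -[all _ _]/(uniq _ && all uniq (L ++ rows ex)) all_cat uL uR !andbT.
  rewrite cat_uniq ul row_uniq uz andbT /=.
  apply/hasPn => -[v i]; rewrite mem_row => /andP[/eqP-> vz]; rewrite mem_rcons in_cons negb_or nz // andbT.
  by rewrite xpair_eqE andbT; apply: contraNneq dz => <-.
rewrite big_cons big_cat /= cat_rcons ed_cat rows_sum.
have := hL p q; rewrite big_cons => hpq.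
have -> : ed ((d, true) :: row true z) p q = ed (row true (d :: z)) p q by [].
rewrite ed_row !eqb_id /=.
have -> : lam (csum false ex') W R p q =
   lam (csum false ex') (csum true ex') R p q + (if p.2 && q.2 then csum false ex' p.1 q.1 else 0).
  by rewrite -lam_fill /lam; case: eqP => //= _; case: p.2.
rewrite -hpq /ex' /csum big_cons /=; case: (p.2 && q.2); lia.
Qed.

End Block.

Lemma nat_or (r b c : bool) : r = b + c :> nat -> (b || c) = r :> nat.
Proof. by case: r b c => [] [] []. Qed.

Lemma nat_or3 (r b c e : bool) : r = b + c + e :> nat -> (b || c) + e = r :> nat.
Proof. by case: r b c e => [] [] [] []. Qed.

(** * Paths and pairs of paths as blocks *)

Section Blocks.
Variable V : finType.
Implicit Types (R : {set V}) (s : seq V) (M : pred V) (x d v : V).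

Lemma sum_mem_count M s : uniq s -> \sum_(v : V) ((v \in s) && M v) = count M s.
Proof.
move=> us; rewrite -big_mkcond /= sum1_card -size_filter.
rewrite -(card_uniqP (filter_uniq M us)); apply: eq_card => v.
by rewrite mem_filter andbC.
Qed.

Lemma card_sum R : #|R| = \sum_v (v \in R).
Proof. by rewrite -sum1_card big_mkcond. Qed.

Lemma sum_eq1 x : \sum_v (v == x) = 1.
Proof. by rewrite -big_mkcond /= sum1_card card1. Qed.

Lemma zig_rung_uniq M x s : uniq (x :: s) -> uniq ((x, true) :: zig M false x s).
Proof. by move=> u; rewrite cons_uniq zig_uniq // andbT (zig_other M false). Qed.

Lemma zig_rung M x s p q : uniq (x :: s) ->
  ed ((x, true) :: zig M false x s) p q =
  if p.2 == q.2 then wcol M p.2 false x s p.1 q.1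
  else (p.1 == q.1) && ((p.1 == x) || (p.1 \in s) && M p.1).
Proof.
case: p q => a i [c j] u; have [t E] := zig_head M false x s.
have -> : ed ((x, true) :: zig M false x s) (a, i) (c, j) =
   link (x, true) (x, ~~ true) (a, i) (c, j) + ed (zig M false x s) (a, i) (c, j).
  by rewrite E.
rewrite zig_ed // link_rung /=; have [->|nij] := eqVneq i j; first by rewrite !andbF.
rewrite andbT; have [->|nac] := eqVneq a c; last first.
  by rewrite addn0; apply/eqP; rewrite eqb0; apply: contra nac => /andP[/eqP-> /eqP->].
rewrite andbb /=; have [->|] := eqVneq c x; last by [].
by move: u => /= /andP[/negPf-> _].
Qed.

(** The zigzag begins with the rung at [x]. Since the last vertex is marked, there are [#|R| - 1]
    segments, and with the zigzag itself the bound is attained. The sum of truth values in the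
    hypothesis expresses that [R] is a disjoint union. *)
Lemma path_block x y s M R : uniq [:: x, y & s] -> M (last y s) ->
    (forall v, v \in R = (v == x) + ((v \in y :: s) && M v) :> nat) ->
  block (ed [:: x, y & s]) R 1.
Proof.
move=> u Ml hR; set t := y :: s.
apply: (@block_assemble _ _ R _ [:: (x, true) :: zig M false x t]
          (allseg M false x t) [:: x :: t]) => //.
- split=> [|p q]; first by rewrite [all _ _]andbT zig_rung_uniq.
  rewrite big_seq1 zig_rung // /lam; case: ifP => _; first by case: p.2.
  by case: (p.1 == q.1); rewrite // !andTb; apply/nat_or/hR.
- exact: seg_uniq.
- by move=> a b; rewrite -(wcolD M false).
- exact: decomp1.
- have ut : uniq t by case/andP: u.
  rewrite card_sum (eq_bigr _ (fun v _ => hR v)) big_split sum_eq1 (sum_mem_count M ut).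
  by rewrite /t -(seg_size M false x) Ml /=; lia.
Qed.

Lemma seg_uniq1 M b x s : uniq (x :: s) -> uniq (seg M b x s).1.
Proof. by move=> u; case/andP: (seg_uniq M b u). Qed.

Lemma seg_uniq2 M b x s : uniq (x :: s) -> all uniq [seq z.2 | z <- (seg M b x s).2].
Proof. by move=> u; case/andP: (seg_uniq M b u). Qed.

Lemma ed_join x s t a b : ed (rev (x :: s) ++ t) a b = ed (x :: s) a b + ed (x :: t) a b.
Proof. by rewrite rev_cons cat_rcons ed_cat -rev_cons ed_rev. Qed.

Lemma join_uniq x s t : uniq (x :: s) -> uniq (x :: t) ->
  (forall v, v \in x :: s -> v \in x :: t -> v = x) -> uniq (rev (x :: s) ++ t).
Proof.
move=> us ut dis; move: (ut); rewrite cat_uniq rev_uniq us (cons_uniq x t) => /andP[xt ->].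
rewrite andTb andbT; apply/hasPn => v vt; rewrite mem_rev; apply: contra xt => vs.
by rewrite -(dis v) // in_cons vt orbT.
Qed.

(* Both lines are zigzagged through, one of them after the rung at [x]; the first
   segments that they miss are glued at [x] into a single path. *)
Lemma two_line_block x y1 s1 y2 s2 M1 M2 R :
    uniq [:: x, y1 & s1] -> uniq [:: x, y2 & s2] ->
    M1 (last y1 s1) -> M2 (last y2 s2) ->
    (forall v, v \in R = (v == x) + ((v \in y1 :: s1) && M1 v)
                       + ((v \in y2 :: s2) && M2 v) :> nat) ->
    (forall v, v \in (seg M1 false x (y1 :: s1)).1 ->
       v \in (seg M2 false x (y2 :: s2)).1 -> v = x) ->
  block (fun a b => ed [:: x, y1 & s1] a b + ed [:: x, y2 & s2] a b) R 2.
Proof.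
move=> u1 u2 l1 l2 hR dis; set t1 := y1 :: s1; set t2 := y2 :: s2.
set f1 := seg M1 false x t1; set f2 := seg M2 false x t2.
set ex := (false, rev f1.1 ++ behead f2.1) :: (f1.2 ++ f2.2).
have exE i a b : csum i ex a b = wcol M1 i false x t1 a b + wcol M2 i false x t2 a b.
  have [r1 E1] : exists r, f1.1 = x :: r := seg_head M1 false x t1.
  have [r2 E2] : exists r, f2.1 = x :: r := seg_head M2 false x t2.
  rewrite /wcol /csum /ex /allseg !big_cons big_cat /= -/f1 -/f2 E1 E2.
  by case: ifP => _ //; rewrite ed_join addnACA.
have Eb a b : csum false ex a b + csum true ex a b =
    ed [:: x, y1 & s1] a b + ed [:: x, y2 & s2] a b.
  by rewrite !exE -(wcolD M1 false) -(wcolD M2 false) -/t1 -/t2; lia.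
apply: (@block_assemble _ _ R _ [:: (x, true) :: zig M1 false x t1; zig M2 false x t2]
          ex [:: x :: t1; x :: t2]) => //.
- split=> [|p q].
    by rewrite -[all _ _]/[&& _, _ & true] andbT zig_rung_uniq // zig_uniq.
  rewrite big_cons big_seq1 zig_rung // /lam; case: p q => a i [c j].
  rewrite zig_ed //=; have [->|nij] := eqVneq i j; first by case: j; rewrite exE.
  by case: (a == c); rewrite // !andTb; apply/nat_or3/hR.
- have [r1 E1] : exists r, f1.1 = x :: r := seg_head M1 false x t1.
  have [r2 E2] : exists r, f2.1 = x :: r := seg_head M2 false x t2.
  rewrite /ex map_cons map_cat -[all _ _]/(_ && all uniq (_ ++ _)) all_cat.
  rewrite !seg_uniq2 // andbT [snd _]/= E1 E2 andbT; apply: join_uniq.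
  + by rewrite -E1 seg_uniq1.
  + by rewrite -[behead _]/r2 -E2 seg_uniq1.
  + by rewrite -E1 -[behead _]/r2 -E2.
- exact: decomp2.
(* As both lines end at marked vertices, [ex] has one element less than there are marks. Two lines
   on one side and the rung at [x] on the other make this an equality; without the gluing it would
   fail by one. *)
- have ut1 : uniq t1 by case/andP: u1.
  have ut2 : uniq t2 by case/andP: u2.
  rewrite card_sum (eq_bigr _ (fun v _ => hR v)) !big_split sum_eq1.
  have Es : size ex = (size f1.2 + size f2.2).+1 by rewrite /ex /= size_cat.
  rewrite (sum_mem_count M1 ut1) (sum_mem_count M2 ut2) Es /f1 /f2 /t1 /t2.
  by rewrite -(seg_size M1 false x) -(seg_size M2 false x) l1 l2 /=; lia.
Qed.

Lemma dangling_ed d x s p q : uniq (x :: rcons s d) ->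
  ed (rcons (row false (x :: rcons s d)) (d, true)) p q =
  if p.2 == q.2 then (if p.2 then 0 else ed (x :: rcons s d) p.1 q.1)
  else (p.1 == q.1) && (p.1 == d).
Proof.
move=> u; have -> : row false (x :: rcons s d) = rcons (row false (x :: s)) (d, false).
  by rewrite -rcons_cons /row map_rcons.
rewrite ed_rcons; have <- : row false (x :: rcons s d) = rcons (row false (x :: s)) (d, false).
  by rewrite -rcons_cons /row map_rcons.
case: p q => a i [c j]; rewrite ed_row -[true]/(~~ false) link_rung /=.
have [->|nij] := eqVneq i j; first by rewrite !andbF addn0; case: j.
rewrite andbT; have -> : (i == false) && (j == false) = false by case: i j nij => [] [].
have [->|nac] := eqVneq a c; first by rewrite andbb.
by apply/eqP; rewrite eqb0; apply: contra nac => /andP[/eqP-> /eqP->].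
Qed.

Lemma dangling_uniq d s : uniq s -> uniq (rcons (row false s) (d, true)).
Proof. by move=> u; rewrite rcons_uniq row_uniq u andbT mem_row. Qed.

(** With a single rung there is room for one path only: the line runs through copy [false] to [d],
    crosses there, and for [L'] returns along itself in copy [true]. *)
Lemma bounce_block x s d : uniq (x :: rcons s d) ->
  block (ed (x :: rcons s d)) [set d] 1.
Proof.
move=> u; have ur : rev (x :: rcons s d) = d :: rev (x :: s) by rewrite -rcons_cons rev_rcons.
have E i a b : csum i [:: (false, d :: rev (x :: s))] a b = if i then 0 else ed (x :: rcons s d) a b.
  by rewrite /csum big_cons big_nil [fst _]/= [snd _]/= -ur ed_rev; case: i; rewrite //= addn0.
apply: (@block_assemble_glue _ _ _ _ (row false (x :: rcons s d)) d (rev (x :: s)) [::] [::]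
  [:: x :: rcons s d]) => //.
- split=> [|p q]; first by rewrite [all _ _]andbT dangling_uniq.
  rewrite big_seq1 dangling_ed // /lam !inE.
  by case: ifP => // _; case: p.2; rewrite E.
- by rewrite -[map _ _]/[:: _ ] -ur [all _ _]andbT rev_uniq.
- by move=> v _; rewrite mem_row.
- by move=> a b; rewrite !E addn0.
- exact: decomp1.
- by rewrite cards1.
Qed.

(** Made for two lines with both ends [x] and [d] in common: the rung at [d] is spent on the first,
    so the second ends unmarked and has one segment too many. To compensate, the first line, after
    crossing at [d], is prolonged in copy [true] back along itself to [x] and on through the first
    segment of the second line. *)
Lemma two_line_glue_block x s1 d y2 s2 M2 R :
    uniq (x :: rcons s1 d) -> uniq [:: x, y2 & s2] -> ~~ M2 (last y2 s2) ->
    (forall v, v \in R = (v == x) + (v == d) + ((v \in y2 :: s2) && M2 v) :> nat) ->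
    (forall v, v \in x :: rcons s1 d ->
       v \in (seg M2 false x (y2 :: s2)).1 -> v = x) ->
  block (fun a b => ed (x :: rcons s1 d) a b + ed [:: x, y2 & s2] a b) R 2.
Proof.
move=> u1 u2 l2 hR dis; set t1 := rcons s1 d; set t2 := y2 :: s2.
set f2 := seg M2 false x t2.
have ur : rev (x :: t1) = d :: rev (x :: s1) by rewrite -rcons_cons rev_rcons.
set z := rev (x :: s1) ++ behead f2.1.
have Ez : d :: z = rev (x :: t1) ++ behead f2.1 by rewrite ur.
set ex := (false, d :: z) :: f2.2.
have exE i a b : csum i ex a b = (if i then 0 else ed (x :: t1) a b) + wcol M2 i false x t2 a b.
  have [r2 E2] : exists r, f2.1 = x :: r := seg_head M2 false x t2.
  rewrite /wcol /csum /ex /allseg !big_cons ![fst _]/= ![snd _]/= -/f2 Ez E2.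
  by case: i => //=; rewrite ed_join addnA.
have Eb a b : csum false ex a b + csum true ex a b =
    ed (x :: t1) a b + ed [:: x, y2 & s2] a b.
  by rewrite !exE -(wcolD M2 false x t2) -addnA.
have uz : uniq (d :: z).
  have [r2 E2] : exists r, f2.1 = x :: r := seg_head M2 false x t2.
  rewrite Ez E2 -[behead _]/r2; apply: join_uniq; rewrite -?E2 //; exact: seg_uniq1.
apply: (@block_assemble_glue _ _ R _ (row false (x :: t1)) d z [:: (x, true) :: zig M2 false x t2]
          f2.2 [:: x :: t1; x :: t2]) => //.
- split=> [|p q].
    by rewrite -[all _ _]/[&& _, _ & true] andbT zig_rung_uniq // dangling_uniq.
  rewrite big_cons big_seq1 zig_rung // /lam dangling_ed // -/ex.
  case: eqP => _; first by case: p.2; rewrite exE.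
  have := hR p.1; case: (p.1 == q.1) => //=; rewrite -addnA addnCA => /esym.
  by case: (_ == d) (_ == x) (_ && _) (_ \in R) => [] [] [] [].
- by apply/andP; split; [exact: uz | exact: (seg_uniq2 M2 false u2)].
- by move=> v _; rewrite mem_row.
- exact: decomp2.
- have ut2 : uniq t2 by case/andP: u2.
  rewrite card_sum (eq_bigr _ (fun v _ => hR v)) !big_split !sum_eq1 (sum_mem_count M2 ut2).
  by rewrite /f2 /t2 -(seg_size M2 false x) (negPf l2) /=; lia.
Qed.

End Blocks.

(** * Products of a block with a path system *)

Lemma sorted_ed (T : eqType) (e : rel T) s :
  (forall p q, 0 < ed s p q -> e p q) -> sorted e s.
Proof.
elim: s => // x [|y s] IH // h; rewrite /= h ?ed_cons2 /link ?eqxx //.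
by apply: IH => p q pq; apply: h; rewrite ed_cons2 addn_gt0 pq orbT.
Qed.

Section Lift.
Variables (V U : eqType) (u w : U) (mid : seq U).
Hypothesis upath : uniq (u :: rcons mid w).
Implicit Types (l : seq (V * bool)) (i : bool).

Definition ladder_step (p q : V * bool) := (p.1 == q.1) (+) (p.2 == q.2).

Definition pos i := if i then w else u.
Definition inner i := if i then rev mid else mid.

(** A rung becomes a copy of the path of [H], whose inner vertices are inserted in reverse when the
    rung leaves copy [true]. *)
Fixpoint lift l : seq (V * U) :=
  if l is p :: l' then (p.1, pos p.2) ::
    (if l' is q :: _ then if p.1 == q.1 then [seq (p.1, x) | x <- inner p.2] else [::]
     else [::]) ++ lift l'
  else [::].

Lemma lift_cons2 p q l : lift [:: p, q & l] = ((p.1, pos p.2) ::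
  (if p.1 == q.1 then [seq (p.1, x) | x <- inner p.2] else [::])) ++ lift (q :: l).
Proof. by []. Qed.

Lemma lift_head p l : exists t, lift (p :: l) = (p.1, pos p.2) :: t.
Proof. by eexists. Qed.

Lemma ed_fiber (b : V) (s : seq U) a y c z :
  ed [seq (b, x) | x <- s] (a, y) (c, z) = ((a == b) && (c == b)) * ed s y z.
Proof.
have [->|nab] := eqVneq a b; last first.
  by rewrite ed_notin //; apply: contra nab => /mapP[x _ [->]].
have [->|ncb] := eqVneq c b; last first.
  by rewrite ed_notinr //; apply: contra ncb => /mapP[x _ [->]].
by rewrite mul1n (@ed_map _ _ (pair b)) // => ? ? [].
Qed.

Lemma inner_path i : pos i :: rcons (inner i) (pos (~~ i)) =
  if i then rev (u :: rcons mid w) else u :: rcons mid w.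
Proof. by case: i; rewrite //= rev_cons rev_rcons. Qed.

Lemma ed_lift_step p q a y c z : ladder_step p q ->
  ed (rcons ((p.1, pos p.2) :: (if p.1 == q.1 then [seq (p.1, x) | x <- inner p.2] else [::]))
       (q.1, pos q.2)) (a, y) (c, z) =
    (a == c) * link p q (a, false) (a, true) * ed (u :: rcons mid w) y z
    + (y == z) * ((y == u) * link p q (a, false) (c, false) + (y == w) * link p q (a, true) (c, true)).
Proof.
case: p q => b i [b' j]; rewrite /ladder_step [fst _]/= [fst _]/= ![snd _]/=.
case: eqVneq => [<-|nb]; last first.
  rewrite addFb => /eqP<-; rewrite /= addn0 !link_row.
  case: (eqVneq y z) => [<-|nyz].
    rewrite [X in _ = X + _](_ : _ = 0) ?add0n; last by case: i; rewrite ?andbF ?muln0.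
    by rewrite [nat_of_bool true]/= mul1n andbA andbb; case: i; rewrite /= ?muln0 ?addn0 ?add0n mulnb.
  rewrite mul0n addn0; case: i => /=; rewrite ?andbF ?muln0 ?mul0n; apply/eqP; rewrite eqb0;
  by apply: contra nyz => /and3P[/eqP-> /eqP->].
rewrite -[j]negbK; case: eqVneq => // nij _.
have -> : j = ~~ i by case: i j nij => [] [].
rewrite negbK -rcons_cons -[(b, pos i)]/((fun x => (b, x)) (pos i)) -map_cons -map_rcons rcons_cons inner_path.
rewrite ed_fiber !link_rung /= !andbF !muln0 addn0 andbT andbb.
have -> : ed (if i then rev (u :: rcons mid w) else u :: rcons mid w) y z = ed (u :: rcons mid w) y z.
  by case: (i); rewrite ?ed_rev.
congr (_ * _); case: (eqVneq a b) => [->|_]; last by rewrite muln0.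
by rewrite eq_sym muln1.
Qed.

Lemma ed_lift l a y c z : sorted ladder_step l ->
  ed (lift l) (a, y) (c, z) =
    (a == c) * ed l (a, false) (a, true) * ed (u :: rcons mid w) y z
    + (y == z) * ((y == u) * ed l (a, false) (c, false) + (y == w) * ed l (a, true) (c, true)).
Proof.
elim: l => [_|p [|q l] IH]; first by rewrite /= !muln0.
  by move=> _; rewrite /= !muln0.
move=> /andP[st /IH {}IH]; have [t E] := lift_head q l.
rewrite lift_cons2 E ed_cat -E IH ed_lift_step // !ed_cons2.
by move: (ed (u :: _) y z) (ed (q :: l)) => X F; lia.
Qed.

Lemma mem_inner i y : (y \in inner i) = (y \in mid).
Proof. by case: i; rewrite /= ?mem_rev. Qed.

Lemma pos_inner i : pos i \notin mid.
Proof.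
move: upath; rewrite /= rcons_uniq mem_rcons inE negb_or => /andP[/andP[_ um] /andP[wm _]].
by case: i.
Qed.

Lemma pos_inj : injective pos.
Proof.
move: upath; rewrite /= mem_rcons inE negb_or => /andP[/andP[/negPf nuw _] _].
by move=> [] [] //= /eqP; rewrite ?nuw // eq_sym nuw.
Qed.

Lemma lift_mem l a y : sorted ladder_step l -> (a, y) \in lift l ->
  (exists2 i, y = pos i & (a, i) \in l) \/
  (y \in mid /\ forall i, (a, i) \in l).
Proof.
elim: l => // p [|q l] IH; first by rewrite inE => _ /eqP[-> ->]; left; exists p.2; rewrite // inE -surjective_pairing.
move=> /andP[st sl]; rewrite lift_cons2 mem_cat in_cons => /orP[/orP[/eqP[-> ->]|]|/(IH sl)].
- by left; exists p.2; rewrite // -surjective_pairing mem_head.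
- case: ifP => // pq /mapP[x]; rewrite mem_inner => xm [-> ->]; right; split=> // i.
  move: st; rewrite /ladder_step pq addTb => nij.
  have [->|ni] := eqVneq i p.2; first by rewrite -surjective_pairing mem_head.
  have -> : i = q.2 by case: i p.2 q.2 ni nij => [] [] [].
  by rewrite (eqP pq) -surjective_pairing in_cons mem_head orbT.
case=> [[i -> al]|[ym al]]; first by left; exists i; rewrite // in_cons al orbT.
by right; split=> // i; rewrite in_cons al orbT.
Qed.

Lemma lift_uniq l : sorted ladder_step l -> uniq l -> uniq (lift l).
Proof.
elim: l => // p [|q l] IH // /andP[st sl] /andP[pl ul].
rewrite lift_cons2 cat_uniq IH // andbT; apply/andP; split.
  case: ifP => // _; rewrite cons_uniq map_inj_uniq; last by move=> ? ? [].
  have -> : uniq (inner p.2).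
    by move: upath; rewrite /= rcons_uniq => /andP[_ /andP[_ um]]; case: p.2; rewrite //= rev_uniq.
  rewrite andbT; apply/mapP => -[x]; rewrite mem_inner => xm [] px.
  by have := pos_inner p.2; rewrite px xm.
apply/hasPn => -[b y] /(@lift_mem (q :: l) _ _ sl) h; rewrite in_cons negb_or; apply/andP; split.
  apply: contra pl => /eqP[bp yp]; case: h => [[i]|[]].
    by rewrite yp => /pos_inj <-; rewrite bp -surjective_pairing.
  by rewrite yp (negPf (pos_inner _)).
case: ifP => // pq; apply/mapP => -[x]; rewrite mem_inner => xm [bp yx]; subst.
case: h => [[i xi]|[_ al]]; first by have := pos_inner i; rewrite -xi xm.
by have := al p.2; rewrite -surjective_pairing (negPf pl).
Qed.

End Lift.

Section Ladder.
Variable V : finType.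
Implicit Types (W : V -> V -> nat) (R : {set V}).

Lemma decomp_diag (T : eqType) (W : T -> T -> nat) D a : decomp W D -> W a a = 0.
Proof.
case=> /allP u <-; rewrite big_seq big1 // => s sD.
by rewrite ed_refl // u.
Qed.

Lemma decomp_gt0 (T : eqType) (W : T -> T -> nat) D s a b :
  decomp W D -> s \in D -> 0 < ed s a b -> 0 < W a b.
Proof.
case=> _ <- sD h; rewrite (big_rem s sD) /=; lia.
Qed.

Lemma lam_ladder W0 W1 R L l : (forall a, W0 a a = 0) -> (forall a, W1 a a = 0) ->
  decomp (lam W0 W1 R) L -> l \in L -> sorted (@ladder_step V) l.
Proof.
move=> h0 h1 dL lL; apply: sorted_ed => p q /(decomp_gt0 dL lL).
rewrite /lam /ladder_step; case: eqP => pq; last by rewrite addbF lt0b => /andP[].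
rewrite addbT; apply: contraTneq => ->; case: p.2; by rewrite ?h0 ?h1.
Qed.

End Ladder.

Lemma size_flatten_sum (I : finType) (A : {set I}) (S T : Type) (f : I -> S -> T) (G : I -> seq S) :
  size (flatten [seq [seq f v z | z <- G v] | v <- enum A]) = \sum_(v in A) size (G v).
Proof.
rewrite size_flatten /shape -map_comp sumnE big_map big_enum.
by apply: eq_bigr => v _; rewrite /= size_map.
Qed.

Section Product.
Variables (V U : finType) (g : rel V) (h : rel U) (k : nat).
Variables (N : {set U}) (mid : U -> seq U) (sg : U -> U).
Hypothesis pathP : forall v, v \in N -> uniq (v :: rcons (mid v) (sg v)).
Hypothesis sgI : {in N &, injective sg}.
Hypothesis hE : forall w z, \sum_(v in N) ed (v :: rcons (mid v) (sg v)) w z = h w z.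
Hypothesis gB : block (fun a b => g a b) [set: V] k.
Hypothesis k2 : 2 * k <= #|V|.

Lemma sum_pred1 (A : {set U}) (y : U) (F : U -> nat) :
  \sum_(v in A) (y == v) * F v = if y \in A then F y else 0.
Proof.
rewrite (eq_bigr (fun v => if v == y then F v else 0)); last first.
  by move=> v _; rewrite eq_sym; case: eqP; rewrite ?mul1n ?mul0n.
rewrite -big_mkcondr /=; case: ifP => yA; last first.
  by rewrite big_pred0 // => v; case: eqP => [->|]; rewrite ?yA ?andbF.
by rewrite (eq_bigl (pred1 y)) ?big_pred1_eq // => v /=; case: eqP => [->|]; rewrite ?yA ?andbF.
Qed.

Lemma sum_sg (y : U) (F : U -> nat) :
  \sum_(v in N) (y == sg v) * F (sg v) = if y \in sg @: N then F y else 0.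
Proof.
by rewrite -(big_imset (fun z => (y == z) * F z) sgI) /= sum_pred1.
Qed.

(** The map [sg] arranges the vertices of [H] in chains and closed orbits. With [m] for [#|V|], an
    arrow to a vertex that starts a path costs at most [m / 2]. The last arrow of a chain, together
    with the completion of the first vertex of a chain, costs at most [m]; this is affordable
    because a chain has one vertex more than it has arrows. *)
Lemma product_decomp : exists2 D : seq (seq (V * U)),
  decomp (fun p q => ((g p.1 q.1 && (p.2 == q.2)) + (h p.2 q.2 && (p.1 == q.1)))%N) D &
  2 * size D <= #|V| * #|U|.
Proof.
have [W0 [W1 [L [L' [Z [Q [gE [dL sL] [dL' dZ] s' [dQ sQ]]]]]]]] := gB.
have g0 a : g a a = 0 :> nat by exact: decomp_diag dQ.
have W00 a : W0 a a = 0 by move: (gE a a); rewrite g0; lia.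
have W10 a : W1 a a = 0 by move: (gE a a); rewrite g0; lia.
pose Lv v := if sg v \in N then L else L'.
pose Wv v := if sg v \in N then W1 else (fun a b => g a b : nat).
pose fib (v : U) (z : seq V) := [seq (x, v) | x <- z].
(* The vertices of [A] start a path but end none, so they have received [W0] only and [Z] supplies
   [W1]. Those of [B] have received nothing and take [Q]. *)
pose A := N :\: sg @: N; pose B := ~: (N :|: sg @: N).
pose D1 := flatten [seq [seq lift v (sg v) (mid v) l | l <- Lv v] | v <- enum N].
pose D2 := flatten [seq [seq fib v z | z <- Z] | v <- enum A].
pose D3 := flatten [seq [seq fib v z | z <- Q] | v <- enum B].
have dLv v : decomp (lam W0 (Wv v) [set: V]) (Lv v) by rewrite /Wv /Lv; case: ifP.
have stL v l : l \in Lv v -> sorted (@ladder_step V) l.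
  by apply: lam_ladder (dLv v) => // a; rewrite /Wv; case: ifP.
have fibI v : injective (fun x : V => (x, v)) by move=> ? ? [].
have ed_fib v z p q : ed (fib v z) p q = (p.2 == q.2) * ((p.2 == v) * ed z p.1 q.1).
  case: p q => a y [c y'] /=; have [->|ny] := eqVneq y v; last first.
    by rewrite ed_notin ?muln0 //; apply: contra ny => /mapP[x _ [_ ->]].
  have [<-|ny] := eqVneq v y'; first by rewrite /fib (@ed_map _ _ (fun x => (x, v)) z a c) //= !mul1n.
  by rewrite ed_notinr //; apply: contra ny => /mapP[x _ [_ ->]].
exists (D1 ++ D2 ++ D3); last first.
  rewrite !size_cat !size_flatten_sum !sum_nat_const.
  pose N1 := [set v in N | sg v \in N]; pose N2 := [set v in N | sg v \notin N].
  have cI : #|sg @: N| = #|N| by exact: card_in_imset.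
  have cN : #|N1| + #|N2| = #|N|.
    rewrite -(cardsID [set v | sg v \in N] N); congr (_ + _); apply: eq_card => v.
      by rewrite !inE.
    by rewrite !inE andbC.
  have cX : #|N :&: sg @: N| = #|N1|.
    rewrite -(card_in_imset (f := sg) (D := N1)); last first.
      by move=> v z; rewrite !inE => /andP[vN _] /andP[zN _]; exact: sgI.
    apply: eq_card => v; rewrite inE; apply/andP/imsetP => [[vN /imsetP[z zN vE]]|[z]].
      by exists z; rewrite // inE zN -vE.
    by rewrite inE => /andP[zN sN] ->; rewrite sN imset_f.
  (* There are as many first vertices of chains as last arrows. *)
  have cA : #|A| = #|N2| by have := cardsID (sg @: N) N; rewrite -/A cX; lia.
  have cB : #|B| + #|N| + #|N2| = #|U|.
    by have := cardsC (N :|: sg @: N); rewrite cardsU cX cI -/B; lia.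
  have -> : \sum_(v in N) size (Lv v) = #|N1| * size L + #|N2| * size L'.
    rewrite (bigID (fun v => sg v \in N)) /= -!sum_nat_const; congr (_ + _);
      apply: eq_big => v; rewrite ?inE // => /andP[_ sN]; rewrite /Lv ?sN //.
    by rewrite (negPf sN).
  move: s'; rewrite cardsT cA -cB -cN => s'.
  have h1 : 2 * (#|N1| * size L) <= #|N1| * #|V| by rewrite mulnCA leq_mul2l; lia.
  have h2 : #|N2| * size L' + #|N2| * size Z <= #|N2| * #|V| by rewrite -mulnDr leq_mul2l s' orbT.
  have h3 : 2 * (#|B| * size Q) <= #|B| * #|V| by rewrite mulnCA leq_mul2l; lia.
  rewrite !mulnDr !(mulnC #|V|); lia.
split.
  rewrite !all_cat; apply/and3P; split; apply/allP => l /flatten_mapP[v].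
  - rewrite mem_enum => vN /mapP[l' lL ->]; apply: lift_uniq (pathP vN) _ (stL _ _ lL) _.
    by case: (dLv v) => /allP u _; exact: (u _ lL).
  - by move=> _ /mapP[z zZ ->]; rewrite map_inj_uniq; [case: dZ => /allP u _; exact: (u _ zZ) | exact: fibI].
  - by move=> _ /mapP[z zQ ->]; rewrite map_inj_uniq; [case: dQ => /allP u _; exact: (u _ zQ) | exact: fibI].
case=> a y [c z]; rewrite !big_cat /= !big_flatten /= !big_map !big_enum /=.
have E1 v : v \in N -> \sum_(l <- [seq lift v (sg v) (mid v) l | l <- Lv v]) ed l (a, y) (c, z) =
   (a == c) * ed (v :: rcons (mid v) (sg v)) y z
   + (y == z) * ((y == v) * W0 a c + (y == sg v) * Wv v a c).
  move=> vN; rewrite big_map big_seq.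
  rewrite (eq_bigr (fun l => (a == c) * ed l (a, false) (a, true) * ed (v :: rcons (mid v) (sg v)) y z
    + (y == z) * ((y == v) * ed l (a, false) (c, false) + (y == sg v) * ed l (a, true) (c, true)))); last first.
    by move=> l lL; rewrite (ed_lift (pathP vN) _ _ _ _ (stL _ _ lL)).
  rewrite -big_seq big_split /= -!big_distrl /= -!big_distrr /= big_split /= -!big_distrr /=.
  by case: (dLv v) => _ dE; rewrite !dE /lam /= inE eqxx muln1.
rewrite (eq_bigr _ E1) big_split /= -!big_distrr /= hE big_split /=.
rewrite sum_pred1.
have -> : \sum_(v in N) (y == sg v) * Wv v a c =
   if y \in sg @: N then (if y \in N then W1 a c else g a c) else 0.
  rewrite -(sum_sg y (fun z => if z \in N then W1 a c else g a c)).
  by apply: eq_bigr => v _; rewrite /Wv; case: ifP.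
have E2 (S : {set U}) (X : V -> V -> nat) DX : decomp X DX ->
    \sum_(v in S) \sum_(l <- [seq fib v z | z <- DX]) ed l (a, y) (c, z) =
    (y == z) * (if y \in S then X a c else 0).
  move=> dX; rewrite -sum_pred1 big_distrr /=; apply: eq_bigr => v _.
  rewrite big_map (eq_bigr _ (fun l _ => ed_fib v l (a, y) (c, z))) /=.
  by rewrite -!big_distrr /=; case: dX => _ ->.
rewrite (E2 A W1) // (E2 B g) // !inE.
have := gE a c.
case: (y == z); case: (a == c); case: (h y z); case: (g a c);
  case: (y \in N); case: (y \in sg @: N) => /=; lia.
Qed.

End Product.

(** * Lovasz path systems *)

Section Ends.
Variable T : eqType.
Implicit Types (s t : seq T) (v : T) (D : nat -> seq T).

(* A one-vertex path has both its ends at that vertex. *)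
Definition endc s v : nat := if s is x :: s' then (x == v) + (last x s' == v) else 0.

Lemma endc_rev s v : endc (rev s) v = endc s v.
Proof.
case: s => // x s; case/lastP: s => [|s z] //.
rewrite rev_cons rev_rcons rcons_cons /= !last_rcons; exact: addnC.
Qed.

Definition upd D i s := fun j => if j == i then s else D j.

Lemma upd_sum n D i s (F : seq T -> nat) : i < n ->
  \sum_(j < n) F (upd D i s j) + F (D i) = \sum_(j < n) F (D j) + F s.
Proof.
move=> ln; rewrite (bigD1 (Ordinal ln)) //= [in RHS](bigD1 (Ordinal ln)) //= /upd eqxx.
rewrite (eq_bigr (fun j : 'I_n => F (D j))); first by clear; lia.
by move=> j; rewrite -val_eqE /= => /negPf->.
Qed.

(** A pair [(i, d)] names one of the two ends of the path [D i]; the path is read starting from that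
    end. *)
Definition dir D (p : nat * bool) := if p.2 then rev (D p.1) else D p.1.

Lemma dir_ed D p a b : ed (dir D p) a b = ed (D p.1) a b.
Proof. by rewrite /dir; case: p.2; rewrite ?ed_rev. Qed.

Lemma dir_endc D p v : endc (dir D p) v = endc (D p.1) v.
Proof. by rewrite /dir; case: p.2; rewrite ?endc_rev. Qed.

Lemma dir_uniq D p : uniq (dir D p) = uniq (D p.1).
Proof. by rewrite /dir; case: p.2; rewrite ?rev_uniq. Qed.

Lemma ed_mid s x y t : 0 < ed (s ++ x :: y :: t) x y.
Proof. by rewrite ed_cat ed_cons2 /link !eqxx addnCA. Qed.

Lemma uniq_split s s' x t t' : uniq (s ++ x :: t) -> s ++ x :: t = s' ++ x :: t' ->
  s = s' /\ t = t'.
Proof.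
elim: s s' => [|a s IH] [|a' s'] /=.
- by move=> _ [->].
- by move=> /andP[xt _] [_ E]; move: xt; rewrite E mem_cat mem_head orbT.
- by move=> /andP[ast _] [E _]; move: ast; rewrite E mem_cat mem_head orbT.
- by move=> /andP[_ u] [-> E]; have [-> ->] := IH _ u E.
Qed.

End Ends.

Section Chain.
Variables (V : finType) (y : V) (n : nat).
Implicit Types (A : {set V}) (D : nat -> seq V) (b c v : V) (K : V -> nat * bool).

(* Lovasz's exchange: to insert the edge [y b], extend a path ending at [b] to [y];
   if that path already visits [y], coming from [c], swap the edge [c y] for [b y]
   and continue with [c].  [K v] is the path end assigned to [v], and [A] contains
   the neighbours of [y] that have not been visited yet. *)
Lemma insert_edge A D b K :
    b \notin A -> b != y -> y \notin A ->
    (forall i, uniq (D i)) ->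
    (forall a c, \sum_(i < n) ed (D i) a c <= 1) ->
    \sum_(i < n) ed (D i) b y = 0 ->
    (forall v, v \in b |: A -> (K v).1 < n /\ exists t, dir D (K v) = v :: t) ->
    (forall v, v \in b |: A -> forall l c r, dir D (K v) = l ++ [:: c, y & r] -> c \in A) ->
  exists D', [/\ forall i, uniq (D' i),
    forall a c, \sum_(i < n) ed (D' i) a c = \sum_(i < n) ed (D i) a c + link y b a c &
    forall v, \sum_(i < n) endc (D' i) v + (b == v) = \sum_(i < n) endc (D i) v + (y == v)].
Proof.
elim: {A}_.+1 {-2}A (ltnSn #|A|) D b => // k IH A Ak D b bA nby yA uD D1 D0 hK hA.
have [in_ [t Et]] := hK b (setU11 _ _); set i := (K b).1 in in_; set P := dir D (K b) in Et.
have uP : uniq P by rewrite /P dir_uniq.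
have updu Q : uniq Q -> forall j, uniq (upd D i Q j).
  by move=> uQ j; rewrite /upd; case: ifP.
have [yP|yP] := boolP (y \in P); last first.
  have uQ : uniq (y :: P) by rewrite /= yP.
  exists (upd D i (y :: P)); split; first exact: updu.
    move=> a c; have := upd_sum D (y :: P) (fun s => ed s a c) in_.
    have -> : ed (y :: P) a c = link y b a c + ed P a c by rewrite Et.
    by rewrite /P dir_ed -/i; clear; lia.
  move=> v; have := upd_sum D (y :: P) (fun s => endc s v) in_.
  have : endc (y :: P) v + (b == v) = endc P v + (y == v) by rewrite Et /=; clear; lia.
  by rewrite /P dir_endc -/i; clear; lia.
have [l [r EP]] : exists l r, P = l ++ y :: r by case/splitPr: yP => l r; exists l, r.
case/lastP: l EP => [|l c] EP; first by move: nby; rewrite Et in EP; case: EP => ->; rewrite eqxx.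
rewrite cat_rcons in EP; have cA := hA _ (setU11 _ _) _ _ _ EP.
have ncb : c != b by apply: contraNneq bA => <-.
have ncy : c != y by apply: contraNneq yA => <-.
(* Swapping the edge [c y] for [b y] turns the path [b ... c y r] into [c ... b y r]. *)
pose P' := rev (rcons l c) ++ y :: r.
have [l' El] : exists l', rcons l c = b :: l'.
  by move: EP; rewrite Et -cat_rcons; case: (rcons l c) (size_rcons l c) => // x l' _ [<- _]; exists l'.
have EP' : P' = c :: rev l ++ y :: r by rewrite /P' rev_rcons.
have uP' : uniq P' by rewrite /P' cat_uniq rev_uniq has_sym has_rev has_sym -cat_uniq cat_rcons -EP.
have edP a d : ed P' a d + link c y a d = ed P a d + link b y a d.
  rewrite EP (ed_cat l) ed_cons2 /P' El rev_cons cat_rcons ed_cat -rev_cons ed_rev ed_cons2 -El.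
  by clear; lia.
have lastP z : last z P = last y r by rewrite EP last_cat.
have endP v : endc P' v + (b == v) = endc P v + (c == v).
  by rewrite EP' Et /= last_cat /= -(lastP b) Et /=; clear; lia.
(* The new path is stored with the orientation of the old one, so that a vertex assigned to its far
   end keeps its assignment. *)
pose Q' := if (K b).2 then rev P' else P'.
have edQ a d : ed Q' a d = ed P' a d by rewrite /Q'; case: ifP; rewrite ?ed_rev.
have endQ v : endc Q' v = endc P' v by rewrite /Q'; case: ifP; rewrite ?endc_rev.
have uQ : uniq Q' by rewrite /Q'; case: ifP; rewrite ?rev_uniq.
have D1E a d : \sum_(j < n) ed (upd D i Q' j) a d + link c y a d =
               \sum_(j < n) ed (D j) a d + link b y a d.
  have := upd_sum D Q' (fun s => ed s a d) in_; rewrite edQ.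
  by have := edP a d; rewrite /P dir_ed -/i; clear; lia.
have D1C v : \sum_(j < n) endc (upd D i Q' j) v + (b == v) =
             \sum_(j < n) endc (D j) v + (c == v).
  have := upd_sum D Q' (fun s => endc s v) in_; rewrite endQ.
  by have := endP v; rewrite /P dir_endc -/i; clear; lia.
have only j a d : j < n -> 0 < ed (D i) a d -> 0 < ed (D j) a d -> j = i.
  move=> jn h1 h2; apply/eqP; apply: contraT => ji; have := D1 a d; move: h1 h2.
  rewrite (bigD1 (Ordinal in_)) //= (bigD1 (Ordinal jn)) /=; first by clear; lia.
  by rewrite -val_eqE.
have icy : 0 < ed (D i) c y by rewrite -(dir_ed D (K b)) -/P EP ed_mid.
have AK v : v \in A -> v \in b |: A by rewrite !inE => ->; rewrite orbT.
(* The near end of [P] is [b], and the far end lies at [y] or beyond it; neither is [c], so [c] is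
   assigned an end of another path. *)
have Kc : (K c).1 != i.
  apply/eqP => ci; have [_ [tc Ec]] := hK c (AK _ cA).
  have [sd|sd] := eqVneq (K c).2 (K b).2.
    have KE : K c = K b by rewrite [K c]surjective_pairing ci sd -surjective_pairing.
    by move: Ec; rewrite KE -/P Et => -[] cb; rewrite cb eqxx in ncb.
  have Er : dir D (K c) = rev P.
    by rewrite /P /dir -/i ci; case: (K c).2 (K b).2 sd => [] [] //; rewrite revK.
  have cr : last y r = c by rewrite -(lastP b) -(revK P) -Er Ec rev_cons last_rcons.
  have : c \in y :: r by rewrite -cr mem_last.
  by move: uP; rewrite EP cat_uniq => /and3P[_ _] /andP[/negPf->].
have other v : v \in A -> (K v).1 = i -> (K v).2 = ~~ (K b).2.
  move=> vA vi; have [sd|] := eqVneq (K v).2 (K b).2; last by do 2!case: (_.2).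
  have [_ [tv Ev]] := hK v (AK _ vA).
  have KE : K v = K b by rewrite [K v]surjective_pairing vi sd -surjective_pairing.
  by move: Ev; rewrite KE -/P Et => -[] vb; rewrite vb vA in bA.
have dirD v : v \in A -> (K v).1 = i -> dir D (K v) = rev P.
  move=> vA vi; rewrite /P /dir vi -/i (other v vA vi).
  by case: (K b).2; rewrite //= revK.
have dirU v : v \in A -> dir (upd D i Q') (K v) =
    if (K v).1 == i then rev P' else dir D (K v).
  move=> vA; rewrite {1}/dir /upd; case: eqP => // vi.
  by rewrite (other v vA vi) /Q'; case: (K b).2; rewrite //= revK.
have inA v : v \in c |: A :\ c -> v \in A by rewrite setD1K.
have revP' : last c (rev l ++ y :: r) = last b t.
  by rewrite last_cat /= -(lastP b) Et.
have [|||||||||D' [uD' edD' endD']] := IH (A :\ c) _ (upd D i Q') c.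
- by rewrite (cardsD1 c) cA in Ak.
- by rewrite !inE eqxx.
- by [].
- by rewrite inE (negPf yA) andbF.
- exact: updu.
- move=> a d; have := D1E a d; have := D1 a d.
  have [|] := boolP (link b y a d); last by clear; lia.
  by case/orP=> /andP[/eqP-> /eqP->]; rewrite ?D0; [|under eq_bigr do rewrite ed_sym; rewrite D0]; clear; lia.
- have := D1E c y; have -> : link b y c y = false by rewrite /link (negPf ncb) (negPf ncy).
  have -> : link c y c y = true by rewrite /link !eqxx.
  by have := D1 c y; clear; lia.
- move=> v /inA vA; have [vn [tv Ev]] := hK v (AK _ vA); split=> //.
  rewrite dirU //; case: eqP => [vi|_]; last by exists tv.
  rewrite (dirD v vA vi) in Ev.
  have vE : v = last b t.
    by have := last_rcons b (rev tv) v; rewrite -rev_cons -Ev revK Et.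
  rewrite EP' lastI revP' -vE rev_rcons; by eexists.
- move=> v /inA vA l0 c0 r0; rewrite dirU //; case: eqP => [vi|vi] E0; last first.
    have c0A := hA v (AK _ vA) _ _ _ E0; rewrite !inE c0A andbT.
    apply: contra_notN vi => /eqP c0c; apply: (@only _ c y) => //.
      by case: (hK v (AK _ vA)).
    by rewrite -(dir_ed D (K v)) E0 c0c ed_mid.
  (* Read from the far end, [P'] agrees with [P] as far as [y], so the predecessor of [y] has not
     changed. *)
  have E1 : P' = rcons (rev r0) y ++ c0 :: rev l0.
    by rewrite -[P']revK E0 rev_cat !rev_cons !cat_rcons.
  rewrite /P' cat_rcons in E1.
  have [_ Er] := uniq_split uP' E1.
  have E2 : dir D (K v) = l0 ++ [:: c0, y, c & rev l].
    by rewrite (dirD v vA vi) EP Er rev_cat !rev_cons revK !cat_rcons.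
  rewrite !inE (hA v (AK _ vA) _ _ _ E2) andbT.
  by apply: contraTneq uP => c0c; rewrite EP Er c0c cat_uniq /= !inE eqxx orbT !andbF.
exists D'; split=> // [a d|v].
  by rewrite edD'; have := D1E a d; rewrite (linkC c) (linkC b); clear; lia.
by have := endD' v; have := D1C v; clear; lia.
Qed.

End Chain.

Section Lovasz.
Variable V : finType.
Implicit Types (e : rel V) (a b c v x y z : V) (D : nat -> seq V).

Definition size_rel e := #|[set p : V * V | e p.1 p.2]|.

Definition del x y e : rel V := fun a b => e a b && ~~ link x y a b.

Lemma del_sym x y e : symmetric e -> symmetric (del x y e).
Proof. by move=> es a b; rewrite /del es link_sym. Qed.

Lemma del_irr x y e : irreflexive e -> irreflexive (del x y e).
Proof. by move=> ei a; rewrite /del ei. Qed.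

Lemma del_size x y e : symmetric e -> e x y -> x != y -> size_rel (del x y e) + 2 = size_rel e.
Proof.
move=> es exy nxy; rewrite /size_rel [in RHS](cardsD1 (x, y)) inE /= exy.
rewrite [in RHS](cardsD1 (y, x)) !inE /= (es y x) exy xpair_eqE eq_sym (negPf nxy) /=.
rewrite addnA addnC; congr (_ + _); apply: eq_card => -[a b]; rewrite !inE /= /del /link !xpair_eqE.
by case: (e a b); case: ((a == x) && (b == y)); case: ((a == y) && (b == x)); rewrite ?andbF ?andbT.
Qed.

Lemma sum_le (n : nat) (F : nat -> nat) i : i < n -> F i <= \sum_(j < n) F j.
Proof. by move=> ln; rewrite (bigD1 (Ordinal ln)) //= leq_addr. Qed.

Lemma sum_gt0 (n : nat) (F : nat -> nat) : 0 < \sum_(j < n) F j -> exists2 i, i < n & 0 < F i.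
Proof.
case: (boolP [exists j : 'I_n, 0 < F j]) => [/existsP[j h] _|]; first by exists j.
rewrite negb_exists => /forallP h; rewrite big1 // => j _.
by apply/eqP; rewrite -leqn0 leqNgt h.
Qed.

Lemma endc_dir D i v : 0 < endc (D i) v -> exists d t, dir D (i, d) = v :: t.
Proof.
case E: (D i) => [|x s] //= h; have [xv|nxv] := eqVneq x v.
  by exists false, s; rewrite /dir /= E xv.
exists true; exists (rev (belast x s)); rewrite /dir /= E lastI rev_rcons.
by congr (_ :: _); apply/eqP; move: h; rewrite (negPf nxv) add0n lt0b.
Qed.

(** An inductive form of Lovasz's theorem. The lower bound provides the path ends that the exchange
    works with, and the smaller upper bound at [a] leaves room for the end created there when an
    edge at [a] is inserted. *)
Definition balanced e a := exists n D,
  [/\ forall i, uniq (D i), forall x z, \sum_(i < n) ed (D i) x z = e x z,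
      forall v, v != a -> 1 <= \sum_(i < n) endc (D i) v <= 2 &
      \sum_(i < n) endc (D i) a <= 1].

(** Inserting the edge moves one path end from [a] to [y], and with it the room for a further end
    from [y] to [a]. *)
Lemma balanced_step e a y : symmetric e -> irreflexive e -> e a y ->
  balanced (del y a e) y -> balanced e a.
Proof.
move=> es ei eay [n [D [uD DE DC Dy]]]; have nay : a != y by apply: contraTneq eay => ->; rewrite ei.
have slot v : exists p, v != y -> p.1 < n /\ exists t, dir D p = v :: t.
  have [->|nvy] := eqVneq v y; first by exists (0, false).
  have /andP[/(@sum_gt0 n (fun i => endc (D i) v))[i ln h] _] := DC v nvy.
  by have [d E] := endc_dir h; exists (i, d).
have [K hK] := choice slot.
pose A := [set c | del y a e y c].
have Ay v : v \in a |: A -> v != y.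
  by rewrite !inE => /orP[/eqP->|] //; apply: contraTneq => ->; rewrite /del ei.
have [||||||||D' [uD' D'E D'C]] := @insert_edge V y n A D a K.
- by rewrite inE /del /link !eqxx andbF.
- by [].
- by rewrite inE /del ei.
- by [].
- by move=> x z; rewrite DE; case: (del _ _ _ _ _).
- by rewrite DE /del /link !eqxx /= orbT andbF.
- by move=> v /Ay; exact: hK.
- move=> v /Ay vy l c r E; rewrite inE del_sym //.
  have [ln _] := hK v vy; have := sum_le (fun i => ed (D i) c y) ln; rewrite DE -(dir_ed D (K v)) E.
  by have := ed_mid l c y r => /leq_trans h /h; rewrite lt0b.
exists n, D'; split=> // [x z|v nva|].
- rewrite D'E DE /del; have [|//] := boolP (link y a x z); last by rewrite andbT addn0.
  by case/orP=> /andP[/eqP-> /eqP->]; rewrite ?eay ?(es y a) ?eay.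
- have := D'C v; rewrite eq_sym (negPf nva) addn0 => ->.
  have [<-|nyv] := eqVneq y v; first by have := Dy; clear; lia.
  by rewrite addn0 DC // eq_sym.
- by have := D'C a; rewrite eqxx eq_sym (negPf nay); have := DC a nay; clear; lia.
Qed.

(** Only one-vertex paths end at the isolated vertex [a]. Dropping them leaves no end there; if [b]
    has no end, a one-vertex path at [b], which counts as two ends, restores the lower bound. *)
Lemma balanced_switch e a b : symmetric e -> irreflexive e -> (forall x, ~~ e a x) ->
  a != b -> balanced e b -> balanced e a.
Proof.
move=> es ei ea nab [n [D [uD DE DC Db]]].
have onlya i : i < n -> 0 < endc (D i) a -> D i = [:: a].
  move=> ln /endc_dir[d [t]]; case: t => [|x t] E.
    by move: E; rewrite /dir /=; case: d => // /(congr1 rev); rewrite revK.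
  have := sum_le (fun i => ed (D i) a x) ln.
  by rewrite DE (negPf (ea x)) -(dir_ed D (i, d)) E ed_cons2 /link !eqxx.
pose D1 i := if D i == [:: a] then [::] else D i.
have uD1 i : uniq (D1 i) by rewrite /D1; case: ifP.
have D1E x z : \sum_(i < n) ed (D1 i) x z = e x z.
  by rewrite -DE; apply: eq_bigr => i _; rewrite /D1; case: eqP => // ->.
have D1a : \sum_(i < n) endc (D1 i) a = 0.
  apply: big1 => i _; rewrite /D1; case: eqP => // na; apply/eqP; rewrite -leqn0 leqNgt.
  by apply/negP => /(onlya _ (ltn_ord i)).
have D1C v : v != a -> \sum_(i < n) endc (D1 i) v = \sum_(i < n) endc (D i) v.
  move=> nva; apply: eq_bigr => i _; rewrite /D1; case: eqP => // -> /=.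
  by rewrite eq_sym (negPf nva).
have [b0|b1] := posnP (\sum_(i < n) endc (D i) b); last first.
  exists n, D1; split=> // [v nva|]; last by rewrite D1a.
  rewrite D1C //; have [->|nvb] := eqVneq v b; last exact: DC.
  by rewrite b1 (leq_trans Db).
exists n.+1, (upd D1 n [:: b]).
have S (F : seq V -> nat) : \sum_(i < n.+1) F (upd D1 n [:: b] i) = \sum_(i < n) F (D1 i) + F [:: b].
  rewrite big_ord_recr /= /upd eqxx; congr (_ + _); apply: eq_bigr => i _.
  by rewrite (ltn_eqF (ltn_ord i)).
split=> [i|x z|v nva|].
- by rewrite /upd; case: ifP.
- by rewrite (S (fun s => ed s x z)) D1E addn0.
- rewrite (S (fun s => endc s v)) D1C // /=; have [<-|nbv] := eqVneq b v; first by rewrite b0.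
  by rewrite addn0 DC // eq_sym.
- by rewrite (S (fun s => endc s a)) D1a /= eq_sym (negPf nab).
Qed.

Lemma balanced_empty e a : (forall x z, ~~ e x z) -> balanced e a.
Proof.
move=> e0; pose L := [seq [:: v] | v <- enum [set~ a]].
exists (size L), (nth [::] L).
have S (F : seq V -> nat) : \sum_(i < size L) F (nth [::] L i) = \sum_(v in [set~ a]) F [:: v].
  by rewrite -(big_mkord predT (fun i => F (nth [::] L i))) -(big_nth [::] predT F) big_map big_enum.
split=> [i|x z|v nva|].
- have [ln|ln] := ltnP i (size L); last by rewrite nth_default.
  by have /mapP[v _ ->] := mem_nth [::] ln.
- by rewrite (S (fun s => ed s x z)) big1 // (negPf (e0 _ _)).
- rewrite (S (fun s => endc s v)) (bigD1 v) /=; last by rewrite !inE.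
  by rewrite eqxx big1 // => w /andP[_ /negPf->].
- by rewrite (S (fun s => endc s a)) big1 // => w; rewrite !inE /= => /negPf->.
Qed.

Lemma balancedP e a : symmetric e -> irreflexive e -> balanced e a.
Proof.
elim: {e}_.+1 {-2}e (ltnSn (size_rel e)) a => // k IH e ek a es ei.
have step x z : e x z -> balanced e x.
  move=> exz; have nxz : z != x by apply: contraTneq exz => ->; rewrite ei.
  apply: (balanced_step es ei exz); apply: IH; rewrite ?del_sym ?del_irr //.
  - have ezx : e z x by rewrite es.
    by have := del_size es ezx nxz; move: ek; clear; lia.
  - exact: del_sym.
  - exact: del_irr.
have [/existsP[y /step]//|] := boolP [exists y, e a y].
rewrite negb_exists => /forallP ea.
have [/existsP[b /existsP[y eby]]|] := boolP [exists b, exists y, e b y].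
  apply: (balanced_switch es ei ea _ (step _ _ eby)).
  by apply: contraTneq eby => <-.
by rewrite negb_exists => /forallP h; apply: balanced_empty => x z; move: (h x); rewrite negb_exists => /forallP.
Qed.

End Lovasz.

(** * Orienting a multigraph of maximum degree two *)

Section Orientation.
Variables (I V : eqType).
Implicit Types (J : seq I) (h t : I -> V) (o : I -> bool).

Lemma sum_change J (F G : I -> nat) j : uniq J -> j \in J -> (forall k, k != j -> F k = G k) ->
  \sum_(k <- J) F k + G j = \sum_(k <- J) G k + F j.
Proof.
move=> uJ jJ FG; rewrite !(big_rem j jJ) /=.
have -> : \sum_(k <- rem j J) F k = \sum_(k <- rem j J) G k.
  by apply: eq_big_seq => k; rewrite mem_rem_uniq // inE => /andP[/FG].
by clear; lia.
Qed.

Lemma sum_notin J (F G : I -> nat) i : i \notin J -> (forall k, k != i -> F k = G k) ->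
  \sum_(k <- J) F k = \sum_(k <- J) G k.
Proof.
by move=> iJ FG; apply: eq_big_seq => k kJ; apply: FG; apply: contraNneq iJ => <-.
Qed.

Definition tip h t o i := if o i then t i else h i.

(* By contraction of the edge [h i, t i] into another edge meeting one of its ends. *)
Lemma orientation J h t : uniq J ->
    (forall v, \sum_(i <- J) ((h i == v) + (t i == v)) <= 2) ->
  exists o, forall v, \sum_(i <- J) (tip h t o i == v) <= 1 /\
                      \sum_(i <- J) (tip t h o i == v) <= 1.
Proof.
elim: J h t => [|i J IH] h t /=; first by exists xpred0 => v; rewrite !big_nil.
case/andP=> iJ uJ deg; pose set_o o b := fun k => if k == i then b else o k.
have tipS f g o b v : \sum_(k <- i :: J) (tip f g (set_o o b) k == v) =
    ((if b then g i else f i) == v) + \sum_(k <- J) (tip f g o k == v).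
  rewrite big_cons {1}/tip {1}/set_o eqxx; congr (_ + _).
  by apply: (sum_notin iJ) => k ki; rewrite /tip /set_o (negPf ki).
have tipD f g o v : \sum_(k <- J) ((f k == v) + (g k == v)) =
    \sum_(k <- J) (tip f g o k == v) + \sum_(k <- J) (tip g f o k == v).
  by rewrite -big_split; apply: eq_bigr => k _; rewrite /tip; case: (o k); rewrite // addnC.
have degS v : (h i == v) + (t i == v) + \sum_(k <- J) ((h k == v) + (t k == v)) <= 2.
  by have := deg v; rewrite big_cons.
have [z|] := posnP (\sum_(k <- J) ((h k == t i) + (t k == t i))).
  have [|o ho] := IH h t uJ; first by move=> v; have := degS v; clear; lia.
  (* No other edge meets [t i], so [i] may start at [h i] unless another edge already does. *)
  exists (set_o o (\sum_(k <- J) (tip h t o k == h i) != 0)) => v; rewrite !tipS.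
  have := degS (h i); rewrite eqxx (tipD _ _ o) => dh.
  rewrite (tipD _ _ o) in z.
  have [hv tv] := ho v.
  case: (eqVneq (\sum_(k <- J) (tip h t o k == h i)) 0) => /= z0.
    split.
      have [<-|_] := eqVneq (h i) v; first by rewrite z0.
      by rewrite add0n.
    have [<-|_] := eqVneq (t i) v; last by rewrite add0n.
    by move: z; clear; lia.
  split.
    have [<-|_] := eqVneq (t i) v; last by rewrite add0n.
    by move: z; clear; lia.
  have [<-|_] := eqVneq (h i) v; last by rewrite add0n.
  by move: dh z0; clear; lia.
rewrite lt0n sum_nat_seq_neq0 => /hasP[j jJ /= jt].
pose x := h i; pose y := t i.
pose sub (f : I -> V) b := fun k => if (k == j) && b then x else f k.
pose b := h j == y.
have bt : ~~ b -> t j = y.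
  by move=> nb; move: jt; rewrite (negPf nb : (h j == t i) = false) add0n eqb0 negbK => /eqP.
have subj f c : sub f c j = if c then x else f j by rewrite /sub eqxx.
(* [sub] moves the end of [j] from [y] to [x]. As [i] and [j] were the only edges at [y], none is
   left there, whence the term [2 * (y == v)]. *)
have degS' v : \sum_(k <- J) ((sub h b k == v) + (sub t (~~ b) k == v)) + 2 * (y == v) <= 2.
  have := degS v; rewrite -/x -/y.
  have /(sum_change uJ jJ) : forall k, k != j ->
      (sub h b k == v) + (sub t (~~ b) k == v) = (h k == v) + (t k == v) :> nat.
    by move=> k kj; rewrite /sub (negPf kj).
  rewrite !subj; move: bt; rewrite /b.
  case: (eqVneq (h j) y) => [-> _|_ -> //] /=; clear; lia.
have [|o ho] := IH (sub h b) (sub t (~~ b)) uJ; first by move=> v; have := degS' v; clear; lia.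
(* The direction of [i] is chosen so that [i] and [j] are traversed one after the other through
   [y]. *)
exists (set_o o (o j == b)) => v; rewrite !tipS -/x -/y; have [] := ho v; have := degS' v.
rewrite (tipD _ _ o).
have /(sum_change uJ jJ) : forall k, k != j ->
    (tip h t o k == v) = (tip (sub h b) (sub t (~~ b)) o k == v) :> nat.
  by move=> k kj; rewrite /tip /sub (negPf kj).
have /(sum_change uJ jJ) : forall k, k != j ->
    (tip t h o k == v) = (tip (sub t (~~ b)) (sub h b) o k == v) :> nat.
  by move=> k kj; rewrite /tip /sub (negPf kj).
move: (\sum_(_ <- _) _) (\sum_(_ <- _) _) (\sum_(_ <- _) _) (\sum_(_ <- _) _).
rewrite /tip !subj; move: bt; rewrite /b.
case: (eqVneq (h j) y) => [-> _|_ -> //].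
  by case: (o j); rewrite /=; clear; lia.
by case: (o j); rewrite /=; clear; lia.
Qed.
End Orientation.

Lemma path_system (V : finType) (e : rel V) : symmetric e -> irreflexive e ->
  exists (N : {set V}) (mid : V -> seq V) (sg : V -> V),
  [/\ forall v, v \in N -> uniq (v :: rcons (mid v) (sg v)), {in N &, injective sg} &
      forall x z, \sum_(v in N) ed (v :: rcons (mid v) (sg v)) x z = e x z].
Proof.
move=> es ei; have [a _|V0] := pickP (@predT V); last first.
  by exists set0, (fun=> [::]), id; split=> [v|v|v]; have := V0 v.
have [n [D [uD DE DC Da]]] := balancedP a es ei.
(* One-vertex paths only served the lower bound of [balanced]; the paths to be oriented are those
   with an edge. *)
pose J := [seq i <- iota 0 n | 1 < size (D i)].
pose h i := head a (D i); pose t i := last a (D i).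
have uJ : uniq J by rewrite filter_uniq ?iota_uniq.
have JP i : i \in J -> 1 < size (D i) by rewrite mem_filter => /andP[].
have [|o ho] := @orientation _ _ J h t uJ.
  move=> v; have : \sum_(i < n) endc (D i) v <= 2.
    by have [->|/DC/andP[]//] := eqVneq v a; exact: leq_trans Da _.
  apply: leq_trans; rewrite -(big_mkord predT (fun i => endc (D i) v)) /index_iota subn0 big_filter.
  rewrite [leqRHS](bigID (fun i => 1 < size (D i))) /=; apply: leq_trans (leq_addr _ _).
  apply: leq_sum => i; rewrite /h /t /endc; case: (D i) => //.
have inj f : (forall v, \sum_(i <- J) (f i == v) <= 1) -> {in J &, injective f}.
  move=> f1 i j iJ jJ fij; apply/eqP; apply: contraT => nij; have := f1 (f j).
  have jr : j \in rem i J by rewrite mem_rem_uniq // inE eq_sym nij.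
  by rewrite (big_rem i iJ) /= (big_rem j jr) /= fij eqxx.
have injh : {in J &, injective (tip h t o)} by apply: inj => v; have [] := ho v.
have injt : {in J &, injective (tip t h o)} by apply: inj => v; have [] := ho v.
pose N := [set v in map (tip h t o) J].
have slot v : exists i, v \in N -> i \in J /\ tip h t o i = v.
  have [|] := boolP (v \in N); last by exists 0.
  by rewrite inE => /mapP[i iJ ->]; exists i.
have [K hK] := choice slot; pose q v := dir D (K v, o (K v)).
have qE v : v \in N -> q v = v :: rcons (behead (belast v (behead (q v)))) (tip t h o (K v)).
  move=> /hK[/JP]; rewrite /q /dir /tip /h /t /=.
  case: (D (K v)) => [|x [|z s]] //= _; case: (o (K v)) => [<-|<-].
    rewrite !rev_cons; case: (lastP s) => [|s' w] //=.
    by rewrite rev_rcons /= last_rcons belast_rcons.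
  by rewrite /= [in LHS]lastI /=.
exists N, (fun v => behead (belast v (behead (q v)))), (fun v => tip t h o (K v)); split.
- by move=> v vN; rewrite -qE // dir_uniq.
- move=> v w vN wN E; have [vJ <-] := hK v vN; have [wJ <-] := hK w wN.
  by rewrite (injt _ _ vJ wJ E).
- move=> x z; have edE v : v \in N ->
      ed (v :: rcons (behead (belast v (behead (q v)))) (tip t h o (K v))) x z = ed (D (K v)) x z.
    by move=> vN; rewrite -qE // dir_ed.
  rewrite -DE; transitivity (\sum_(v in N) ed (D (K v)) x z); first exact: eq_bigr edE.
  transitivity (\sum_(i <- J) ed (D i) x z).
    rewrite (eq_bigl (fun v => v \in map (tip h t o) J)); last by move=> v; rewrite inE.
    rewrite -big_uniq ?map_inj_in_uniq //= big_map; apply: eq_big_seq => i iJ.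
    have iN : tip h t o i \in N by rewrite inE map_f.
    by have [kJ kE] := hK _ iN; rewrite (injh _ _ kJ iJ kE).
  rewrite -(big_mkord predT (fun i => ed (D i) x z)) /index_iota subn0 big_filter.
  rewrite [RHS](bigID (fun i => 1 < size (D i))) /= [X in _ + X]big1 ?addn0 //.
  by move=> i; case: (D i) => [|? []].
Qed.

(** * Forests *)

Section Walks.
Variable V : finType.
Implicit Types (e : rel V) (w : V -> V -> nat) (s c : seq V) (a b x y z v : V) (R : {set V}).

Definition diff e w : rel V := fun a b => e a b && (w a b == 0).

Lemma diff_sym e s : symmetric e -> symmetric (diff e (ed s)).
Proof. by move=> es a b; rewrite /diff es ed_sym. Qed.

Lemma diff_irr e w : irreflexive e -> irreflexive (diff e w).
Proof. by move=> ei a; rewrite /diff ei. Qed.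

Lemma diff_sub e w : subrel (diff e w) e.
Proof. by move=> a b /andP[]. Qed.

Lemma path_ed e x s a b : symmetric e -> path e x s -> 0 < ed (x :: s) a b -> e a b.
Proof.
move=> es; elim: s x => // y s IH x /andP[exy p]; rewrite ed_cons2 addn_gt0 lt0b => /orP[|]; last exact: IH.
by case/orP=> /andP[/eqP-> /eqP->] //; rewrite es.
Qed.

Lemma ed_path e x s : (forall a b, 0 < ed (x :: s) a b -> e a b) -> path e x s.
Proof.
elim: s x => // y s IH x h /=; rewrite h ?ed_cons2 /link ?eqxx //=.
by apply: IH => a b ab; apply: h; rewrite ed_cons2 addn_gt0 ab orbT.
Qed.

Lemma closed_ed_le1 x s a b : uniq (x :: s) -> 1 < size s -> ed (x :: rcons s x) a b <= 1.
Proof.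
case/lastP: s => // s y u; rewrite size_rcons ltnS -[x :: _]/(rcons (rcons (x :: s) y) x) ed_rcons.
case E: (link y x a b); last by rewrite addn0 ed_le1.
move=> s0; suff -> : ed (rcons (x :: s) y) a b = 0 by [].
have xy : ed (rcons (x :: s) y) x y = 0.
  case: s s0 u {E} => // z s _; rewrite [uniq _]/= => /and3P[xs zs _].
  have zy : z != y by apply: contraNneq zs => ->; rewrite mem_rcons mem_head.
  have xz : x != z by apply: contraNneq xs => ->; rewrite mem_head.
  rewrite [rcons _ _]/= ed_cons2 (@ed_notin _ _ x) // addn0.
  by rewrite /link eqxx [y == z]eq_sym (negPf zy) (negPf xz).
by case/orP: E => /andP[/eqP-> /eqP->] //; rewrite ed_sym.
Qed.

Definition deg e v := \sum_b e v b.
Definition odds e := [set v | odd (deg e v)].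
Definition nonisolated e := [set v | 0 < deg e v].

Lemma deg_gt0P e v : reflect (exists b, e v b) (0 < deg e v).
Proof.
apply: (iffP idP) => [|[b eb]]; last by rewrite /deg (bigD1 b) //= eb.
rewrite /deg lt0n sum_nat_eq0 negb_forall => /existsP[b]; rewrite implyTb eqb0 negbK => eb.
by exists b.
Qed.

Lemma odds_nonisolated e : odds e \subset nonisolated e.
Proof. by apply/subsetP => v; rewrite !inE; case: (deg e v). Qed.

Lemma sum_link x y v : x != y -> \sum_b link x y v b = (v == x) + (v == y).
Proof.
move=> nxy; rewrite (eq_bigr (fun b => (if v == x then (b == y) : nat else 0) + if v == y then (b == x) : nat else 0)).
  by rewrite big_split; case: (v == x); case: (v == y); rewrite /= ?sum_eq1 ?big1_eq.
move=> b _; rewrite /link; case: (eqVneq v x) => [->|_]; rewrite ?(negPf nxy) /= ?orbF ?addn0 //.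
by case: (v == y).
Qed.

Lemma ed_deg_odd e x s v : irreflexive e -> path e x s ->
  odd (\sum_b ed (x :: s) v b) = (v == x) (+) (v == last x s).
Proof.
move=> ei; elim: s x => [|y s IH] x; first by move=> _; rewrite big1 // addbb.
case/andP=> exy p; have nxy : x != y by apply: contraTneq exy => ->; rewrite ei.
rewrite (eq_bigr (fun b => link x y v b + ed (y :: s) v b)) // big_split oddD IH //=.
suff : odd (\sum_b link x y v b) = (v == x) (+) (v == y).
  by move=> ->; case: (v == x); case: (v == y); case: (v == last y s).
by rewrite sum_link // oddD !oddb.
Qed.

Lemma diffK e x s a b : symmetric e -> path e x s -> (forall a b, ed (x :: s) a b <= 1) ->
  diff e (ed (x :: s)) a b + ed (x :: s) a b = e a b.
Proof.
move=> es p h; rewrite /diff.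
have := h a b; case E: (ed (x :: s) a b) => [|[|k]] // _; first by rewrite eqxx andbT addn0.
by rewrite (path_ed es p) ?E // andbF.
Qed.

Lemma deg_diff e x s v : symmetric e -> path e x s -> (forall a b, ed (x :: s) a b <= 1) ->
  deg (diff e (ed (x :: s))) v + \sum_b ed (x :: s) v b = deg e v.
Proof. by move=> es p h; rewrite -big_split; apply: eq_bigr => b _; exact: diffK. Qed.

Lemma odds_diff e x s v : symmetric e -> irreflexive e -> path e x s ->
    (forall a b, ed (x :: s) a b <= 1) ->
  (v \in odds (diff e (ed (x :: s)))) = (v \in odds e) (+) ((v == x) (+) (v == last x s)).
Proof.
move=> es ei p h; rewrite !inE -(deg_diff v es p h) oddD (ed_deg_odd v ei p).
by rewrite -addbA addbb addbF.
Qed.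

Definition acyclic e := forall c, 2 < size c -> uniq c -> ~~ cycle e c.

Lemma acyclic_sub e e' : subrel e' e -> acyclic e -> acyclic e'.
Proof. by move=> se ac c c2 uc; apply: contra (ac c c2 uc); exact: sub_cycle. Qed.

(** A second neighbour of the end [x] would lie on the path and close a cycle. *)
Lemma leaf e x y s : symmetric e -> irreflexive e -> acyclic e -> path e x (y :: s) -> uniq [:: x, y & s] ->
  (forall z, e x z -> z \in [:: x, y & s]) -> deg e x = 1.
Proof.
move=> es ei ac p u mx; have exy : e x y by case/andP: p.
rewrite /deg (bigD1 y) //= exy big1 // => b nby; apply/eqP; rewrite eqb0; apply/negP => exb.
have := mx b exb; rewrite !inE (negPf nby) /=; have [bx|_] /= := eqVneq b x.
  by rewrite bx ei in exb.
move=> bs; case/splitPr: bs p u => l r p u.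
have := ac (x :: y :: rcons l b); rewrite /= size_rcons => /(_ isT).
move: u; rewrite -cat_rcons -!cat_cons cat_uniq => /andP[u _] /(_ u)/negP[].
move: p; rewrite -cat_rcons -cat_cons cat_path => /andP[p _].
by rewrite [_ && _](rcons_path e x (y :: rcons l b)) p /= last_rcons es.
Qed.

Lemma path_rev e x s : symmetric e -> path e x s -> path e (last x s) (rev (belast x s)).
Proof. by move=> es p; rewrite rev_path (eq_path (e' := e)) // => a b; rewrite /= es. Qed.

Lemma rev_belast x s : last x s :: rev (belast x s) = rev (x :: s).
Proof. by rewrite [x :: s]lastI rev_rcons. Qed.

(** Take a longest path through [v]: all neighbours of its ends lie on it. *)
Lemma leaf_path e v : symmetric e -> irreflexive e -> acyclic e -> v \in nonisolated e ->
  exists x y s, [/\ path e x (y :: s), uniq [:: x, y & s], v \in [:: x, y & s],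
    deg e x = 1 & deg e (last y s) = 1].
Proof.
move=> es ei ac; rewrite inE => /deg_gt0P[b evb].
pose P k := `[< exists x s, [/\ path e x s, uniq (x :: s), v \in x :: s & size s = k] >].
have P1 : P 1.
  apply/asboolP; exists v, [:: b]; split=> //=; first by rewrite evb.
    by rewrite inE andbT; apply: contraTneq evb => <-; rewrite ei.
  exact: mem_head.
have Pub k : P k -> k <= #|V|.
  case/asboolP=> x [s [_ u _ <-]]; have := max_card (mem (x :: s)); rewrite (card_uniqP u) /=.
  exact: ltnW.
have [k /asboolP[x [s [p u vs <-]]] mx] := ex_maxnP (ex_intro _ 1 P1) Pub.
have end_leaf x' s' : path e x' s' -> uniq (x' :: s') -> v \in x' :: s' -> size s' = size s ->
    forall z, e x' z -> z \in x' :: s'.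
  move=> p' u' vs' ss z ez; apply: contraT => zs'; have := mx (size s').+1.
  rewrite ss ltnn; apply; apply/asboolP; exists z, (x' :: s'); split=> //=.
  - by rewrite es ez.
  - by rewrite zs'.
  - by rewrite inE vs' orbT.
  - by rewrite ss.
case: s p u vs mx end_leaf => [|y s] p u vs mx end_leaf; first by have := mx 1 P1.
exists x, y, s; split=> //.
  by apply: (leaf es ei ac p u); exact: end_leaf p u vs (erefl _).
have pr := path_rev es p; have ur : uniq (last x (y :: s) :: rev (belast x (y :: s))).
  by rewrite rev_belast rev_uniq.
have vr : v \in last x (y :: s) :: rev (belast x (y :: s)) by rewrite rev_belast mem_rev.
have sr : size (rev (belast x (y :: s))) = size (y :: s) by rewrite size_rev size_belast.
have := end_leaf _ _ pr ur vr sr; case: (rev _) pr ur sr => // y' s' pr ur _ h.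
exact: (leaf es ei ac pr ur h).
Qed.

Lemma deg_sub e e' v : subrel e' e -> deg e' v <= deg e v.
Proof. by move=> se; apply: leq_sum => b _; case E: (e' v b) => //; rewrite (se _ _ E). Qed.

(** Induction by peeling off a path between two leaves. Its ends become isolated, so two odd
    vertices disappear for one path. The rung at a vertex of [R] is assigned to the last path
    through it, the one whose removal isolates the vertex. *)
Lemma forest_block e R : symmetric e -> irreflexive e -> acyclic e ->
  odds e \subset R -> R \subset nonisolated e -> block (fun a b => e a b) R (#|odds e|./2).
Proof.
elim: {e}_.+1 {-2}e (ltnSn #|nonisolated e|) R => // k IH e ek R es ei ac oR Rn.
have [N0|[v vN]] := set_0Vmem (nonisolated e).
  have R0 : R = set0 by apply/eqP; rewrite -subset0 -N0.
  have -> : odds e = set0 by apply/eqP; rewrite -subset0 -R0.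
  rewrite R0 cards0; apply: block_eq (@block0 V) => a b.
  case E: (e a b) => //; move/setP/(_ a): N0; rewrite !inE => /negP[].
  by apply/deg_gt0P; exists b.
have [x [y [s [p u _ dx dy]]]] := leaf_path es ei ac vN.
have le1 a b : ed [:: x, y & s] a b <= 1 by exact: ed_le1.
pose e' := diff e (ed [:: x, y & s]).
have oE z : z \in odds e' = (z \in odds e) (+) ((z == x) (+) (z == last y s)).
  exact: odds_diff.
have nxy : x != last y s by apply: contraTneq u => ->; rewrite /= mem_last.
have ox : x \in odds e by rewrite inE dx.
have oy : last y s \in odds e by rewrite inE dy.
have oE' : odds e' = odds e :\ x :\ last y s.
  apply/setP => z; rewrite oE !in_setD1.
  have [->|nz] := eqVneq z (last y s); first by rewrite eq_sym (negPf nxy) oy.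
  by have [->|nz'] := eqVneq z x; rewrite ?ox ?addbF.
have inp z : z \in nonisolated e -> z \notin nonisolated e' -> z \in [:: x, y & s].
  rewrite !inE => /deg_gt0P[b eb] z0; apply/negPn/negP => zp.
  have := ed_notin b (_ : z \notin [:: x, y & s]); rewrite !inE zp => /(_ isT) E.
  by case/negP: z0; apply/deg_gt0P; exists b; rewrite /e' /diff eb E.
have d0 z : deg e z = 1 -> z \in odds e -> z \notin odds e' -> z \notin nonisolated e'.
  move=> d1 _ zo; have := deg_sub z (@diff_sub e (ed [:: x, y & s])); rewrite -/e' d1.
  by move: zo; rewrite !inE; case: (deg e' z) => [|[|]].
have xN : x \notin nonisolated e' by apply: d0; rewrite // oE' !inE eqxx andbF.
have yN : last y s \notin nonisolated e' by apply: d0; rewrite // oE' !inE eqxx.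
pose Rp := R :\: nonisolated e'; pose R' := R :&: nonisolated e'.
have -> : R = Rp :|: R' by rewrite setUC setID.
have -> : #|odds e|./2 = 1 + #|odds e'|./2.
  by rewrite oE' (cardsD1 x (odds e)) ox (cardsD1 (last y s) (_ :\ x)) !inE eq_sym nxy dy.
apply: (@block_eq _ (fun a b => ed [:: x, y & s] a b + e' a b)).
  by move=> a b; rewrite addnC diffK.
apply: block_add.
- by rewrite -setI_eq0 /Rp /R'; apply/eqP/setP => z; rewrite !inE; case: (0 < _); rewrite ?andbF.
- apply: (@path_block _ _ _ _ (fun z => z \in Rp)) => // [|z].
    by rewrite in_setD yN (subsetP oR).
  have [->|nz] := eqVneq z x.
    by rewrite in_setD xN (subsetP oR) //; move: u; rewrite cons_uniq => /andP[/negPf-> _].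
  rewrite add0n; case zR: (z \in Rp); rewrite ?andbF // andbT.
  move: (zR); rewrite inE => /andP[zn /(subsetP Rn)zN].
  by have := inp z zN zn; rewrite inE (negPf nz) /= => ->.
- apply: IH.
  + apply: leq_trans (_ : #|nonisolated e| <= k) => //; apply: proper_card; apply/properP; split.
      by apply/subsetP => z; rewrite !inE => /leq_trans; apply; apply: deg_sub; exact: diff_sub.
    by exists x; rewrite // inE dx.
  + exact: diff_sym.
  + exact: diff_irr.
  + by apply: acyclic_sub ac; exact: diff_sub.
  + by rewrite subsetI odds_nonisolated andbT (subset_trans _ oR) // oE' !subDset subsetU // subsetUr ?orbT.
  + exact: subsetIr.
Qed.
End Walks.

(** * Connectedness, acyclicity and edge counts *)

Section Counting.
Variable V : finType.
Implicit Types (e : rel V) (s c : seq V) (a b x y z v : V) (R S : {set V}).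

Definition arcs_on e S := \sum_(a in S) \sum_(b in S) e a b.
(** Every edge counts twice, so a bicyclic graph has [2 * #|V| + 2] arcs and a tree
    [2 * #|V| - 2]. *)
Definition arcs e := \sum_v deg e v.
Definition conn e := forall x y, connect e x y.

Lemma arcs_onT e : arcs_on e setT = arcs e.
Proof.
rewrite /arcs_on /arcs /deg; under eq_bigl => a do rewrite inE.
by apply: eq_bigr => a _; apply: eq_bigl => b; rewrite inE.
Qed.

(** By connectedness some edge leaves [S]; taking its far end into [S] adds at least the two arcs of
    that edge. *)
Lemma arcs_on_grow e S : conn e -> symmetric e -> S != set0 ->
  arcs_on e S + 2 * #|~: S| <= arcs e.
Proof.
move=> ce es; elim: {S}_.+1 {-2}S (ltnSn #|~: S|) => // k IH S Sk S0.
have [C0|[v vC]] := set_0Vmem (~: S).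
  by rewrite C0 cards0 muln0 addn0 -arcs_onT -(setCK S) C0 setC0.
have [z zS] := set0Pn _ S0; have vS : v \notin S by rewrite -in_setC.
have [a [b [aS bS eab]]] : exists a b, [/\ a \in S, b \notin S & e a b].
  have /connectP[p pe vl] := ce z v; elim: p z zS pe vl => [|w p IHp] z zS /=.
    by move=> _ vz; rewrite vz zS in vS.
  case/andP=> ezw pe vl; have [wS|wS] := boolP (w \in S); first exact: IHp pe vl.
  by exists z, w.
have cS : #|~: S| = (#|~: (b |: S)|).+1.
  by rewrite (cardsD1 b) inE bS setCU setDE setIC.
have bS0 : b |: S != set0 by apply/set0Pn; exists b; rewrite setU11.
have := IH (b |: S); rewrite cS in Sk *; move=> /(_ Sk bS0); apply: leq_trans.
rewrite mulnS addnA leq_add2r /arcs_on (big_setU1 _ bS) /=.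
rewrite [X in _ <= _ + X](eq_bigr (fun i => e i b + \sum_(j in S) e i j)); last first.
  by move=> c _; rewrite (big_setU1 _ bS).
rewrite big_split /= (big_setU1 _ bS) /=; set Z := \sum_(i in S) \sum_(j in S) _.
have -> : \sum_(i in S) e i b = 1 + \sum_(i in S | i != a) e i b by rewrite (bigD1 a) //= eab.
have -> : \sum_(i in S) e b i = 1 + \sum_(i in S | i != a) e b i by rewrite (bigD1 a) //= es eab.
by clear; lia.
Qed.

Lemma conn_arcs e : conn e -> symmetric e -> 2 * #|V| <= arcs e + 2.
Proof.
move=> ce es; have [V0|] := posnP #|V|; first by rewrite V0.
case/card_gt0P=> r _; have := @arcs_on_grow e [set r] ce es.
have -> : [set r] != set0 by apply/set0Pn; exists r; rewrite set11.
by move=> /(_ isT); have := cardsC [set r]; rewrite cards1; clear; lia.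
Qed.

Lemma conn_diff e s : symmetric e -> conn e ->
  (forall a b, 0 < ed s a b -> connect (diff e (ed s)) a b) -> conn (diff e (ed s)).
Proof.
move=> es ce h x y; have : connect e x y by []; apply: connect_sub => a b eab.
have [z|] := posnP (ed s a b); last exact: h.
by apply: connect1; rewrite /diff eab z.
Qed.

Lemma sum_ed e x s : irreflexive e -> path e x s -> \sum_a \sum_b ed (x :: s) a b = 2 * size s.
Proof.
move=> ei; elim: s x => [|y s IH] x p; first by rewrite big1 // => a _; rewrite big1.
case/andP: p => exy p; have nxy : x != y by apply: contraTneq exy => ->; rewrite ei.
rewrite mulnS -(IH _ p) -[2]/(1 + 1) -{1}(sum_eq1 x) -(sum_eq1 y) -!big_split.
by apply: eq_bigr => a _; transitivity (\sum_b link x y a b + \sum_b ed (y :: s) a b);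
  [rewrite -big_split | rewrite sum_link].
Qed.

Lemma arcs_diff e x s : symmetric e -> irreflexive e -> path e x s ->
  (forall a b, ed (x :: s) a b <= 1) -> arcs (diff e (ed (x :: s))) + 2 * size s = arcs e.
Proof.
move=> es ei p le1; rewrite -(sum_ed ei p) -big_split; apply: eq_bigr => a _.
exact: deg_diff.
Qed.

Lemma path_diff e x s w : symmetric e -> path e x s ->
  (forall a b, 0 < ed (x :: s) a b -> w a b = 0) -> path (diff e w) x s.
Proof.
by move=> es p h; apply: ed_path => a b ab; rewrite /diff (path_ed es p ab) (h _ _ ab).
Qed.

Lemma last_connect e x s : path e x s -> connect e x (last x s).
Proof. by move=> p; apply/connectP; exists s. Qed.

Lemma cycle_connect e x s : symmetric e -> uniq (x :: s) -> 1 < size s -> cycle e (x :: s) ->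
  connect (diff e (ed [:: last x s; x])) x (last x s).
Proof.
move=> es u s1; rewrite [cycle _ _]/= rcons_path => /andP[p _].
apply: last_connect; apply: path_diff => // a b ab.
have := closed_ed_le1 a b u s1; case/lastP: s p ab {u s1} => [//|s y] _ ab.
rewrite -[x :: _]/(rcons (rcons (x :: s) y) x) ed_rcons last_rcons [ed [:: y; x] a b]/= !addn0.
rewrite -[x :: rcons s y]/(rcons (x :: s) y) in ab; move: ab; clear.
by move: (ed _ a b) => n; case: (link y x a b) => //=; clear; lia.
Qed.

Lemma conn_cycle e x s : symmetric e -> conn e -> uniq (x :: s) -> 1 < size s -> cycle e (x :: s) ->
  conn (diff e (ed [:: last x s; x])).
Proof.
move=> es ce u s1 c; apply: conn_diff => // a b.
have h := cycle_connect es u s1 c; rewrite [X in 0 < X]/= !addn0 lt0b; case/orP=> /andP[/eqP-> /eqP->] //.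
by rewrite (sym_connect_sym (diff_sym _ es)).
Qed.

(** Removing an edge of a cycle would leave a connected graph with fewer arcs than [conn_arcs]
    allows. *)
Lemma tree_acyclic e : symmetric e -> irreflexive e -> conn e -> arcs e + 2 <= 2 * #|V| -> acyclic e.
Proof.
move=> es ei ce le [|x s] //; rewrite /= ltnS => s1 u; apply/negP => c.
have := conn_arcs (conn_cycle es ce u s1 c) (diff_sym _ es).
have p : path e (last x s) [:: x] by move: c; rewrite /= rcons_path => /andP[_ ->].
have l1 a b : ed [:: last x s; x] a b <= 1 by rewrite ed_cons2 /= !addn0; case: link.
by have := arcs_diff es ei p l1; rewrite [size _]/=; move: le; clear; lia.
Qed.

(** Removing the edge at a leaf loses two arcs and at least one non-isolated vertex. *)
Lemma acyclic_arcs e : symmetric e -> irreflexive e -> acyclic e -> 0 < #|nonisolated e| ->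
  arcs e + 2 <= 2 * #|nonisolated e|.
Proof.
elim: {e}_.+1 {-2}e (ltnSn #|nonisolated e|) => // k IH e ek es ei ac.
case/card_gt0P=> v /(leaf_path es ei ac)[x [y [s [p u _ dx _]]]].
have exy : path e x [:: y] by move: p => /= /andP[->].
have nxy : x != y by move: u; rewrite /= inE negb_or => /andP[/andP[]].
have l1 a b : ed [:: x; y] a b <= 1 by rewrite ed_cons2 /= !addn0; case: link.
have := arcs_diff es ei exy l1; set e' := diff _ _ => aE.
have sN : nonisolated e' \subset nonisolated e :\ x.
  apply/subsetP => z; rewrite !inE => dz; have := deg_sub z (@diff_sub _ e (ed [:: x; y])).
  rewrite -/e' => le; rewrite (leq_trans dz le) andbT; apply: contraTneq dz => ->.
  have := deg_diff x es exy l1; rewrite -/e' dx; rewrite (bigD1 y) //= /link !eqxx /=; clear; lia.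
have xN : x \in nonisolated e by rewrite inE dx.
have := subset_leq_card sN; have := cardsD1 x (nonisolated e); rewrite xN => cE sz.
have [z|e0] := posnP #|nonisolated e'|.
  have -> : arcs e = 2.
    rewrite -aE /arcs big1 // => w _; apply/eqP; rewrite -leqn0 leqNgt; apply/negP => dw.
    by move/eqP: z; rewrite cards_eq0 => /eqP/setP/(_ w); rewrite !inE dw.
  have yN : y \in nonisolated e :\ x.
    by rewrite !inE eq_sym nxy; apply/deg_gt0P; exists x; rewrite es; move: exy; rewrite /= andbT.
  by rewrite cE (cardsD1 y) yN; clear; lia.
have := IH e' _ (diff_sym _ es) (diff_irr _ ei) (acyclic_sub (@diff_sub _ _ _) ac) e0.
by move: aE sz ek; rewrite cE [size _]/=; clear; lia.
Qed.

End Counting.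

(** * Cycles, bowties and thetas as blocks *)

Section Pieces.
Variable V : finType.
Implicit Types (e F g : rel V) (s t l c : seq V) (a b d x y z u v w : V) (R S : {set V}).

(** The condition on [G] that [product_decomp] consumes: rungs everywhere, at half a path per
    vertex. *)
Definition half_block g := exists2 k, 2 * k <= #|V| & block (fun a b => g a b) [set: V] k.

(** The rungs off [R] fall to the forest, so no vertex off [R] may be isolated in it. The odd
    vertices of the forest are ends of its paths and need their rungs there, so they lie off [R]. *)
Lemma half_block_of_forest g F W R k : symmetric F -> irreflexive F -> acyclic F ->
    (forall a b, F a b + W a b = g a b) -> block W R k ->
    odds F \subset ~: R -> ~: R \subset nonisolated F -> 2 * k <= #|~: odds F| ->
  half_block g.
Proof.
move=> Fs Fi Fa FW bW oR Rn le.
exists (k + #|odds F|./2).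
  by have := cardsC (odds F); move: le; clear; lia.
rewrite -(setUCr R); apply: (@block_eq _ (fun a b => W a b + F a b)).
  by move=> a b; rewrite addnC.
by apply: block_add bW (forest_block _ _ _ oR Rn); rewrite // disjoints_subset setCK.
Qed.

Lemma card_uniq_le s (A : {set V}) : uniq s -> {subset s <= A} -> size s <= #|A|.
Proof. by move=> us sA; rewrite -(card_uniqP us); apply: subset_leq_card; apply/subsetP. Qed.

Lemma has_split (M : pred V) s : has M s -> exists l y r, [/\ s = l ++ y :: r, M y & ~~ has M l].
Proof.
elim: s => // x s IH /=; have [Mx _|nMx] /= := boolP (M x); first by exists [::], x, s.
by case/IH=> l [y [r [-> My nl]]]; exists (x :: l), y, r; rewrite /= negb_or nMx.
Qed.

Lemma ed_cons_rev z s a b : ed (z :: rev s) a b = ed (rcons s z) a b.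
Proof. by rewrite -ed_rev rev_cons revK. Qed.

(** The vertex [x] and the next vertex [d] of [R] cut the cycle into two lines for
    [two_line_glue_block]. A third vertex of [R] stops the first segment of the second line before
    [d], so that the glued path is simple. *)
Lemma cycle_block x s R : uniq (x :: s) -> x \in R -> {subset R <= x :: s} -> 2 < #|R| ->
  block (ed (x :: rcons s x)) R 2.
Proof.
move=> u xR Rs R3.
have : has (mem R) s.
  apply: contraLR R3 => /hasPn h; rewrite -leqNgt; apply: leq_trans (_ : #|[set x]| <= _); last by rewrite cards1.
  apply: subset_leq_card; apply/subsetP => v vR; rewrite inE.
  by have := Rs v vR; rewrite inE => /orP[//|/h]; rewrite /= vR.
case/has_split=> s1 [d [s2 [sE dM s1R]]]; have dR : d \in R by [].
have s1N v : v \in s1 -> v \notin R.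
  by move=> vs; apply: contra s1R => vR; apply/hasP; exists v.
have h2 : has (mem R) s2.
  apply: contraLR R3 => /hasPn h; rewrite -leqNgt; apply: leq_trans (_ : #|[set x; d]| <= _).
    apply: subset_leq_card; apply/subsetP => v vR; rewrite !inE.
    have := Rs v vR; rewrite sE inE mem_cat inE => /or4P[->//|/s1N|->|/h]; rewrite ?orbT ?vR //=.
    by rewrite vR.
  by rewrite cards2; case: (_ != _).
have [y2 [t2 E2]] : exists y2 t2, rcons (rev s2) d = y2 :: t2.
  by case: (rev s2) => [|y2 t2]; [exists d, [::] | exists y2, (rcons t2 d)].
move: u; rewrite sE -cat_rcons cons_uniq cat_uniq mem_cat negb_or => /and3P[/andP[xs1 xs2] us1].
case/andP=> ds us2.
have ds2 : d \notin s2 by apply: contra ds => ds2; apply/hasP; exists d; rewrite // mem_rcons mem_head.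
have xd : x != d by apply: contraNneq xs1 => ->; rewrite mem_rcons mem_head.
have ds1 : d \notin s1 by move: us1; rewrite rcons_uniq => /andP[].
apply: (@block_eq _ (fun a b => ed (x :: rcons s1 d) a b + ed [:: x, y2 & t2] a b)).
  move=> a b; rewrite -E2 cat_rcons rcons_cat rcons_cons -cat_cons ed_cat rcons_cons.
  by rewrite -(ed_rev (x :: rcons (rev s2) d)) rev_cons rev_rcons revK addnC.
have memE v : (v \in y2 :: t2) = (v == d) || (v \in s2) by rewrite -E2 mem_rcons inE mem_rev.
apply: (@two_line_glue_block _ _ _ _ _ _ (fun v => (v \in R) && (v != d))).
- by rewrite cons_uniq xs1.
- by rewrite -E2 cons_uniq rcons_uniq rev_uniq mem_rcons inE negb_or !mem_rev xd xs2 ds2.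
- by rewrite -[last _ _]/(last y2 (y2 :: t2)) -E2 last_rcons eqxx andbF.
- move=> v; rewrite memE; have [->|vx] := eqVneq v x.
    by rewrite xR (negPf xd) (negPf xs2).
  have [->|vd] := eqVneq v d; first by rewrite dR andbF.
  rewrite andbT /=; case vR: (v \in R); rewrite ?andbF // andbT.
  have := Rs v vR; rewrite sE inE mem_cat inE (negPf vx) (negPf vd) /=.
  by case vs1: (v \in s1) => /=; [rewrite (negPf (s1N v vs1)) in vR | move=> ->].
- move=> v v1 v2; apply/eqP; apply: contraT => vx.
  have : v \in x :: rev s2.
    move: v2; rewrite -E2; have : has (fun v => (v \in R) && (v != d)) (rev s2).
      rewrite has_rev; case/hasP: h2 => w w2 wR; apply/hasP; exists w => //.
      by rewrite [w \in R]wR /=; apply: contraNneq ds2 => <-.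
    case/has_split=> l [w [r [-> Mw _]]]; rewrite rcons_cat rcons_cons => /(@seg_upto _ (fun v => (v \in R) && (v != d)) _ _ _ _ _ Mw).
    by rewrite -cat_rcons !inE mem_cat orbA => ->.
  rewrite inE (negPf vx) mem_rev /= => vs2.
  move: v1; rewrite inE (negPf vx) /= => v1.
  by case/negP: ds; apply/hasP; exists v.
Qed.

(** Both lines join [u1] to [u2]: one is the wedge through [z], the other takes all remaining edges.
    The rung at [v1] stops the first segment of the latter before it reaches [z]. *)
Lemma bowtie_block z u1 t1 v1 u2 t2 R :
    uniq (z :: (u1 :: rcons t1 v1) ++ u2 :: t2) -> u1 \in R -> u2 \in R -> v1 \in R ->
    {subset R <= z :: (u1 :: rcons t1 v1) ++ u2 :: t2} ->
  block (fun a b => ed (z :: rcons (u1 :: rcons t1 v1) z) a b + ed (z :: rcons (u2 :: t2) z) a b) R 2.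
Proof.
set t := rcons t1 v1 => u u1R u2R v1R Rs.
apply: (@block_eq _ (fun a b => ed (u1 :: rcons [:: z] u2) a b + ed (u1 :: t ++ z :: rev (u2 :: t2)) a b)).
  move=> a b; rewrite -(cat_cons u1) ed_cat ed_cons_rev.
  by rewrite !rcons_cons !ed_cons2 (linkC u1 z) /=; clear; lia.
have [y2 [r2 E2]] : exists y2 r2, t ++ z :: rev (u2 :: t2) = y2 :: r2.
  by rewrite /t; case: (t1) => [|y2 r2] /=; do 2!eexists.
move: u; rewrite cons_uniq mem_cat negb_or => /andP[/andP[zt zt2]].
rewrite cat_uniq => /and3P[ut dis ut2].
have disP v : v \in u2 :: t2 -> v \notin u1 :: t by move=> vt; apply: contra dis => vt1; apply/hasP; exists v.
have u2z : u2 != z by apply: contraNneq zt2 => <-; rewrite mem_head.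
have u1z : u1 != z by apply: contraNneq zt => <-; rewrite mem_head.
have u1u2 : u1 != u2 by apply: contraNneq (disP _ (mem_head u2 t2)) => <-; rewrite mem_head.
have uu1 : u1 \notin t by move: ut => /andP[].
have memE v : (v \in y2 :: r2) = [|| v \in t, v == z | v \in u2 :: t2].
  by rewrite -E2 mem_cat inE mem_rev.
rewrite E2; apply: (@two_line_glue_block _ _ _ _ _ _ (fun v => (v \in R) && (v != u2))).
- by rewrite /= !inE negb_or u1z u1u2 eq_sym u2z.
- rewrite -E2 -cat_cons cat_uniq ut /= mem_rev zt2 rev_uniq ut2 !andbT negb_or zt /=.
  by apply/hasPn => v; rewrite mem_rev => /disP.
- rewrite -[last _ _]/(last y2 (y2 :: r2)) -E2 last_cat /= rev_cons last_rcons.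
  by rewrite eqxx andbF.
- move=> v; rewrite memE; have [->|vu1] := eqVneq v u1.
    have -> : u1 \in u2 :: t2 = false.
      by apply/negP => /disP; rewrite mem_head.
    by rewrite u1R (negPf u1u2) (negPf uu1) (negPf u1z).
  have [->|vu2] := eqVneq v u2; first by rewrite u2R andbF.
  rewrite andbT /=; case vR: (v \in R); rewrite ?andbF // andbT.
  have := Rs v vR; rewrite in_cons mem_cat (in_cons u1) (negPf vu1) /=.
  by case: (v == z); case: (v \in t) => //= ->.
- move=> v v1' v2; apply/eqP; apply: contraT => vu1.
  have : v \in u1 :: t.
    move: v2; rewrite -E2 /t cat_rcons.
    apply: (@seg_upto _ (fun v => (v \in R) && (v != u2))).
    rewrite v1R /=; apply: contraNneq (disP _ (mem_head u2 t2)) => <-.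
    by rewrite inE mem_rcons mem_head orbT.
  move: v1'; rewrite !inE (negPf vu1) /= => /orP[/eqP->|/eqP-> vt].
    by move=> zt'; move: zt; rewrite inE zt' orbT.
  by have := disP _ (mem_head u2 t2); rewrite inE vt orbT.
Qed.

Lemma theta_uniq x y l1 l2 l3 : uniq [:: x, y & l1 ++ l2 ++ l3] ->
  [/\ [/\ x != y, x \notin l1, x \notin l2 & x \notin l3],
      [/\ y \notin l1, y \notin l2 & y \notin l3], [/\ uniq l1, uniq l2 & uniq l3] &
      [/\ forall v, v \in l1 -> v \notin l2, forall v, v \in l1 -> v \notin l3 &
          forall v, v \in l2 -> v \notin l3]].
Proof.
rewrite !cons_uniq in_cons !cat_uniq !mem_cat !negb_or.
case/and3P=> /and4P[-> -> -> ->] /and3P[-> -> ->] /and3P[-> /hasPn d1 /and3P[-> /hasPn d2 ->]].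
split=> //; split=> v vl; apply/negP => vl'.
- by have := d1 v; rewrite mem_cat vl' /= vl => /(_ isT).
- by have := d1 v; rewrite mem_cat vl' orbT /= vl => /(_ isT).
- by have := d2 v vl'; rewrite /= vl.
Qed.

(** Both lines start at [u2]. One passes [x] and follows the third path to [y]; the other follows
    the second path to [y] and the first one back to [x]. Each of [x] and [y] is marked only on the
    line that ends there, and the rungs at [u1] and [u3] keep the first segments apart. *)
Lemma theta_block x y u1 l1 u2 l2 u3 l3 R :
    uniq [:: x, y & (u1 :: l1) ++ (u2 :: l2) ++ u3 :: l3] ->
    x \in R -> y \in R -> u1 \in R -> u2 \in R -> u3 \in R ->
    {subset R <= [:: x, y & (u1 :: l1) ++ (u2 :: l2) ++ u3 :: l3]} ->
  block (fun a b => ed (x :: rcons (u1 :: l1) y) a b + ed (x :: rcons (u2 :: l2) y) a b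
    + ed (x :: rcons (u3 :: l3) y) a b) R 2.
Proof.
move=> u xR yR u1R u2R u3R Rs.
apply: (@block_eq _ (fun a b => ed [:: u2, x & rcons (u3 :: l3) y] a b +
    ed (u2 :: l2 ++ y :: rcons (rev (u1 :: l1)) x) a b)).
  move=> a b; rewrite -(cat_cons u2) ed_cat -rev_cons ed_cons_rev.
  by rewrite !rcons_cons !ed_cons2 (linkC u2 x) /=; clear; lia.
have [y2 [r2 E2]] : exists y2 r2, l2 ++ y :: rcons (rev (u1 :: l1)) x = y2 :: r2.
  by case: (l2) => [|y2 r2] /=; do 2!eexists.
rewrite E2; have [[xy x1 x2 x3] [y1 y2' y3] [ul1 ul2 ul3] [d12 d13 d23]] := theta_uniq u.
have xu2 : x != u2 by apply: contraNneq x2 => <-; rewrite mem_head.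
have yu2 : y != u2 by apply: contraNneq y2' => <-; rewrite mem_head.
have u2l : u2 \notin l2 by move: ul2 => /andP[].
have memE v : (v \in y2 :: r2) = [|| v \in l2, v == y, v \in u1 :: l1 | v == x].
  by rewrite -E2 mem_cat in_cons mem_rcons in_cons mem_rev [(v == x) || _]orbC.
have u23 := d23 _ (mem_head u2 l2).
have u21 : u2 \notin u1 :: l1 by apply/negP => /d12; rewrite mem_head.
apply: (@two_line_block _ _ _ _ _ _ (fun v => (v \in R) && (v != x)) (fun v => (v \in R) && (v != y))).
- move: ul3 x3 y3 u23; move: (u3 :: l3) => L ul xl yl ul'.
  rewrite !cons_uniq rcons_uniq in_cons !mem_rcons !in_cons !negb_or.
  by rewrite eq_sym xu2 [u2 == y]eq_sym yu2 ul' xy xl yl.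
- rewrite -E2; move: ul1 x1 y1 u21 d12; move: (u1 :: l1) => L ul xl yl ul' dis.
  rewrite -cat_cons cat_uniq ul2 cons_uniq rcons_uniq !mem_rcons !(in_cons x) !mem_rev rev_uniq.
  rewrite negb_or [y == x]eq_sym xy yl xl ul !andbT; apply/hasPn => v.
  rewrite in_cons mem_rcons in_cons mem_rev => /or3P[/eqP->//|/eqP->//|/dis//].
- by rewrite /= last_rcons yR eq_sym.
- by rewrite -[last _ _]/(last y2 (y2 :: r2)) -E2 last_cat /= last_rcons xR.
- move=> v; rewrite memE in_cons mem_rcons (in_cons y); have [->|vu2] := eqVneq v u2.
    by rewrite u2R ![u2 == _]eq_sym (negPf xu2) (negPf yu2) (negPf u23) (negPf u2l) (negPf u21).
  have [->|vx] := eqVneq v x; first by rewrite xR andbF xy !orbT.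
  have [->|vy] := eqVneq v y; first by rewrite yR !andbF.
  rewrite !andbT !orbF /=; case vR: (v \in R); rewrite ?andbF // !andbT.
  have := Rs v vR; rewrite in_cons (negPf vx) in_cons (negPf vy) !mem_cat (in_cons u2) (negPf vu2) !orFb.
  case v1: (v \in u1 :: l1) => /=; first by rewrite (negPf (d13 _ v1)) orbT.
  rewrite !orbF; case v2: (v \in l2) => /=; last by move=> ->.
  by rewrite (negPf (d23 _ _)) // in_cons v2 orbT.
- move=> v vA vB; apply/eqP; apply: contraT => vu2.
  have u3x : u3 != x by apply: contraNneq x3 => <-; rewrite mem_head.
  have u1y : u1 != y by apply: contraNneq y1 => <-; rewrite mem_head.
  have : v \in [:: u2; x; u3].
    by apply: (@seg_upto _ (fun v => (v \in R) && (v != x)) _ _ [:: x] u3 (rcons l3 y));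
      [rewrite u3R | exact: vA].
  have : v \in u2 :: rcons (l2 ++ y :: rev l1) u1.
    apply: (@seg_upto _ (fun v => (v \in R) && (v != y)) false _ (l2 ++ y :: rev l1) u1 [:: x]).
      by rewrite u1R.
    by move: vB; rewrite -E2 rev_cons -!cats1 -!catA.
  rewrite !in_cons (negPf vu2) mem_rcons in_cons mem_cat in_cons mem_rev /= in_nil orbF.
  move=> vB' /orP[] /eqP vE; move: vB'; rewrite {}vE.
    rewrite (negPf xy) /= => /or3P[/eqP xE|xl|xl].
    + by rewrite xE mem_head in x1.
    + by rewrite in_cons xl orbT in x2.
    + by rewrite in_cons xl orbT in x1.
  case/or4P=> [/eqP uE|ul|/eqP uE|ul].
  + by have := d13 u1 (mem_head _ _); rewrite -uE mem_head.
  + by have := d23 u3; rewrite in_cons ul orbT mem_head => /(_ isT).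
  + by rewrite -uE mem_head in y3.
  + by have := d13 u3; rewrite in_cons ul orbT mem_head => /(_ isT).
Qed.

End Pieces.

(** * Bicyclic graphs *)

Section Cases.
Variable V : finType.
Variable g : rel V.
Hypotheses (gs : symmetric g) (gi : irreflexive g) (gc : conn g) (ga : arcs g = 2 * #|V| + 2).
Implicit Types (s t l c : seq V) (a b d x y z u v w : V) (R S : {set V}).

Lemma card_gt1 : 1 < #|V|.
Proof.
rewrite ltnNge; apply/negP => /card_le1_eqP h.
suff : arcs g = 0 by rewrite ga; clear; lia.
by apply: big1 => v _; apply: big1 => w _; rewrite (h v w) // gi.
Qed.

Lemma conn_nonisolated (F : rel V) v : conn F -> v \in nonisolated F.
Proof.
move=> Fc; rewrite inE; have [w nvw] : exists w, w != v.
  by apply/existsP; rewrite -negb_forall; apply/negP => /forallP h; have := card_gt1;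
    rewrite ltnNge => /negP[]; apply/card_le1_eqP => x y _ _;
    rewrite (eqP (h x)) (eqP (h y)).
have /connectP[[|z p] /= pF vw] := Fc v w; first by rewrite vw eqxx in nvw.
by apply/deg_gt0P; exists z; case/andP: pF.
Qed.

Lemma nonisolated_off (F : rel V) s v : v \in nonisolated F -> v \notin s ->
  v \in nonisolated (diff F (ed s)).
Proof.
rewrite !inE => /deg_gt0P[b Fb] vs; apply/deg_gt0P; exists b.
by rewrite /diff Fb ed_notin.
Qed.

Lemma link_le1 x y a b : ed [:: x; y] a b <= 1.
Proof. by rewrite /= !addn0; case: link. Qed.

(** Without the wedge from [u] over [x] to [a], a spanning tree remains in which the odd vertex [a]
    has become even. The wedge bounces at [a] for one path, and a second even vertex [w] completes
    the payment. *)
Lemma bounce_case u x a w : g x u -> g x a -> u != a -> a \in odds g ->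
    conn (diff g (ed [:: u; x; a])) -> w != a -> w \notin odds (diff g (ed [:: u; x; a])) -> half_block g.
Proof.
move=> xu xa ua ao; set T := diff _ _ => Tc wa wT.
have nxu : u != x by apply: contraTneq xu => ->; rewrite gi.
have nxa : x != a by apply: contraTneq xa => ->; rewrite gi.
have un : uniq [:: u; x; a] by rewrite /= !inE negb_or nxu ua nxa.
have p : path g u [:: x; a] by rewrite /= gs xu xa.
have le1 := ed_le1 _ _ un.
have aT : a \notin odds T by rewrite odds_diff // ao eqxx [a == u]eq_sym (negPf ua).
apply: (@half_block_of_forest _ g T (ed (u :: rcons [:: x] a)) [set a] 1).
- exact: diff_sym.
- exact: diff_irr.
- apply: tree_acyclic => //; [exact: diff_sym | exact: diff_irr |].
  by have := arcs_diff gs gi p le1; rewrite ga [size _]/= -/T; clear; lia.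
- by move=> b c; rewrite diffK.
- exact: bounce_block.
- by rewrite subsetC sub1set inE.
- by apply/subsetP => v _; exact: conn_nonisolated.
- apply: (@card_uniq_le _ [:: w; a]); first by rewrite /= inE wa.
  by move=> v; rewrite !in_cons in_nil orbF in_setC => /orP[]/eqP->.
Qed.

Lemma uniq3P a b d : uniq [:: a; b; d] -> [/\ a != b, a != d & b != d].
Proof. by rewrite /= !inE negb_or andbT => /andP[/andP[-> ->] ->]. Qed.

(** If [u'] is odd, removing the wedge from [u'] to [a] makes it even; otherwise removing the wedge
    from [u] to [a] leaves it even. Either way [a] and [u'] are the two even vertices wanted. *)
Lemma bounce2 x a u u' : g x a -> g x u -> g x u' -> uniq [:: a; u; u'] -> a \in odds g ->
  conn (diff g (ed [:: u; x; a])) -> conn (diff g (ed [:: u'; x; a])) -> half_block g.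
Proof.
move=> xa xu xu' /uniq3P[au au' uu'] ao c1 c2.
have par z w : g x z -> z != a -> (w \in odds (diff g (ed [:: z; x; a]))) =
    (w \in odds g) (+) ((w == z) (+) (w == a)).
  move=> xz za; apply: odds_diff => //; first by rewrite /= gs xz xa.
  move=> b c; apply: ed_le1; rewrite /= !inE negb_or za !andbT; apply/andP; split.
    by apply: contraTneq xz => ->; rewrite gi.
  by apply: contraTneq xa => ->; rewrite gi.
rewrite eq_sym in au; rewrite eq_sym in au'; rewrite eq_sym in uu'.
have [uo|ue] := boolP (u' \in odds g).
  by apply: (@bounce_case u' x a u') => //; rewrite par // uo eqxx (negPf au').
by apply: (@bounce_case u x a u') => //; rewrite par // (negPf ue) (negPf au') (negPf uu').
Qed.

(** * Thetas *)

Section Theta.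
(** The lists are the interiors of three paths from [x] to [y]; in a simple graph at most one of
    these paths is a single edge. *)
Definition theta x y l1 l2 l3 := [/\ uniq [:: x, y & l1 ++ l2 ++ l3],
  path g x (rcons l1 y), path g x (rcons l2 y), path g x (rcons l3 y) &
  count (@nilp V) [:: l1; l2; l3] <= 1].

Lemma theta12 x y l1 l2 l3 : theta x y l1 l2 l3 -> theta x y l2 l1 l3.
Proof.
case=> u p1 p2 p3 n; split=> //; last by move: n; rewrite /= addnCA.
by rewrite (perm_uniq (s2 := [:: x, y & l1 ++ l2 ++ l3])) // !perm_cons perm_catCA.
Qed.

Lemma theta23 x y l1 l2 l3 : theta x y l1 l2 l3 -> theta x y l1 l3 l2.
Proof.
case=> u p1 p2 p3 n; split=> //; last by move: n; rewrite /= !addn0 [nilp l3 + _]addnC.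
by rewrite (perm_uniq (s2 := [:: x, y & l1 ++ l2 ++ l3])) // !perm_cons perm_cat2l perm_catC.
Qed.

Lemma rev_rcons_path x y l : path g x (rcons l y) -> path g y (rcons (rev l) x).
Proof. by move/(path_rev gs); rewrite last_rcons belast_rcons rev_cons. Qed.

Lemma theta_rev x y l1 l2 l3 : theta x y l1 l2 l3 -> theta y x (rev l1) (rev l2) (rev l3).
Proof.
case=> u p1 p2 p3 n; split; do ?exact: rev_rcons_path.
  have pr : perm_eq [:: y, x & rev l1 ++ rev l2 ++ rev l3] [:: x, y & l1 ++ l2 ++ l3].
    apply/permP => a /=; rewrite !count_cat !count_rev; clear; lia.
  by rewrite (perm_uniq pr).
by move: n; rewrite /= /nilp !size_rev.
Qed.

(** Throughout, [head y l] is the neighbour of [x] on the path with interior [l]; the default value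
    [y] is right when the path is a single edge. *)
Lemma foot_adj x y l : path g x (rcons l y) -> g x (head y l).
Proof. by case: l => [|z l] /= /andP[]. Qed.

Lemma theta_heads x y l1 l2 l3 : theta x y l1 l2 l3 -> uniq [:: head y l1; head y l2; head y l3].
Proof.
case=> /theta_uniq[_ [y1 y2 y3] _ [d12 d13 d23]] _ _ _ n.
rewrite /= !inE negb_or andbT.
have yh l l' : y \notin l -> y \notin l' -> (forall v, v \in l -> v \notin l') ->
    ~~ (nilp l && nilp l') -> head y l != head y l'.
  case: l l' => [|z l] [|z' l'] //= yl yl' d _.
  - by apply: contraNneq yl' => <-; rewrite mem_head.
  - by apply: contraNneq yl => <-; rewrite mem_head.
  - by apply: contraNneq (d z (mem_head _ _)) => ->; rewrite mem_head.
rewrite !yh //; apply: contraL n => /andP[/= -> ->]; by rewrite -ltnNge; clear; lia.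
Qed.

Lemma wedge_ed h x h' l a b : uniq (x :: l) -> h != head x l -> h' != head x l ->
  0 < ed (x :: l) a b -> ed [:: h; x; h'] a b = 0.
Proof.
move=> u nh nh' ab; apply/eqP; rewrite -leqn0 leqNgt; apply: contraL ab; rewrite -leqNgt leqn0.
have nx z : z != head x l -> ed (x :: l) x z = 0.
  case: l u {nh nh'} => [|w l] //; rewrite cons_uniq => /andP[xwl _] zw.
  have xw : x != w by apply: contraNneq xwl => ->; rewrite mem_head.
  by rewrite ed_cons2 (ed_notin _ xwl) /link (negPf zw) (negPf xw) andbF.
rewrite !ed_cons2 addn0 addn_gt0 !lt0b => /orP[]/orP[]/andP[/eqP-> /eqP->].
all: by rewrite ?nx // ed_sym nx.
Qed.

(** The third path still links [x] to [y], and from [y] the other two lead back to the far ends of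
    the removed edges. *)
Lemma theta_conn x y l1 l2 l3 : theta x y l1 l2 l3 ->
  conn (diff g (ed [:: head y l1; x; head y l2])).
Proof.
move=> th; have /uniq3P[h12 h13 h23] := theta_heads th.
case: th => u p1 p2 p3 n; have [[xy x1 x2 x3] [y1 y2 y3] [u1 u2 u3] _] := theta_uniq u.
set T := diff _ _; have Ts : symmetric T by exact: diff_sym.
have cyx : connect T x y.
  rewrite -[y in connect _ _ y](last_rcons x l3 y).
  apply: last_connect; apply: path_diff => // a b; apply: wedge_ed.
  - by rewrite cons_uniq mem_rcons in_cons negb_or xy x3 rcons_uniq y3.
  - by rewrite headI.
  - by rewrite headI.
have side l : x \notin l -> path g x (rcons l y) -> connect T x (head y l).
  move=> xl p; apply: connect_trans cyx _; rewrite (sym_connect_sym Ts).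
  case: l xl p => [|z l] xl; first by [].
  case/andP=> _ p; rewrite /= -[y in connect _ _ y](last_rcons z l y); apply: last_connect.
  apply: path_diff => // a b ab; rewrite ed_cons2.
  have xz : x \notin z :: rcons l y by rewrite -rcons_cons mem_rcons in_cons negb_or xy.
  apply/eqP; rewrite -leqn0 leqNgt; apply/negP; rewrite /= !addn0 addn_gt0 !lt0b.
  by move=> /orP[]/orP[]/andP[/eqP aE /eqP bE]; move: ab; rewrite aE bE ?(ed_notin _ xz) ?(ed_notinr _ xz).
apply: conn_diff => // a b; rewrite /= !addn0 addn_gt0 !lt0b -/T.
have s1 := side _ x1 p1; have s2 := side _ x2 p2.
by move=> /orP[]/orP[]/andP[/eqP-> /eqP->]; rewrite // (sym_connect_sym Ts).
Qed.

Lemma theta_odd x y l1 l2 l3 : theta x y l1 l2 l3 -> head y l1 \in odds g -> half_block g.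
Proof.
move=> th o; have un := theta_heads th; have [_ p1 p2 p3 _] := th.
apply: (bounce2 (foot_adj p1) (foot_adj p2) (foot_adj p3) un o).
  exact: theta_conn (theta12 th).
exact: theta_conn (theta12 (theta23 th)).
Qed.

Lemma subrel_diff (W W' : V -> V -> nat) : (forall a b, W a b = 0 -> W' a b = 0) ->
  subrel (diff g W) (diff g W').
Proof. by move=> h a b /andP[ab /eqP z]; rewrite /diff ab h. Qed.

Lemma tree_wedge u x u' : uniq [:: u; x; u'] -> g x u -> g x u' ->
  conn (diff g (ed [:: u; x; u'])) -> acyclic (diff g (ed [:: u; x; u'])).
Proof.
move=> un xu xu' c; apply: tree_acyclic => //; [exact: diff_sym | exact: diff_irr |].
have p : path g u [:: x; u'] by rewrite /= gs xu xu'.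
by have := arcs_diff gs gi p (fun a b => ed_le1 a b un); rewrite ga [size _]/=; clear; lia.
Qed.


Lemma closed_head x z s : 0 < ed (x :: rcons (z :: s) x) x z.
Proof. by rewrite rcons_cons ed_cons2 /link !eqxx. Qed.

Lemma closed_last x z s : 0 < ed (x :: rcons (rcons s z) x) x z.
Proof. by rewrite -[x :: _]/(rcons (rcons (x :: s) z) x) ed_rcons addnC /link !eqxx orbT. Qed.

Lemma wedge_closed h x h' W : (forall a b, W a b = W b a) -> 0 < W x h -> 0 < W x h' ->
  subrel (diff g W) (diff g (ed [:: h; x; h'])).
Proof.
move=> Ws W1 W2; apply: subrel_diff => a b; apply: contra_eq; rewrite -!lt0n.
rewrite !ed_cons2 addn0 addn_gt0 !lt0b.
by case/orP=> /orP[]/andP[/eqP-> /eqP->] //; rewrite Ws.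
Qed.

(** Removing a cycle changes no parity. So [x] and its three neighbours on the theta stay even and
    pay for two paths, while [x] and the two neighbours on the cycle are the three rungs that
    [cycle_block] asks for. *)
Lemma theta_cycle x y l1 l2 l3 : theta x y l1 l2 l3 -> 0 < size l1 -> 0 < size l2 ->
    x \notin odds g -> head y l1 \notin odds g -> head y l2 \notin odds g ->
    head y l3 \notin odds g ->
  half_block g.
Proof.
move=> th n1 n2 xe e1 e2 e3; have un := theta_heads th; have [u p1 p2 p3 _] := th.
have [[xy x1 x2 x3] [y1 y2 y3] [u1 u2 u3] [d12 d13 d23]] := theta_uniq u.
have /uniq3P[h12 h13 h23] := un.
have h1 : head y l1 \in l1 by case: (l1) n1 => // z l _; exact: mem_head.
have h2 : head y l2 \in l2 by case: (l2) n2 => // z l _; exact: mem_head.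
pose s := l1 ++ y :: rev l2; pose F := diff g (ed (x :: rcons s x)).
have xs : x \notin s by rewrite mem_cat in_cons mem_rev !negb_or x1 xy x2.
have us : uniq (x :: s).
  rewrite cons_uniq xs cat_uniq u1 cons_uniq rev_uniq u2 mem_rev y2 !andbT.
  by apply/hasPn => v; rewrite in_cons mem_rev => /orP[/eqP->//|v2]; apply/negP => /d12; rewrite v2.
have s1 : 1 < size s by rewrite size_cat /= addnS ltnS addn_gt0 n1.
have ps : path g x (rcons s x).
  rewrite rcons_cat rcons_cons -cat_rcons cat_path p1 last_rcons; exact: rev_rcons_path.
have le1 a b : ed (x :: rcons s x) a b <= 1 by exact: closed_ed_le1.
have oF v : (v \in odds F) = (v \in odds g).
  by rewrite odds_diff // last_rcons addbb addbF.
have xh l : x \notin l -> x != head y l.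
  by case: l => //= z l; rewrite in_cons negb_or => /andP[].
pose R := [set v | (v \in x :: s) && (v \notin odds g)].
have sP v : v \in x :: s = [|| v == x, v \in l1, v == y | v \in l2].
  by rewrite in_cons mem_cat in_cons mem_rev.
apply: (@half_block_of_forest _ g F (ed (x :: rcons s x)) R 2).
- exact: diff_sym.
- exact: diff_irr.
- have un' : uniq [:: head y l1; x; head y l2].
    by rewrite /= !inE negb_or h12 xh // [_ == x]eq_sym xh.
  apply: acyclic_sub (tree_wedge un' (foot_adj p1) (foot_adj p2) (theta_conn th)).
  apply: wedge_closed; first exact: ed_sym.
    by rewrite /s; case: (l1) n1 => //= z l _; exact: closed_head.
  rewrite /s; case: (l2) n2 => //= z l _; rewrite rev_cons -rcons_cons -rcons_cat; exact: closed_last.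
- by move=> a b; rewrite diffK.
- apply: cycle_block => //; first by rewrite in_set mem_head.
    by move=> v; rewrite in_set => /andP[].
  apply: (@card_uniq_le _ [:: x; head y l1; head y l2]).
    by rewrite /= !inE negb_or h12 !xh.
  move=> v; rewrite !in_cons in_nil orbF in_set sP.
  by case/or3P=> /eqP->; rewrite ?eqxx ?h1 ?h2 ?orbT.
- by apply/subsetP => v; rewrite oF => vo; rewrite in_setC in_set vo andbF.
- apply/subsetP => v; rewrite in_setC in_set negb_and negbK => /orP[vs|vo].
    apply: nonisolated_off; first exact: conn_nonisolated.
    by rewrite -rcons_cons mem_rcons in_cons negb_or vs andbT; apply: contraNneq vs => ->; rewrite mem_head.
  by apply: (subsetP (odds_nonisolated F)); rewrite oF.
- apply: (@card_uniq_le _ [:: x; head y l1; head y l2; head y l3]).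
    by rewrite cons_uniq un andbT !in_cons in_nil orbF !negb_or !xh.
  move=> v; rewrite !in_cons in_nil orbF in_setC oF.
  by case/or4P=> /eqP->.
Qed.

Lemma theta_even x y l1 l2 l3 : theta x y l1 l2 l3 ->
    x \notin odds g -> head y l1 \notin odds g -> head y l2 \notin odds g ->
    head y l3 \notin odds g ->
  half_block g.
Proof.
move=> th xe e1 e2 e3; have n : count (@nilp V) [:: l1; l2; l3] <= 1 by case: th.
case: (posnP (size l1)) n => [/size0nil z|n1] n.
  have [n2 n3] : 0 < size l2 /\ 0 < size l3.
    by move: n; rewrite z; case: (l2) (l3) => [|? ?] [|? ?].
  exact: theta_cycle (theta23 (theta12 th)) n2 n3 xe e2 e3 e1.
case: (posnP (size l2)) n => [/size0nil z|n2] n.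
  have n3 : 0 < size l3 by move: n n1; rewrite z; case: (l1) (l3) => [|? ?] [|? ?].
  exact: theta_cycle (theta23 th) n1 n3 xe e1 e3 e2.
exact: theta_cycle th n1 n2 xe e1 e2 e3.
Qed.

Lemma ed_rcons_mem l y a b : 0 < ed (rcons l y) a b -> (a \in l) || (b \in l).
Proof.
elim: l => // z l IH; rewrite rcons_cons headI ed_cons2 -headI addn_gt0 lt0b => /orP[|/IH]; last first.
  by rewrite !in_cons => /orP[]->; rewrite !orbT.
by case/orP=> /andP[/eqP aE /eqP bE]; rewrite ?aE ?bE mem_head ?orbT.
Qed.

Lemma parallel_ed x y l l' a b : 0 < size l -> x \notin l -> y \notin l ->
    (forall v, v \in l -> v \notin l') ->
  0 < ed (x :: rcons l y) a b -> ed (x :: rcons l' y) a b = 0.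
Proof.
move=> nl xl yl d h.
have off v : v \in l -> v \notin x :: rcons l' y.
  move=> vl; rewrite in_cons mem_rcons in_cons !negb_or d // andbT.
  by apply/andP; split; apply: contraTneq vl => ->.
suff /orP[/off|/off] : (a \in l) || (b \in l); [exact: ed_notin | exact: ed_notinr |].
case: l nl h {xl yl d off} => // z l _; rewrite rcons_cons ed_cons2 addn_gt0 lt0b.
case/orP=> [|/(@ed_rcons_mem (z :: l))//].
by case/orP=> /andP[/eqP aE /eqP bE]; rewrite ?aE ?bE mem_head ?orbT.
Qed.

Lemma theta_half_block x y l1 l2 l3 : theta x y l1 l2 l3 -> half_block g.
Proof.
move=> th; have thr := theta_rev th.
have [|h1] := boolP (head y l1 \in odds g); first exact: (theta_odd th).
have [|h2] := boolP (head y l2 \in odds g); first exact: (theta_odd (theta12 th)).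
have [|h3] := boolP (head y l3 \in odds g); first exact: (theta_odd (theta12 (theta23 th))).
have [xo|] := boolP (x \in odds g); last by move=> xe; exact: theta_even th xe h1 h2 h3.
have [|r1] := boolP (head x (rev l1) \in odds g); first exact: (theta_odd thr).
have [|r2] := boolP (head x (rev l2) \in odds g); first exact: (theta_odd (theta12 thr)).
have [|r3] := boolP (head x (rev l3) \in odds g); first exact: (theta_odd (theta12 (theta23 thr))).
have [yo|ye] := boolP (y \in odds g); last exact: theta_even thr ye r1 r2 r3.
(* Now [x] and [y] are odd and their neighbours on the theta are even, so no path is a single edge.
   Removing the whole theta takes three edges from [x] and from [y], which become even; with two
   further neighbours of [x] they pay for two paths. *)
have un := theta_heads th; have [u p1 p2 p3 _] := th.
have ne l : head y l \notin odds g -> exists z l', l = z :: l'.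
  by case: l => [|z l'] /=; [rewrite yo | exists z, l'].
have [[xy x1 x2 x3] [y1 y2 y3] [u1 u2 u3] [d12 d13 d23]] := theta_uniq u.
have xh l : x \notin l -> x != head y l.
  by case: l => //= z l; rewrite in_cons negb_or => /andP[].
have un' : uniq [:: head y l1; x; head y l2].
  by have /uniq3P[h12 _ _] := un; rewrite /= !inE negb_or h12 xh // [_ == x]eq_sym xh.
have Fa : acyclic (diff g (ed [:: head y l1; x; head y l2])).
  exact: tree_wedge un' (foot_adj p1) (foot_adj p2) (theta_conn th).
have [z1 [m1 E1]] := ne _ h1; have [z2 [m2 E2]] := ne _ h2; have [z3 [m3 E3]] := ne _ h3.
have le1 l : uniq l -> x \notin l -> y \notin l -> forall a b, ed (x :: rcons l y) a b <= 1.
  by move=> ul xl yl a b; apply: ed_le1; rewrite cons_uniq mem_rcons in_cons negb_or xy xl rcons_uniq yl.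
pose P l := ed (x :: rcons l y).
pose F1 := diff g (P l1); pose F2 := diff F1 (P l2); pose F := diff F2 (P l3).
have [F1s F1i] : symmetric F1 /\ irreflexive F1 by split; [exact: diff_sym | exact: diff_irr].
have [F2s F2i] : symmetric F2 /\ irreflexive F2 by split; [exact: diff_sym | exact: diff_irr].
have q2 : path F1 x (rcons l2 y).
  apply: path_diff => // a b; apply: parallel_ed => //; first by rewrite E2.
  by move=> v v2; apply/negP => /d12; rewrite v2.
have q3 : path F2 x (rcons l3 y).
  apply: path_diff => //; last first.
    move=> a b; apply: parallel_ed => //; first by rewrite E3.
    by move=> v v2; apply/negP => /d23; rewrite v2.
  apply: path_diff => // a b; apply: parallel_ed => //; first by rewrite E3.
  by move=> v v2; apply/negP => /d13; rewrite v2.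
have oF v : (v \in odds F) = (v \in odds g) (+) ((v == x) (+) (v == y)).
  have -> : (v \in odds F) = (v \in odds F2) (+) ((v == x) (+) (v == y)).
    by rewrite (odds_diff _ F2s F2i q3 (le1 _ u3 x3 y3)) last_rcons.
  have -> : (v \in odds F2) = (v \in odds F1) (+) ((v == x) (+) (v == y)).
    by rewrite (odds_diff _ F1s F1i q2 (le1 _ u2 x2 y2)) last_rcons.
  rewrite (odds_diff _ gs gi p1 (le1 _ u1 x1 y1)) last_rcons.
  by case: (v \in odds g); case: (v == x); case: (v == y).
have oFn v : v != x -> v != y -> (v \in odds F) = (v \in odds g).
  by move=> /negPf vx /negPf vy; rewrite oF vx vy !addbF.
have xF : x \notin odds F by rewrite oF eqxx (negPf xy) xo.
have yF : y \notin odds F by rewrite oF eqxx [y == x]eq_sym (negPf xy) yo.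
have hy l : y \notin l -> head y l \notin odds g -> head y l != y.
  by move=> yl; apply: contraNneq => ->.
pose all := [:: x, y & l1 ++ l2 ++ l3].
have allP l v : {subset l <= l1 ++ l2 ++ l3} -> v \in x :: rcons l y -> v \in all.
  by move=> sl; rewrite !in_cons mem_rcons in_cons => /or3P[->|->|/sl->]; rewrite ?orbT.
pose R := [set v | (v \in all) && (v \notin odds F)].
have hR l : {subset l <= l1 ++ l2 ++ l3} -> x \notin l -> y \notin l -> head y l \notin odds g ->
    head y l \in R.
  move=> sl xl yl hl; rewrite in_set oFn ?hl ?hy // 1?eq_sym ?xh // andbT.
  by apply: allP sl _; case: (l) => [|z m]; rewrite /= !in_cons eqxx ?orbT.
have s1 : {subset l1 <= l1 ++ l2 ++ l3} by move=> v vl; rewrite mem_cat vl.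
have s2 : {subset l2 <= l1 ++ l2 ++ l3} by move=> v vl; rewrite !mem_cat vl orbT.
have s3 : {subset l3 <= l1 ++ l2 ++ l3} by move=> v vl; rewrite !mem_cat vl !orbT.
have sub a b : F a b -> [/\ g a b, P l1 a b = 0, P l2 a b = 0 & P l3 a b = 0].
  by case/andP=> /andP[/andP[-> /eqP->] /eqP->] /eqP->.
apply: (@half_block_of_forest _ g F (fun a b => P l1 a b + P l2 a b + P l3 a b) R 2).
- exact: diff_sym.
- exact: diff_irr.
- apply: acyclic_sub Fa => a b /sub[ab w1 w2 _].
  apply: (@wedge_closed _ _ _ (fun a b => P l1 a b + P l2 a b)).
  + by move=> c d; rewrite /P ![ed _ c d]ed_sym.
  + by rewrite E1 /P addn_gt0 rcons_cons ed_cons2 /link !eqxx.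
  + by rewrite E2 /P addn_gt0 rcons_cons [X in _ || (0 < X)]ed_cons2 /link !eqxx orbT.
  + by rewrite /diff ab w1 w2.
- move=> a b; rewrite addnC -addnA -(diffK _ _ gs p1 (le1 _ u1 x1 y1)).
  rewrite -(diffK _ _ F1s q2 (le1 _ u2 x2 y2)) -(diffK _ _ F2s q3 (le1 _ u3 x3 y3)).
  by rewrite -/F /P; clear; lia.
- have hR1 := hR l1 s1 x1 y1 h1; have hR2 := hR l2 s2 x2 y2 h2; have hR3 := hR l3 s3 x3 y3 h3.
  move: u hR1 hR2 hR3; rewrite /R /all /P E1 E2 E3 => u hR1 hR2 hR3; apply: theta_block => //.
  + by rewrite in_set mem_head.
  + by rewrite in_set in_cons mem_head orbT.
  + by move=> v; rewrite in_set => /andP[].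
- by apply/subsetP => v vo; rewrite in_setC in_set vo andbF.
- apply/subsetP => v; rewrite in_setC in_set negb_and negbK => /orP[vs|vo]; last first.
    by apply: (subsetP (odds_nonisolated F)).
  have vn l : {subset l <= l1 ++ l2 ++ l3} -> v \notin x :: rcons l y.
    by move=> sl; apply: contra vs; exact: allP.
  do 3!(apply: nonisolated_off; last exact: vn); exact: conn_nonisolated.
- apply: (@card_uniq_le _ [:: y; x; head y l1; head y l2]).
    have /uniq3P[h12 _ _] := un.
    by rewrite /= !inE !negb_or h12 !xh // [y == x]eq_sym xy ![y == head _ _]eq_sym !hy.
  move=> v; rewrite !in_cons in_nil orbF in_setC => /or4P[]/eqP-> //.
    by rewrite oFn ?hy // eq_sym xh.
  by rewrite oFn ?hy // eq_sym xh.
Qed.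
End Theta.
End Cases.

(** * Two cycles with one common vertex *)

Section Bowtie.
Variable V : finType.
Variable g : rel V.
Hypotheses (gs : symmetric g) (gi : irreflexive g) (gc : conn g) (ga : arcs g = 2 * #|V| + 2).
Implicit Types (s t l c : seq V) (a b d x y z u v w : V) (R S : {set V}).

Definition bowtie z l1 l2 := [/\ uniq (z :: l1 ++ l2), 1 < size l1, 1 < size l2,
  path g z (rcons l1 z) & path g z (rcons l2 z)].

Lemma bowtie_sym z l1 l2 : bowtie z l1 l2 -> bowtie z l2 l1.
Proof.
case=> u n1 n2 p1 p2; split=> //.
by rewrite (perm_uniq (s2 := z :: l1 ++ l2)) // perm_cons perm_catC.
Qed.

Lemma bowtie_rev z l1 l2 : bowtie z l1 l2 -> bowtie z (rev l1) l2.
Proof.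
case=> u n1 n2 p1 p2; split=> //; rewrite ?size_rev //; last exact: rev_rcons_path.
by rewrite (perm_uniq (s2 := z :: l1 ++ l2)) // perm_cons perm_cat2r perm_rev.
Qed.

Lemma bowtie_uniq z l1 l2 : uniq (z :: l1 ++ l2) ->
  [/\ uniq (z :: l1), uniq (z :: l2) & forall v, v \in l1 -> v \notin l2].
Proof.
rewrite !cons_uniq mem_cat negb_or cat_uniq.
case/and4P=> /andP[-> ->] -> /hasPn d ->; split=> // v v1; apply/negP => v2.
by have := d v v2; rewrite /= v1.
Qed.

Lemma mem_head_ne z l : 0 < size l -> head z l \in l.
Proof. by case: l => // x l _; exact: mem_head. Qed.

Lemma bowtie_side z l u' : uniq (z :: l) -> 1 < size l -> path g z (rcons l z) ->
    u' \notin z :: l ->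
  connect (diff g (ed [:: head z l; z; u'])) (head z l) z.
Proof.
case: l => // u m ul um; rewrite rcons_cons => /andP[_ p] u'l.
rewrite [head _ _]/= -[z in connect _ _ z](last_rcons u m z); apply: last_connect.
have uz : ed (u :: rcons m z) z u = 0.
  have := @closed_ed_le1 V z (u :: m) z u ul um.
  have E : link z u z u = true by rewrite /link !eqxx.
  by rewrite rcons_cons ed_cons2 E add1n ltnS leqn0 => /eqP.
have u'm : u' \notin u :: rcons m z.
  by move: u'l; rewrite !in_cons mem_rcons in_cons !negb_or => /and3P[-> -> ->].
apply: path_diff => // a b ab; apply/eqP; rewrite -leqn0 leqNgt; apply/negP.
rewrite !ed_cons2 addn0 addn_gt0 !lt0b => /orP[]/orP[]/andP[/eqP aE /eqP bE]; move: ab; rewrite aE bE.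
- by rewrite ed_sym uz.
- by rewrite uz.
- by rewrite (ed_notinr _ u'm).
- by rewrite (ed_notin _ u'm).
Qed.

Lemma bowtie_conn z l1 l2 : bowtie z l1 l2 -> conn (diff g (ed [:: head z l1; z; head z l2])).
Proof.
case=> /bowtie_uniq[u1 u2 dis] n1 n2 p1 p2.
have h1 := mem_head_ne z (ltnW n1); have h2 := mem_head_ne z (ltnW n2).
have z1 : z \notin l1 by case/andP: u1.
have z2 : z \notin l2 by case/andP: u2.
set T := diff _ _; have Ts : symmetric T by exact: diff_sym.
have c1 : connect T (head z l1) z.
  apply: bowtie_side => //; rewrite in_cons negb_or.
  by apply/andP; split; [apply: contraNneq z2 => <- | apply/negP => /dis; rewrite h2].
have c2 : connect T (head z l2) z.
  have TE : T =2 diff g (ed [:: head z l2; z; head z l1]).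
    by move=> a b; rewrite /T /diff -[[:: head z l2; z; _]]/(rev [:: head z l1; z; head z l2]) ed_rev.
  rewrite (eq_connect TE); apply: bowtie_side => //; rewrite in_cons negb_or dis // andbT.
  by apply: contraNneq z1 => <-.
apply: conn_diff => // a b; rewrite !ed_cons2 addn0 addn_gt0 !lt0b -/T.
by move=> /orP[]/orP[]/andP[/eqP-> /eqP->]; rewrite // (sym_connect_sym Ts).
Qed.

(** The two wedges lead through [z] from its neighbour on one cycle to its two neighbours on the
    other; each takes one edge from either cycle, so connectedness is kept. *)
Lemma bowtie_odd z l1 l2 : bowtie z l1 l2 -> head z l1 \in odds g -> half_block g.
Proof.
move=> bt o; have [/bowtie_uniq[u1 u2 dis] n1 n2 p1 p2] := bt.
have h1 := mem_head_ne z (ltnW n1); have h2 := mem_head_ne z (ltnW n2).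
have h2r : head z (rev l2) \in l2 by rewrite -mem_rev mem_head_ne // size_rev ltnW.
have bs := bowtie_sym bt.
apply: (bounce2 gs gi ga (foot_adj p1) (foot_adj p2) (foot_adj (rev_rcons_path gs p2)) _ o
  (bowtie_conn bs) (bowtie_conn (bowtie_rev bs))).
have ne v : v \in l2 -> head z l1 != v by move=> v2; apply: contraTneq v2 => <-; exact: dis.
rewrite /= !inE negb_or !ne //= andbT.
case: (l2) n2 u2 => // a m; case/lastP: m => // m b _ /andP[_]; rewrite /= rev_cons rev_rcons /=.
by rewrite mem_rcons inE negb_or => /andP[/andP[]].
Qed.

(** Removing both cycles changes no parity, so the four even neighbours of [z] pay for the two
    paths. *)
Lemma bowtie_even z u1 t1 v1 l2 : bowtie z (u1 :: rcons t1 v1) l2 ->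
    u1 \notin odds g -> v1 \notin odds g ->
    head z l2 \notin odds g -> head z (rev l2) \notin odds g ->
  half_block g.
Proof.
set l1 := u1 :: _ => bt e1 e2 e3 e4; have [u n1 n2 p1 p2] := bt.
have [ul1 ul2 dis] := bowtie_uniq u.
have h2 := mem_head_ne z (ltnW n2).
have h2r : head z (rev l2) \in l2 by rewrite -mem_rev mem_head_ne // size_rev ltnW.
have le1 l : uniq (z :: l) -> 1 < size l -> forall a b, ed (z :: rcons l z) a b <= 1.
  by move=> ul nl a b; exact: closed_ed_le1.
pose P l := ed (z :: rcons l z); pose F1 := diff g (P l1); pose F := diff F1 (P l2).
have [F1s F1i] : symmetric F1 /\ irreflexive F1 by split; [exact: diff_sym | exact: diff_irr].
have off l l' v : (forall v, v \in l -> v \notin l') -> z \notin l -> v \in l -> v \notin z :: rcons l' z.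
  move=> d zl vl; rewrite in_cons mem_rcons in_cons !negb_or d // andbT andbb.
  by apply: contraNneq zl => <-.
have z1 : z \notin l1 by case/andP: ul1.
have z2 : z \notin l2 by case/andP: ul2.
have q2 : path F1 z (rcons l2 z).
  apply: path_diff => // a b ab.
  have dis' v : v \in l2 -> v \notin l1 by move=> v2; apply/negP => /dis; rewrite v2.
  have : (a \in l2) || (b \in l2).
    case: (l2) n2 ab => // x m _; rewrite rcons_cons ed_cons2 addn_gt0 lt0b => /orP[].
      by case/orP=> /andP[/eqP-> /eqP->]; rewrite mem_head ?orbT.
    exact: (@ed_rcons_mem _ (x :: m)).
  by case/orP=> h; [rewrite /P ed_notin | rewrite /P ed_notinr] => //; exact: off dis' z2 h.
have oF v : (v \in odds F) = (v \in odds g).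
  rewrite (odds_diff _ F1s F1i q2 (le1 _ ul2 n2)) last_rcons addbb addbF.
  by rewrite (odds_diff _ gs gi p1 (le1 _ ul1 n1)) last_rcons addbb addbF.
have [x2 [m2 E2]] : exists x2 m2, l2 = x2 :: m2 by case: (l2) n2 => // x2 m2; exists x2, m2.
have un : uniq [:: head z l1; z; head z l2].
  rewrite /= !inE negb_or andbT -!andbA; apply/and3P; split.
  - by apply: contraNneq z1 => {1}<-; exact: mem_head.
  - by apply: contraTneq h2 => <-; apply: dis; exact: mem_head.
  - by apply: contraNneq z2 => {1}->.
have Fa := tree_wedge gs gi ga un (foot_adj p1) (foot_adj p2) (bowtie_conn bt).
pose all := z :: l1 ++ l2.
pose R := [set v | (v \in all) && (v \notin odds g)].
have v1l : v1 \in l1 by rewrite in_cons mem_rcons mem_head orbT.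
have in1 v : v \in l1 -> v \notin odds g -> v \in R.
  by move=> vl ve; rewrite in_set in_cons mem_cat vl orbT.
have in2 v : v \in l2 -> v \notin odds g -> v \in R.
  by move=> vl ve; rewrite in_set in_cons mem_cat vl !orbT.
apply: (@half_block_of_forest _ g F (fun a b => P l1 a b + P l2 a b) R 2).
- exact: diff_sym.
- exact: diff_irr.
- apply: acyclic_sub Fa => a b /andP[/andP[ab /eqP w1] /eqP w2].
  apply: (@wedge_closed _ _ _ _ _ (fun a b => P l1 a b + P l2 a b)).
  + by move=> c d; rewrite /P ![ed _ c d]ed_sym.
  + by rewrite /l1 /P addn_gt0 closed_head.
  + by rewrite E2 /P addn_gt0 closed_head orbT.
  + by rewrite /diff ab w1 w2.
- move=> a b; rewrite -(diffK _ _ gs p1 (le1 _ ul1 n1)) -(diffK _ _ F1s q2 (le1 _ ul2 n2)).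
  by rewrite -/F /P; clear; lia.
- move: u in1 in2 h2 e3; rewrite /R /all /P E2 => u in1 in2 h2 e3; apply: bowtie_block => //.
  + by apply: in1 => //; exact: mem_head.
  + by apply: in2.
  + exact: in1.
  + by move=> v; rewrite in_set => /andP[].
- by apply/subsetP => v; rewrite oF => vo; rewrite in_setC in_set vo andbF.
- apply/subsetP => v; rewrite in_setC in_set negb_and negbK => /orP[vs|vo]; last first.
    by apply: (subsetP (odds_nonisolated F)); rewrite oF.
  move: vs; rewrite in_cons mem_cat !negb_or => /and3P[vz vl1 vl2].
  do 2!(apply: nonisolated_off; last by rewrite in_cons mem_rcons in_cons !negb_or vz).
  exact: (conn_nonisolated gi ga).
- apply: (@card_uniq_le _ [:: u1; v1; head z l2; head z (rev l2)]).
    have ne v w : v \in l1 -> w \in l2 -> v != w.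
      by move=> vl wl; apply: contraTneq wl => <-; exact: dis.
    have u1l : u1 \in l1 by exact: mem_head.
    rewrite /= !inE !negb_or (ne u1 _ u1l h2) (ne u1 _ u1l h2r) (ne v1 _ v1l h2) (ne v1 _ v1l h2r).
    rewrite !andbT; apply/andP; split.
      by move: ul1 => /andP[_ /andP[]]; rewrite mem_rcons in_cons negb_or => /andP[].
    case: (l2) n2 ul2 => // a m; case/lastP: m => // m b _ /andP[_]; rewrite /= rev_cons rev_rcons /=.
    by rewrite mem_rcons inE negb_or => /andP[/andP[]].
  by move=> v; rewrite !in_cons in_nil orbF in_setC oF => /or4P[]/eqP->.
Qed.

Lemma bowtie_half_block z l1 l2 : bowtie z l1 l2 -> half_block g.
Proof.
move=> bt; have br := bowtie_rev bt; have bs := bowtie_sym bt; have bsr := bowtie_rev bs.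
have [|e1] := boolP (head z l1 \in odds g); first exact: bowtie_odd bt.
have [|e2] := boolP (head z (rev l1) \in odds g); first exact: bowtie_odd br.
have [|e3] := boolP (head z l2 \in odds g); first exact: bowtie_odd bs.
have [|e4] := boolP (head z (rev l2) \in odds g); first exact: bowtie_odd bsr.
have [_ n1 _ _ _] := bt; case: l1 n1 bt e1 e2 {br bs bsr} => // u1 m; case/lastP: m => // t1 v1 _.
by rewrite rev_cons rev_rcons => bt e1 e2; exact: bowtie_even bt e1 e2 e3 e4.
Qed.

End Bowtie.

(** * A cycle merged with a path of the forest *)

Section Lollipop.
Variable V : finType.
Implicit Types (g F : rel V) (s t l c : seq V) (a b d x y z u v w p q : V) (R S : {set V}).

Lemma conn_cut g S x y : conn g -> x \in S -> y \notin S ->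
  exists a b, [/\ a \in S, b \notin S & g a b].
Proof.
move=> gc xS yS; have /connectP[l gl yl] := gc x y.
elim: l x xS gl yl => [|w l IH] x xS /= => [_ xy|/andP[gxw gl] yl]; first by rewrite xy xS in yS.
have [wS|wS] := boolP (w \in S); first exact: IH gl yl.
by exists x, w.
Qed.

(* Otherwise the first edge of the ear lies on a cycle, and removing it leaves a
   tree that still contains the cycle [x :: s]. *)
Lemma no_ear g x s p t : symmetric g -> irreflexive g -> conn g -> arcs g = 2 * #|V| ->
    uniq (x :: s) -> 1 < size s -> path g x (rcons s x) ->
    path (diff g (ed (x :: rcons s x))) p t -> uniq (p :: t) ->
    p \in x :: s -> last p t \in x :: s ->
  t = [::].
Proof.
move=> gs gi gc ga us s1 ps; case: t => // q t pt ut pc lc; exfalso.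
have /andP[gpq cpq] : diff g (ed (x :: rcons s x)) p q by case/andP: pt.
pose D := diff g (ed [:: p; q]); have Ds : symmetric D by exact: diff_sym.
have pD : path D x (rcons s x).
  apply: path_diff => // a b ab; rewrite ed_cons2 addn0; apply/eqP; rewrite eqb0.
  apply: contraL ab; rewrite -leqNgt leqn0.
  by case/orP=> /andP[/eqP-> /eqP->] //; rewrite ed_sym.
have tD : path D q t.
  case/andP: pt => _ pt; have pg := sub_path (@diff_sub _ _ _) pt.
  apply: path_diff => // a b ab; apply/eqP; rewrite ed_cons2 addn0 eqb0.
  move: ut; rewrite cons_uniq => /andP[pqt _].
  apply: contraL ab; rewrite -leqNgt leqn0.
  by case/orP=> /andP[/eqP-> /eqP->]; rewrite ?(ed_notin _ pqt) ?(ed_notinr _ pqt).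
have cD v : v \in x :: s -> connect D x v.
  move=> vs; apply: (path_connect pD); move: vs; rewrite !in_cons mem_rcons in_cons.
  by case/orP=> ->; rewrite ?orbT.
have cpqD : connect D p q.
  rewrite (connect_trans (y := x)) //; first by rewrite (sym_connect_sym Ds) cD.
  apply: connect_trans (cD _ lc) _; rewrite (sym_connect_sym Ds); exact: last_connect.
have Dc : conn D.
  apply: conn_diff => // a b; rewrite ed_cons2 addn0 lt0b.
  by case/orP=> /andP[/eqP-> /eqP->] //; rewrite (sym_connect_sym Ds).
have gp : path g p [:: q] by rewrite /= gpq.
have Da : acyclic D.
  apply: tree_acyclic => //; first exact: diff_irr.
  by have := arcs_diff gs gi gp (link_le1 p q); rewrite ga [size _]/= -/D; clear; lia.
by have := Da (x :: s); rewrite [cycle _ _]/= pD ltnS s1 us => /(_ isT isT).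
Qed.

(** By [cycle_block] a cycle costs two paths and calls for four even vertices, one more than a
    triangle has. Here it shares two paths with a leaf-to-leaf path of the forest through [x], which
    would cost one anyway; so the cycle adds only one path and needs two even vertices. The
    condition on ears, supplied by [no_ear], keeps that path off the cycle except at [x]. *)
Lemma lollipop g F W2 R2 k x s :
    symmetric F -> irreflexive F -> acyclic F ->
    (forall a b, F a b + ed (x :: rcons s x) a b + W2 a b = g a b) -> block W2 R2 k ->
    uniq (x :: s) -> 1 < size s ->
    (forall v, v \in x :: s -> v \notin odds F) -> (forall v, v \in x :: s -> v \notin R2) ->
    R2 \subset ~: odds F -> (forall v, v \notin x :: s -> v \notin R2 -> v \in nonisolated F) ->
    x \in nonisolated F ->
    (forall p t, path F p t -> uniq (p :: t) -> p \in x :: s -> last p t \in x :: s -> t = [::]) ->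
    2 * k.+1 <= #|~: odds F| ->
  half_block g.
Proof.
move=> Fs Fi Fa FW b2 us s1 Ce CR2 R2e Fn xN ear le.
have [p0 [p1 [t [pP uP xP d0 d1]]]] := leaf_path Fs Fi Fa xN.
set P := p1 :: t in pP uP xP; set q0 := last p1 t in d1.
have o0 : p0 \in odds F by rewrite in_set d0.
have o1 : q0 \in odds F by rewrite in_set d1.
have Co v : v \in odds F -> v \notin x :: s by move=> vo; apply: contraL vo; exact: Ce.
have p0x : p0 != x by apply: contraNneq (Co _ o0) => ->; exact: mem_head.
have q0x : q0 != x by apply: contraNneq (Co _ o1) => ->; exact: mem_head.
have nq : p0 != q0.
  by apply: contraTneq uP => ->; rewrite cons_uniq mem_last.
have [l [r EP]] : exists l r, p0 :: P = rcons (p0 :: l) x ++ r.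
  move: xP; rewrite in_cons eq_sym (negPf p0x) /= => /splitPr[l r].
  by exists l, r; rewrite /= cat_rcons.
have EP' : P = rcons l x ++ r by case: EP.
have lr : last x r = q0.
  by rewrite /q0 -[last p1 t]/(last p0 P) EP' last_cat last_rcons.
have [y [r' Er]] : exists y r', r = y :: r'.
  by case: (r) lr => [|y r' _]; [move=> /= E; rewrite E eqxx in q0x | exists y, r'].
have pl : path F p0 (rcons l x) by move: pP; rewrite EP' cat_path => /andP[].
have pr : path F x r by move: pP; rewrite EP' cat_path last_rcons => /andP[].
have [ul ur dis] : [/\ uniq (rcons (p0 :: l) x), uniq (x :: r) &
    forall v, v \in rcons (p0 :: l) x -> v \notin r].
  move: uP; rewrite EP cat_uniq => /and3P[ul /hasPn d ur]; split=> //.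
    by rewrite cons_uniq ur andbT; apply/negP => /d; rewrite /= in_cons mem_rcons mem_head orbT.
  by move=> v vl; apply/negP => /d/negP[].
have rC v : v \in r -> v \notin x :: s.
  move=> vr; case/splitPr: vr pr ur => r1 r2 pr ur; apply/negP => vC.
  have := ear x (rcons r1 v); rewrite last_rcons mem_head vC.
  move: pr ur; rewrite -cat_rcons cat_path -cat_cons cat_uniq => /andP[-> _] /and3P[-> _ _].
  by move=> /(_ isT isT isT isT); case: (r1).
have lC v : v \in p0 :: l -> v \notin x :: s.
  have ulr : uniq (x :: rev (p0 :: l)) by rewrite -rev_rcons rev_uniq.
  have plr : path F x (rev (p0 :: l)).
    by have := path_rev Fs pl; rewrite last_rcons belast_rcons.
  rewrite -mem_rev => vr; case/splitPr: vr plr ulr => r1 r2 plr ulr; apply/negP => vC.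
  have := ear x (rcons r1 v); rewrite last_rcons mem_head vC.
  move: plr ulr; rewrite -cat_rcons cat_path -cat_cons cat_uniq => /andP[-> _] /and3P[-> _ _].
  by move=> /(_ isT isT isT isT); case: (r1).
pose F' := diff F (ed (p0 :: P)).
have le1 a b : ed (p0 :: P) a b <= 1 by exact: ed_le1.
have oF' v : (v \in odds F') = (v \in odds F) (+) ((v == p0) (+) (v == q0)).
  by rewrite (odds_diff _ Fs Fi pP le1).
have end_iso v : deg F v = 1 -> v \notin odds F' -> v \notin nonisolated F'.
  move=> dv; rewrite !in_set; have := deg_sub v (@diff_sub _ F (ed (p0 :: P))); rewrite -/F' dv.
  by case: (deg F' v) => [|[|]].
have p0e : p0 \notin odds F' by rewrite oF' o0 eqxx (negPf nq).
have q0e : q0 \notin odds F' by rewrite oF' o1 eqxx [q0 == _]eq_sym (negPf nq).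
have p0i := end_iso _ d0 p0e; have q0i := end_iso _ d1 q0e.
have R2o v : v \in odds F -> v \notin R2.
  by move=> vo; apply/negP => /(subsetP R2e); rewrite in_setC vo.
(* Besides the cycle, these are the vertices of the path whose rungs neither the remaining forest
   nor the block [W2] can serve. *)
pose R1 := [set v | (v \in x :: s) || [&& v \in p0 :: P, v \notin nonisolated F' & v \notin R2]].
have CR1 v : v \in x :: s -> v \in R1 by move=> vC; rewrite in_set vC.
have p0R : p0 \in R1 by rewrite in_set mem_head p0i R2o // orbT.
have q0P : q0 \in P by exact: mem_last.
have q0R : q0 \in R1 by rewrite in_set [q0 \in p0 :: P]in_cons q0P q0i R2o // !orbT.
have R1P v : v \in R1 -> [|| v \in x :: s, v \in p0 :: l | v \in r].
  rewrite in_set EP mem_cat mem_rcons !in_cons => /orP[->//|/andP[]].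
  by case/orP=> [/orP[->|->]|->]; rewrite ?orbT.
have pE a b : ed (p0 :: P) a b = ed (rcons (p0 :: l) x) a b + ed (x :: r) a b.
  by rewrite EP -[rcons _ x ++ r]/(rcons (p0 :: l) x ++ r) cat_rcons ed_cat.
have b1 : block (fun a b => ed (x :: rcons s x) a b + ed (p0 :: P) a b) R1 2.
  have [s' [u Es']] : exists s' u, s = rcons s' u.
    by case/lastP: (s) s1 => // s' u; exists s', u.
  have u_s' : u \notin x :: s' by move: us; rewrite Es' -rcons_cons rcons_uniq => /andP[].
  have us' : uniq (x :: s') by move: us; rewrite Es' -rcons_cons rcons_uniq => /andP[].
  have sP v : (v \in x :: s) = [|| v == x, v == u | v \in s'] by rewrite Es' in_cons mem_rcons.
  have ux : u != x by move: u_s'; rewrite in_cons negb_or => /andP[].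
  have us0 : u \notin s' by move: u_s'; rewrite in_cons negb_or => /andP[].
  have xs0 : x \notin s' by case/andP: us'.
  have [w [m Es]] : exists w m, rev s' = w :: m.
    move: s1; rewrite Es'; case: (s') => // a m _.
    by rewrite rev_cons; case: (rev m) => [|b n]; do 2!eexists.
  have ws : w \in s' by rewrite -mem_rev Es mem_head.
  have [y2 [r2 E2]] : exists y2 r2, rev s' ++ x :: rev (p0 :: l) = y2 :: r2.
    by rewrite Es; do 2!eexists.
  have memE v : (v \in y2 :: r2) = [|| v \in s', v == x | v \in p0 :: l].
    by rewrite -E2 mem_cat in_cons !mem_rev.
  have uR : u \in R1 by rewrite CR1 // sP eqxx orbT.
  have xR : x \in R1 by rewrite CR1 // mem_head.
  (* From [u], the last vertex of the cycle before [x], one line enters [x] at once and runs to the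
     leaf [q0]; the other goes round the cycle to [x] and then to the leaf [p0]. The rung at [x]
     belongs to the first. *)
  apply: (@block_eq _ (fun a b => ed [:: u, x & r] a b + ed [:: u, y2 & r2] a b)).
    move=> a b; rewrite -E2 pE -(cat_cons u) ed_cat ed_cons_rev ed_cons2.
    rewrite Es' -[x :: rcons _ x]/(rcons (rcons (x :: s') u) x) ed_rcons.
    rewrite -(ed_rev (rcons (x :: s') u)) rev_rcons rev_cons -rcons_cons; move: (ed (x :: r) a b) (ed (rcons (p0 :: l) x) a b) (ed (rcons (u :: rev s') x) a b) (nat_of_bool (link u x a b)); clear; lia.
  have xr : x \notin r by case/andP: ur.
  have xl : x \notin p0 :: l by move: ul; rewrite rcons_uniq => /andP[].
  have ur' : u \notin r by apply/negP => /rC; rewrite sP eqxx orbT.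
  have ul' : u \notin p0 :: l by apply/negP => /lC; rewrite sP eqxx orbT.
  rewrite Er; apply: (@two_line_block _ _ _ _ _ _ (fun v => v \in R1) (fun v => (v \in R1) && (v != x))).
  - by rewrite -Er [uniq _]cons_uniq ur andbT in_cons negb_or ux.
  - rewrite -E2 cons_uniq mem_cat in_cons !mem_rev 2!negb_or us0 ux ul'  /=.
    rewrite cat_uniq rev_uniq cons_uniq mem_rev xl rev_uniq; move: us' ul.
    rewrite cons_uniq rcons_uniq => /andP[_ ->] /andP[_ ->]; rewrite !andbT /= mem_rev negb_or xs0 /=.
    apply/hasPn => v; rewrite !mem_rev => /lC; rewrite sP !negb_or.
    by case/and3P.
  - by rewrite -lr Er in q0R *.
  - rewrite -[last _ _]/(last y2 (y2 :: r2)) -E2 last_cat /= rev_cons last_rcons p0R p0x //.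
  - move=> v; rewrite -Er memE in_cons; have [->|vu] := eqVneq v u.
      by rewrite uR (negPf ux) (negPf ur') (negPf us0) (negPf ul').
    have [->|vx] := eqVneq v x; first by rewrite xR andbF.
    rewrite andbT /=; case vR: (v \in R1); rewrite ?andbF // !andbT.
    have := R1P v vR; rewrite sP (negPf vx) (negPf vu) /=.
    case vs: (v \in s') => /=.
      by case vr: (v \in r) => //; have := rC _ vr; rewrite sP vs !orbT.
    case vl: (v \in p0 :: l) => /=; last by move=> ->.
    by rewrite (negPf (dis v _)) // mem_rcons in_cons vl orbT.
  - move=> v v1 v2.
    have : v \in [:: u; x] := (@seg_upto _ (fun v => v \in R1) false u [::] x (y :: r') xR v v1).
    have : v \in [:: u; w].
      apply: (@seg_upto _ (fun v => (v \in R1) && (v != x)) false _ [::] w (m ++ x :: rev (p0 :: l))).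
        by rewrite CR1 ?sP ?ws ?orbT //; apply: contraNneq xs0 => <-.
      by rewrite -E2 Es in v2.
    rewrite !in_cons !in_nil !orbF => /orP[/eqP//|/eqP->] /orP[/eqP//|/eqP wx].
    by rewrite -wx ws in xs0.
apply: (@half_block_of_forest _ g F' (fun a b => ed (x :: rcons s x) a b + ed (p0 :: P) a b + W2 a b) (R1 :|: R2) (2 + k)).
- exact: diff_sym.
- exact: diff_irr.
- by apply: acyclic_sub Fa; exact: diff_sub.
- by move=> a b; rewrite -FW -(diffK a b Fs pP le1) -/F'; clear; lia.
- apply: block_add b1 b2; rewrite -setI_eq0; apply/eqP/setP => v; rewrite !in_set.
  apply/negP => /andP[/orP[/CR2/negP//|/and3P[_ _ /negP//]]].
- apply/subsetP => v vo; rewrite in_setC in_setU negb_or in_set negb_or.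
  have vF : v \in odds F.
    move: vo; rewrite oF'; have [->|_] := eqVneq v p0; first by rewrite o0.
    by have [->|_] := eqVneq v q0; rewrite ?o1 ?addbF.
  by rewrite (Co _ vF) (R2o _ vF) (subsetP (odds_nonisolated F') _ vo) andbF.
- apply/subsetP => v; rewrite in_setC in_setU negb_or in_set negb_or => /andP[/andP[vC vP] vR].
  move: vP; rewrite vR andbT negb_and negbK => /orP[vP|//].
  by apply: nonisolated_off => //; exact: Fn.
- have sub : [set p0; q0] :|: ~: odds F \subset ~: odds F'.
    apply/subsetP => v; rewrite !in_setU !in_set1 !in_setC => /orP[/orP[]/eqP->//|ve].
    rewrite oF' (negPf ve); have [vp|_] := eqVneq v p0; first by rewrite vp o0 in ve.
    by have [vq|_] := eqVneq v q0; first by rewrite vq o1 in ve.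
  apply: leq_trans (subset_leq_card sub); rewrite cardsU cards2 nq.
  have -> : [set p0; q0] :&: ~: odds F = set0.
    apply/setP => v; rewrite in_setI in_setC in_set2 in_set0.
    by apply/negP => /andP[/orP[]/eqP->]; rewrite ?o0 ?o1.
  by rewrite cards0; move: le; clear; lia.
Qed.
End Lollipop.

(** * Two disjoint cycles *)

Section Dumbbell.
Variable V : finType.
Variable g : rel V.
Hypotheses (gs : symmetric g) (gi : irreflexive g) (gc : conn g) (ga : arcs g = 2 * #|V| + 2).
Implicit Types (s t l c : seq V) (a b d x y z u v w p q : V) (R S : {set V}) (e : rel V).

Definition closed_walk e x s := [/\ uniq (x :: s), 1 < size s & path e x (rcons s x)].

Lemma closed_walk_rot e x s y : closed_walk e x s -> y \in x :: s ->
  exists2 t, closed_walk e y t & x :: s =i y :: t.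
Proof.
case=> u s1 p ys; have [i t E] := rot_to ys; exists t; last first.
  by move=> v; rewrite -E mem_rot.
have sE : size t = size s by have := size_rot i (x :: s); rewrite E => -[].
split; rewrite ?sE //; first by rewrite -E rot_uniq.
by have := rot_cycle i e (x :: s); rewrite E /= p.
Qed.

Lemma closed_walk_rev e x s : symmetric e -> closed_walk e x s -> closed_walk e x (rev s).
Proof.
move=> es [u s1 p]; split; rewrite ?size_rev //; last exact: rev_rcons_path.
by move: u; rewrite !cons_uniq mem_rev rev_uniq.
Qed.

Lemma closed_walk_diff e x s y t : symmetric e -> closed_walk e x s ->
  (forall v, v \in x :: s -> v \notin y :: t) -> closed_walk (diff e (ed (y :: t))) x s.
Proof.
move=> es [u s1 p] d; split=> //; apply: path_diff => // a b /ed_mem.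
by rewrite -rcons_cons mem_rcons in_cons orb_idl => [/d/ed_notin-> //|/eqP->]; rewrite mem_head.
Qed.

Lemma closed_walk_conn e x s : symmetric e -> conn e -> closed_walk e x s ->
  conn (diff e (ed [:: last x s; x])).
Proof. by move=> es ec [u s1 p]; exact: conn_cycle. Qed.

Lemma last_mem x s : 1 < size s -> last x s \in s.
Proof. by case: s => // y s _ /=; exact: mem_last. Qed.

Lemma last_adj e x s : path e x (rcons s x) -> e (last x s) x.
Proof. by rewrite rcons_path => /andP[]. Qed.

Lemma last_edge x s a b : 1 < size s -> ed (x :: rcons s x) a b = 0 -> ed [:: last x s; x] a b = 0.
Proof.
case/lastP: s => // s z _; rewrite -[x :: _]/(rcons (rcons (x :: s) z) x) ed_rcons last_rcons.
by rewrite ed_cons2 addn0 => /eqP; rewrite addn_eq0 => /andP[_ /eqP].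
Qed.

Lemma arcs_last e x s : symmetric e -> irreflexive e -> closed_walk e x s ->
  arcs (diff e (ed [:: last x s; x])) + 2 = arcs e.
Proof.
move=> es ei [u s1 p]; have pe : path e (last x s) [:: x] by rewrite /= last_adj.
exact: (arcs_diff es ei pe (link_le1 _ _)).
Qed.

(** Deleting the edge between [last a t] and [a] flips the parity of its two ends, so that both [a]
    and [b] are even afterwards. Here [b] is the other end if that is odd, and else an even vertex
    elsewhere on the cycle. *)
Lemma odd_pick x s a0 : closed_walk g x s -> a0 \in x :: s -> a0 \in odds g ->
  exists a t b, [/\ closed_walk g a t, x :: s =i a :: t, a \in odds g, b \in t &
    (b \in odds g) = (b == last a t)].
Proof.
move=> cw as0 ao; have [t cwt E] := closed_walk_rot cw as0.
have [u t1 _] := cwt.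
have [zo|ze] := boolP (last a0 t \in odds g).
  by exists a0, t, (last a0 t); split; rewrite ?last_mem ?eqxx.
have h1 : head a0 t \in t by rewrite mem_head_ne // ltnW.
have [yo|ye] := boolP (head a0 t \in odds g); last first.
  exists a0, t, (head a0 t); split; rewrite ?(negPf ye) //.
  apply/esym; case: t t1 u {cwt E ze h1 ye} => // y t t1 /and3P[_ yt _].
  apply: contraNF yt => /eqP /= E; rewrite E; case: (t) t1 => // z t' _ /=; exact: mem_last.
exists a0, (rev t), (head a0 t); split; rewrite ?mem_rev //; first exact: closed_walk_rev.
  by move=> v; rewrite E !in_cons mem_rev.
by rewrite yo; case: (t) t1 => // y t' _; rewrite rev_cons last_rcons eqxx.
Qed.

(** One edge of each cycle bounces as a block of cost one. A spanning tree remains, in which the two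
    even vertices chosen on each cycle pay for its edge. *)
Lemma dumbbell_odd a1 t1 b1 a2 t2 b2 : closed_walk g a1 t1 -> closed_walk g a2 t2 ->
    (forall v, v \in a1 :: t1 -> v \notin a2 :: t2) ->
    a1 \in odds g -> b1 \in t1 -> (b1 \in odds g) = (b1 == last a1 t1) ->
    a2 \in odds g -> b2 \in t2 -> (b2 \in odds g) = (b2 == last a2 t2) ->
  half_block g.
Proof.
move=> c1 c2 dis o1 m1 e1 o2 m2 e2; have [u1 s1 p1] := c1; have [u2 s2 p2] := c2.
set z1 := last a1 t1 in e1; set z2 := last a2 t2 in e2.
have z1t : z1 \in t1 by exact: last_mem.
have z2t : z2 \in t2 by exact: last_mem.
have dis' v w : v \in a1 :: t1 -> w \in a2 :: t2 -> v != w.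
  by move=> vt wt; apply: contraTneq wt => <-; exact: dis.
have in1 v : v \in t1 -> v \in a1 :: t1 by rewrite in_cons => ->; rewrite orbT.
have in2 v : v \in t2 -> v \in a2 :: t2 by rewrite in_cons => ->; rewrite orbT.
pose T1 := diff g (ed [:: z1; a1]); pose T := diff T1 (ed [:: z2; a2]).
have [T1s T1i] : symmetric T1 /\ irreflexive T1 by split; [exact: diff_sym | exact: diff_irr].
have c2' : closed_walk T1 a2 t2.
  apply: closed_walk_diff => // v vt; apply: contraTN vt; rewrite !in_cons orbF.
  by case/orP=> /eqP->; apply: dis; rewrite ?mem_head // in1.
have T1c : conn T1 by exact: closed_walk_conn.
have Tc : conn T by exact: closed_walk_conn.
have aT : arcs T + 2 = 2 * #|V|.
  have := arcs_last T1s T1i c2'; have := arcs_last gs gi c1; rewrite ga -/z1 -/z2 -/T1 -/T; clear; lia.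
have na1 v : v \in t1 -> v != a1 by move=> vt; apply: contraTneq vt => ->; case/andP: u1.
have na2 v : v \in t2 -> v != a2 by move=> vt; apply: contraTneq vt => ->; case/andP: u2.
have q1 : path g z1 [:: a1] by rewrite /= last_adj.
have q2 : path T1 z2 [:: a2] by rewrite /= last_adj //; case: c2'.
have oT v : (v \in odds T) = (v \in odds g) (+) ((v == z1) (+) (v == a1)) (+) ((v == z2) (+) (v == a2)).
  by rewrite (odds_diff _ T1s T1i q2 (link_le1 _ _)) (odds_diff _ gs gi q1 (link_le1 _ _)).
have oT1 v : v \in a1 :: t1 -> (v \in odds T) = (v \in odds g) (+) ((v == z1) (+) (v == a1)).
  by move=> vt; rewrite oT (negPf (dis' v z2 vt (in2 _ z2t))) (negPf (dis' v a2 vt (mem_head _ _))) !addbF.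
have oT2 v : v \in a2 :: t2 -> (v \in odds T) = (v \in odds g) (+) ((v == z2) (+) (v == a2)).
  move=> vt; have vz := dis' z1 v (in1 _ z1t) vt; have va := dis' a1 v (mem_head _ _) vt.
  by rewrite oT [v == z1]eq_sym [v == a1]eq_sym (negPf vz) (negPf va) !addbF.
have E1 : a1 \notin odds T by rewrite oT1 ?mem_head // o1 eqxx eq_sym (negPf (na1 _ z1t)).
have E2 : a2 \notin odds T by rewrite oT2 ?mem_head // o2 eqxx eq_sym (negPf (na2 _ z2t)).
have E3 : b1 \notin odds T by rewrite oT1 ?in1 // e1 (negPf (na1 _ m1)) addbF addbb.
have E4 : b2 \notin odds T by rewrite oT2 ?in2 // e2 (negPf (na2 _ m2)) addbF addbb.
apply: (@half_block_of_forest _ g T (fun a b => ed [:: z1; a1] a b + ed [:: z2; a2] a b) ([set a1] :|: [set a2]) (1 + 1)).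
- exact: diff_sym.
- exact: diff_irr.
- by apply: tree_acyclic; [exact: diff_sym | exact: diff_irr | | rewrite aT].
- move=> a b; rewrite -(diffK a b gs q1 (link_le1 _ _)) -(diffK a b T1s q2 (link_le1 _ _)) -/T1 -/T.
  by move: (ed [:: z1; a1] a b) (ed [:: z2; a2] a b) (nat_of_bool _); clear; lia.
- apply: block_add; first by rewrite disjoints1 in_set1 dis' // mem_head.
    by apply: (@bounce_block _ z1 [::] a1); rewrite /= inE na1.
  by apply: (@bounce_block _ z2 [::] a2); rewrite /= inE na2.
- by apply/subsetP => v vo; rewrite in_setC in_set2; apply/negP => /orP[]/eqP vE;
    rewrite vE ?(negPf E1) ?(negPf E2) in vo.
- by apply/subsetP => v _; exact: (conn_nonisolated gi ga).
- apply: (@card_uniq_le _ [:: a1; b1; a2; b2]).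
    have n1 : a1 != b1 by rewrite eq_sym na1.
    have n2 : a2 != b2 by rewrite eq_sym na2.
    have i1 := mem_head a1 t1; have i2 := mem_head a2 t2; have j1 := in1 _ m1; have j2 := in2 _ m2.
    rewrite /= !inE !negb_or n1 n2 (dis' _ _ i1 i2) (dis' _ _ i1 j2) (dis' _ _ j1 i2).
    by rewrite (dis' _ _ j1 j2).
  by move=> v; rewrite !in_cons in_nil orbF in_setC => /or4P[]/eqP->.
Qed.

(** [p :: q] is the part of the second cycle to be removed, a single edge or the whole cycle. The
    first cycle has at least three even vertices, of which [lollipop] uses two; the spare one is the
    [+ 1] in the last hypothesis. *)
Lemma dumbbell_core x s y t p (q : seq V) R2 k :
    closed_walk g x s -> (forall v, v \in x :: s -> v \notin odds g) ->
    closed_walk g y t -> (forall v, v \in x :: s -> v \notin y :: t) ->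
    path g p q -> (forall a b, ed (p :: q) a b <= 1) -> {subset p :: q <= y :: t} ->
    (forall a b, ed (p :: q) a b = 0 -> ed [:: last y t; y] a b = 0) ->
    block (ed (p :: q)) R2 k -> {subset R2 <= y :: t} ->
    (forall v, v \in R2 -> v \notin odds (diff g (ed (p :: q)))) ->
    (forall v, v \notin R2 -> v \in nonisolated (diff g (ed (p :: q)))) ->
    2 * k <= #|[set v in y :: t | v \notin odds (diff g (ed (p :: q)))]| + 1 ->
  half_block g.
Proof.
move=> c0 Ce0 c2 dis0 pq le1 sub pq0 b2 R2t R2e R2n le.
(* The forest path of [lollipop] needs a cycle vertex that keeps an edge when the cycle is gone; one
   exists because the graph is connected and the cycle does not contain [y]. *)
have [a [b [aC bC gab]]] : exists a b, [/\ a \in x :: s, b \notin x :: s & g a b].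
  have yC : y \notin x :: s by apply/negP => /dis0; rewrite mem_head.
  have := @conn_cut _ g [set v in x :: s] x y gc; rewrite !in_set mem_head => /(_ isT yC).
  by case=> a [b []]; rewrite !in_set => aC bC gab; exists a, b.
have [s' c1 sE] := closed_walk_rot c0 aC.
have {Ce0} Ce v : v \in a :: s' -> v \notin odds g by rewrite -sE; exact: Ce0.
have {dis0} dis v : v \in a :: s' -> v \notin y :: t by rewrite -sE; exact: dis0.
rewrite sE in bC; have [u1 s1 p1] := c1; have [u2 t1 p2] := c2.
pose G1 := diff g (ed (p :: q)); pose F := diff G1 (ed (a :: rcons s' a)).
have [G1s G1i] : symmetric G1 /\ irreflexive G1 by split; [exact: diff_sym | exact: diff_irr].
(* With one edge of the second cycle removed the graph is unicyclic, so [no_ear] applies to the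
   first cycle; [F] is a subgraph of this graph without that cycle. *)
pose g1 := diff g (ed [:: last y t; y]).
have [g1s g1i] : symmetric g1 /\ irreflexive g1 by split; [exact: diff_sym | exact: diff_irr].
have g1c : conn g1 by exact: closed_walk_conn.
have g1a : arcs g1 = 2 * #|V| by have := arcs_last gs gi c2; rewrite ga -/g1; clear; lia.
have offt v : v \in a :: s' -> v \notin p :: q by move=> /dis; apply: contra; exact: sub.
have c1' : closed_walk G1 a s' by exact: closed_walk_diff.
have c1'' : closed_walk g1 a s'.
  apply: closed_walk_diff => // v /dis; apply: contra; rewrite !in_cons orbF => /orP[]/eqP->.
    by rewrite last_mem // orbT.
  by rewrite eqxx.
have [_ _ q1] := c1'; have [_ _ r1] := c1''.
have le1' v w : ed (a :: rcons s' a) v w <= 1 by exact: closed_ed_le1.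
have Fsub : subrel F (diff g1 (ed (a :: rcons s' a))).
  by move=> c d /andP[/andP[gcd /eqP z] w]; rewrite /diff /g1 /diff gcd pq0.
have oF v : (v \in odds F) = (v \in odds G1).
  by rewrite (odds_diff _ G1s G1i q1 le1') last_rcons addbb addbF.
have CeF v : v \in a :: s' -> v \notin odds F.
  move=> vC; rewrite oF (odds_diff _ gs gi pq le1) negb_add; have vp := offt v vC.
  have -> : (v == p) = false by apply: contraNF vp => /eqP->; exact: mem_head.
  have -> : (v == last p q) = false by apply: contraNF vp => /eqP->; exact: mem_last.
  by rewrite (negPf (Ce _ vC)).
have offF v : v \notin a :: s' -> v \notin a :: rcons s' a.
  move=> vC; rewrite -rcons_cons mem_rcons in_cons negb_or vC andbT.
  by apply: contraNneq vC => ->; exact: mem_head.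
apply: (@lollipop _ g F (ed (p :: q)) R2 k a s') => //.
- exact: diff_sym.
- exact: diff_irr.
- apply: acyclic_sub Fsub _.
  apply: (@acyclic_sub _ (diff g1 (ed [:: last a s'; a]))).
    by apply: subrel_diff => c d; exact: last_edge.
  apply: tree_acyclic; [exact: diff_sym | exact: diff_irr | exact: closed_walk_conn |].
  by have := arcs_last g1s g1i c1''; rewrite g1a; clear; lia.
- move=> c d; rewrite -(diffK c d gs pq le1) -(diffK c d G1s q1 le1') -/G1 -/F.
  by move: (ed (a :: rcons s' a) c d) (ed (p :: q) c d) (nat_of_bool _); clear; lia.
- by move=> v vC; apply/negP => /R2t; apply/negP; exact: dis.
- by apply/subsetP => v /R2e ve; rewrite in_setC oF.
- by move=> v vC vR; apply: nonisolated_off; [exact: R2n | exact: offF].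
- rewrite in_set; apply/deg_gt0P; exists b; rewrite /F /diff (ed_notinr _ (offF _ bC)) eqxx andbT.
  by rewrite /G1 /diff gab ed_notin ?eqxx // offt // mem_head.
- move=> v l vl ul vC lC; apply: (no_ear g1s g1i g1c g1a u1 s1 r1 _ ul vC lC).
  exact: sub_path Fsub _ _ vl.
- have S1 : [set v in a :: s'] :|: [set v in y :: t | v \notin odds G1] \subset ~: odds F.
    apply/subsetP => v; rewrite in_setU in_setC => /orP[|].
      by move=> vC; apply: CeF; rewrite in_set in vC.
    by move=> ve; rewrite oF; rewrite in_set in ve; case/andP: ve.
  have := subset_leq_card S1; rewrite cardsU.
  have -> : [set v in a :: s'] :&: [set v in y :: t | v \notin odds G1] = set0.
    apply/setP => v; rewrite in_setI in_set0; apply/negP => /andP[]; rewrite in_set => vC.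
    by rewrite in_set => /andP[vt _]; have := dis v vC; rewrite vt.
  have : size (a :: s') <= #|[set v in a :: s']|.
    by apply: card_uniq_le => // v; rewrite in_set.
  by move: le s1; rewrite cards0 -/G1 [size (a :: s')]/=; clear; lia.
Qed.

Lemma dumbbell_even x s y t :
    closed_walk g x s -> (forall v, v \in x :: s -> v \notin odds g) ->
    closed_walk g y t -> (forall v, v \in x :: s -> v \notin y :: t) ->
  half_block g.
Proof.
move=> c1 Ce c2 dis.
have [/hasP[a0 a0C a0o]|/hasPn C2e] := boolP (has (fun v => v \in odds g) (y :: t)).
  have [a [t' [b [c2' tE ao bt be]]]] := odd_pick c2 a0C a0o.
  have [u2 t1 p2] := c2'; have la := last_mem a t1.
  have na v : v \in t' -> v != a by move=> vt; apply: contraTneq vt => ->; case/andP: u2.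
  have q : path g (last a t') [:: a] by rewrite /= last_adj.
  apply: (@dumbbell_core x s a t' (last a t') [:: a] [set a] 1) => //.
  - by move=> v; rewrite -tE; exact: dis.
  - exact: link_le1.
  - by move=> v; rewrite !in_cons in_nil orbF => /orP[]/eqP->; rewrite ?eqxx // la orbT.
  - by apply: (@bounce_block _ _ [::] a); rewrite /= inE na.
  - by move=> v; rewrite in_set1 => /eqP->; exact: mem_head.
  - move=> v; rewrite in_set1 => /eqP->; rewrite (odds_diff _ gs gi q (link_le1 _ _)) ao eqxx.
    by rewrite eq_sym (negPf (na _ la)).
  - by move=> v _; apply: (conn_nonisolated gi ga); exact: closed_walk_conn.
  - rewrite addn1 ltnS; apply/card_gt0P; exists b; rewrite in_set in_cons bt orbT /=.
    by rewrite (odds_diff _ gs gi q (link_le1 _ _)) be [_ == last _ [:: a]]/= (negPf (na _ bt)) addbF addbb.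
have [u2 t1 p2] := c2; have le1 a b : ed (y :: rcons t y) a b <= 1 by exact: closed_ed_le1.
have oF v : (v \in odds (diff g (ed (y :: rcons t y)))) = (v \in odds g).
  by rewrite (odds_diff _ gs gi p2 le1) last_rcons addbb addbF.
have tP v : (v \in y :: rcons t y) = (v \in y :: t).
  by rewrite -rcons_cons mem_rcons in_cons orb_idl // => /eqP->; exact: mem_head.
have cC : 2 < #|[set v in y :: t]|.
  have tS : {subset y :: t <= [set v in y :: t]} by move=> v; rewrite in_set.
  exact: leq_trans (card_uniq_le u2 tS).
apply: (@dumbbell_core x s y t y (rcons t y) [set v in y :: t] 2) => //.
- by move=> v; rewrite tP.
- by move=> a b; exact: last_edge.
- apply: cycle_block => //; first by rewrite in_set mem_head.
  by move=> v; rewrite in_set.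
- by move=> v; rewrite in_set.
- by move=> v; rewrite in_set oF => /C2e.
- move=> v; rewrite in_set => vC; apply: nonisolated_off; last by rewrite tP.
  exact: (conn_nonisolated gi ga).
(* A triangle is just enough: [2 * 2 <= 3 + 1]. *)
- rewrite addn1 ltnS; apply: leq_trans cC _; apply: subset_leq_card; apply/subsetP => v.
  by rewrite !in_set => vC; rewrite vC -[deg _ _]/(deg _ _); have := C2e v vC; rewrite /= -oF in_set.
Qed.

Lemma dumbbell_half_block x s y t : closed_walk g x s -> closed_walk g y t ->
  (forall v, v \in x :: s -> v \notin y :: t) -> half_block g.
Proof.
move=> c1 c2 dis.
have [/hasP[a0 a0C a0o]|/hasPn C1e] := boolP (has (fun v => v \in odds g) (x :: s)); last first.
  exact: dumbbell_even c1 C1e c2 dis.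
have dis' v : v \in y :: t -> v \notin x :: s by move=> vt; apply/negP => /dis; rewrite vt.
have [/hasP[b0 b0C b0o]|/hasPn C2e] := boolP (has (fun v => v \in odds g) (y :: t)); last first.
  exact: dumbbell_even c2 C2e c1 dis'.
have [a [s' [b [c1' sE ao bt be]]]] := odd_pick c1 a0C a0o.
have [a' [t' [b' [c2' tE ao' bt' be']]]] := odd_pick c2 b0C b0o.
apply: (dumbbell_odd c1' c2' _ ao bt be ao' bt' be').
by move=> v; rewrite -sE -tE; exact: dis.
Qed.

End Dumbbell.

(** * Finding two cycles in a bicyclic graph *)

Section Structure.
Variable V : finType.
Implicit Types (s t l c : seq V) (a b d x y z u v w p q : V) (e : rel V).

Lemma path_acyclic s : uniq s -> acyclic (fun a b => 0 < ed s a b).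
Proof.
elim: s => [|x s IH]; first by move=> _ [|? [|? ?]].
move=> u c c2 uc; apply/negP => cyc; have /andP[xs us] := u.
have nb z : 0 < ed (x :: s) x z -> z = head x s.
  case: s xs {u us IH cyc} => [|y s] xs; first by [].
  have xy : x != y by apply: contraNneq xs => ->; exact: mem_head.
  by rewrite ed_cons2 (ed_notin _ xs) addn0 lt0b /link eqxx (negPf xy) orbF => /eqP.
have [xc|xc] := boolP (x \in c).
  have [i t E] := rot_to xc; move: c2 uc cyc; rewrite -(size_rot i) -(rot_uniq i) -(rot_cycle i) E.
  case: t {E} => // y t; case/lastP: t => // t z _ ut /= /andP[xy].
  rewrite rcons_path last_rcons => /andP[_ zx].
  have yE := nb _ xy; have zE : z = head x s by apply: nb; rewrite ed_sym.
  by move: ut; rewrite yE zE /= mem_rcons mem_head !andbF.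
case/negP: (IH us c c2 uc); apply: (sub_in_cycle _ _ cyc (P := mem c)); last exact/allP.
move=> a b ac bc; have ax : a != x by apply: contraNneq xc => <-.
have bx : b != x by apply: contraNneq xc => <-.
case: (s) => // y s'; rewrite ed_cons2 addn_gt0 lt0b => /orP[|//].
by case/orP=> /andP[/eqP aE /eqP bE]; rewrite ?aE ?bE eqxx in ax bx.
Qed.

Lemma not_acyclic e : ~ acyclic e -> exists x s, closed_walk e x s.
Proof.
move=> na; apply: contrapT => h; apply: na => -[|x s] // c2 uc; apply/negP => cyc.
by case: h; exists x, s.
Qed.

Lemma next_head x y s : next [:: x, y & s] x = y.
Proof. by rewrite /= eqxx. Qed.

Section Bicyclic.
Variable g : rel V.
Hypotheses (gs : symmetric g) (gi : irreflexive g) (gc : conn g) (ga : arcs g = 2 * #|V| + 2).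

Lemma exists_closed e : symmetric e -> irreflexive e -> conn e -> 2 * #|V| <= arcs e ->
  exists x s, closed_walk e x s.
Proof.
move=> es ei ec le; apply: not_acyclic => ac.
have v0 : 0 < #|nonisolated e|.
  have /card_gt0P[v _] := ltnW (card_gt1 gi ga).
  by apply/card_gt0P; exists v; exact: (conn_nonisolated gi ga).
have := acyclic_arcs es ei ac v0; have := subset_leq_card (subsetT (nonisolated e)); rewrite cardsT.
by move: le; clear; lia.
Qed.

(** The second cycle is found in the graph without the last edge of the first. It does not consist
    of edges of the path [x :: s] alone, as a path is acyclic, so it has an edge from [b] to [z] off
    the first cycle; it is rotated to close with that edge. *)
Lemma second_cycle x s : closed_walk g x s ->
  exists z t b, closed_walk g z (rcons t b) /\ ed (x :: rcons s x) b z = 0.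
Proof.
move=> cw; have [us s1 ps] := cw.
pose g1 := diff g (ed [:: last x s; x]).
have [g1s g1i] : symmetric g1 /\ irreflexive g1 by split; [exact: diff_sym | exact: diff_irr].
have [|y [c c1]] := exists_closed g1s g1i (closed_walk_conn gs gc cw).
  by have := arcs_last gs gi cw; rewrite ga -/g1; clear; lia.
have [b bc /eqP eb] : exists2 b, b \in y :: c & ed (x :: s) b (next (y :: c) b) == 0.
  have [uc c2 pc] := c1; apply/hasP; apply: contraT => /hasPn h.
  have /negP[] := path_acyclic us (c2 : 2 < size (y :: c)) uc.
  by apply: cycle_from_next => // v /h; rewrite lt0n.
have [uc c2 pc] := c1; have [i t' E] := rot_to bc.
have := rot_cycle i g1 (y :: c); have := rot_uniq i (y :: c); have := size_rot i (y :: c).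
have := next_rot i uc b; rewrite {}E uc [cycle g1 (y :: c)]pc.
case: t' => [|z t]; first by move=> _ [sc]; rewrite -sc in c2.
rewrite next_head => zE sz ut ct; rewrite -zE in eb.
have bz : g1 b z by case/andP: ct.
exists z, t, b; split; last first.
  have : ed [:: last x s; x] b z = 0 by case/andP: bz => _ /eqP.
  case/lastP: (s) s1 eb => // s' w _ eb; rewrite last_rcons.
  rewrite -[x :: rcons _ x]/(rcons (rcons (x :: s') w) x) ed_rcons ed_cons2 addn0 => ->.
  by rewrite eb.
have [sc] := sz; split.
- by have := ut; rewrite -(rot_uniq 1) rot1_cons.
- by rewrite size_rcons ltnS -ltnS sc.
- have : cycle g [:: b, z & t] by apply: sub_cycle ct; exact: diff_sub.
  by rewrite -(rot_cycle 1) rot1_cons.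
Qed.

Lemma bicyclic_half_block : half_block g.
Proof.
have [|x [s cw]] := exists_closed gs gi gc; first by rewrite ga leq_addr.
have [z [t [b [cw2 bz]]]] := second_cycle cw.
have [uw w1 pw] := cw2; set w := z :: rcons t b in uw pw *.
pose C := x :: s; have Ccat : ~~ has (mem C) w \/ has (mem C) w by case: has; [right | left].
case: Ccat => [/hasPn dis|/has_split[p [u [r [wE uC pC]]]]].
  exact: (dumbbell_half_block gs gi gc ga cw2 cw dis).
have {}uC : u \in x :: s by [].
have cr : cycle g (u :: r ++ p).
  by rewrite -[u :: _]/((u :: r) ++ p) -(rot_size_cat p) -wE rot_cycle.
have ur : uniq (u :: r ++ p).
  by rewrite -[u :: _]/((u :: r) ++ p) -(rot_size_cat p) -wE rot_uniq.
have sr : 1 < size (r ++ p).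
  have := congr1 size wE; rewrite size_cat /= size_rcons => sw; rewrite size_cat addnC.
  by move: w1 sw; rewrite size_rcons; clear; lia.
(* Read from [u], its first vertex on [C], the second cycle is [u :: r ++ p], where [p] avoids [C].
   If [r] avoids [C] too, then [u] is the only common vertex. *)
have [hr|hr] := boolP (has (mem C) r); last first.
  have [l [ul l1 pl] lE] := closed_walk_rot cw uC.
  apply: (bowtie_half_block gs gi gc ga (z := u) (l1 := l) (l2 := r ++ p)); split=> //.
  move: (ul) (ur); rewrite cons_uniq => /andP[ul0 ul']; rewrite cons_uniq => /andP[ur0 ur'].
  rewrite cons_uniq mem_cat negb_or ul0 ur0 cat_uniq ul' ur' andbT /=.
  rewrite andbT; apply/hasPn => v; rewrite mem_cat => vr; apply/negP => vl.
  have vC : v \in C by rewrite /C lE in_cons vl orbT.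
  by case/orP: vr => [vr|vp]; [case/negP: hr | case/negP: pC]; apply/hasP; exists v.
(* Let [v] be the last vertex of [r] on [C]. The arc of the second cycle from [v] on to [u] has its
   interior [q ++ p] off [C] and contains the edge from [b] to [z]; with the two arcs of [C] it
   forms a theta. *)
have : has (mem C) (rev r) by rewrite has_rev.
case/has_split=> q' [v [m' [rE vM q'C]]]; have vC : v \in x :: s by [].
pose q := rev q'; pose m := rev m'; have {}rE : r = m ++ v :: q.
  by rewrite -[r]revK rE rev_cat rev_cons cat_rcons.
have qC : ~~ has (mem C) q by rewrite has_rev.
have qpC a : a \in q ++ p -> a \notin x :: s.
  by rewrite mem_cat => aqp; apply/negP => aC; case/orP: aqp => ain;
    [case/negP: qC | case/negP: pC]; apply/hasP; exists a.
pose eC : rel V := fun a b => 0 < ed (x :: rcons s x) a b.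
have eCg : subrel eC g by move=> a c; case: cw => _ _ ps; exact: path_ed gs ps.
have cwC : closed_walk eC x s by case: cw => us s1 _; split=> //; apply: ed_path.
have [k [uk k1 pk] kE] := closed_walk_rot cwC uC.
have uv : u != v.
  by apply: contraTneq ur => ->; rewrite rE cons_uniq mem_cat mem_cat mem_head orbT.
have vk : v \in k by move: vC; rewrite kE in_cons eq_sym (negPf uv).
have [k1' [k2 kS]] : exists k1' k2, k = k1' ++ v :: k2 by case/splitPr: vk => k1' k2; exists k1', k2.
move: pk; rewrite kS rcons_cat rcons_cons -cat_rcons cat_path last_rcons => /andP[pk1 pk2].
have pl3 : path g v (rcons (q ++ p) u).
  move: cr; rewrite [cycle _ _]/= rE -catA cat_cons rcons_cat rcons_cons -cat_rcons cat_path.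
  by rewrite last_rcons => /andP[].
apply: (theta_half_block gs gi gc ga (x := u) (y := v) (l1 := k1') (l2 := rev k2) (l3 := rev (q ++ p))).
split.
- have pr : perm_eq [:: u, v & k1' ++ rev k2 ++ rev (q ++ p)] ((u :: k) ++ (q ++ p)).
    apply/permP => f; rewrite kS /= !count_cat /= !count_rev !count_cat.
    have -> : count f q = count f q' by exact: count_rev.
    by move: (nat_of_bool (f u)) (nat_of_bool (f v)) (count f k1') (count f k2) (count f q') (count f p); clear; lia.
  rewrite (perm_uniq pr) cat_uniq uk andTb; apply/andP; split.
    by apply/hasPn => a /qpC; rewrite kE.
  move: ur; rewrite rE -catA cat_cons cons_uniq => /andP[_].
  by rewrite cat_uniq cons_uniq => /and3P[_ _ /andP[]].
- exact: sub_path eCg _ _ pk1.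
- apply: rev_rcons_path => //; exact: sub_path eCg _ _ pk2.
- exact: rev_rcons_path.
(* If the third path is a single edge, it is the edge between [b] and [z], which is not on [C];
   hence neither arc of [C] is a single edge. *)
- have n12 : ~~ (nilp k1' && nilp (rev k2)).
    apply/negP => /andP[/nilP e1]; rewrite /nilp size_rev => /nilP e2.
    by move: k1; rewrite kS e1 e2.
  case: (boolP (nilp (rev (q ++ p)))) => [/nilP e3|n3]; last first.
    by move: n12; rewrite /= (negPf n3); case: (nilp _); case: (nilp _).
  have [q0 p0] : q = [::] /\ p = [::].
    by have := congr1 size e3; rewrite size_rev size_cat; case: (q); case: (p).
  have [zu bv] : z = u /\ b = v.
    move: wE; rewrite rE q0 p0 /= => -[zu]; rewrite cats1 => tE; split=> //.
    by have := congr1 (last z) tE; rewrite !last_rcons.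
  have uvC : ~~ eC u v by rewrite /eC -zu -bv ed_sym bz.
  have n1 : ~~ nilp k1' by apply: contraNN uvC => /nilP e1; move: pk1; rewrite e1 /= andbT.
  have n2 : ~~ nilp (rev k2).
    apply: contraNN uvC; rewrite /nilp size_rev => /nilP e2; move: pk2; rewrite e2 /= andbT.
    by rewrite /eC ed_sym.
  by rewrite /= (negPf n1) (negPf n2) e3.
Qed.
End Bicyclic.
End Structure.

(** * Path decompositions *)

Lemma arcs_edge_set (G : sgraph) : arcs (@adj G) = 2 * #|edge_set G|.
Proof.
pose A := [set p : G * G | adj p.1 p.2]; pose f (p : G * G) := [set p.1; p.2].
have -> : arcs (@adj G) = #|A|.
  rewrite /arcs /deg pair_big /= -sum1_card big_mkcond [RHS]big_mkcond.
  by apply: eq_bigr => p _; rewrite inE; case: adj.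
have -> : edge_set G = f @: A.
  apply/setP => E; rewrite inE; apply/existsP/imsetP => [[x /existsP[y /andP[xy /eqP->]]]|[[x y]]].
    by exists (x, y); rewrite ?inE.
  by rewrite inE => xy ->; exists x; apply/existsP; exists y; rewrite xy eqxx.
rewrite -sum1_card (partition_big_imset f) /= mulnC -sum_nat_const.
apply: eq_bigr => E /imsetP[[x y]]; rewrite inE /= => xy ->.
have nxy : x != y by apply: contraTneq xy => ->; rewrite adj_irrefl.
rewrite sum1dep_card -[RHS]/(1.+1); have <- : #|[set (x, y); (y, x)]| = 2.
  by rewrite cards2 xpair_eqE negb_and nxy.
apply: eq_card => -[a b]; rewrite !inE /= /f !xpair_eqE /=.
apply/andP/orP => [[ab /eqP/setP Eab]|[] /andP[/eqP-> /eqP->]]; last 2 first.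
- by rewrite xy eqxx.
- by rewrite adj_sym xy setUC eqxx.
have nab : a != b by apply: contraTneq ab => ->; rewrite adj_irrefl.
have := Eab a; have := Eab b; rewrite !inE !eqxx orbT /= => /esym/orP[]/eqP bE /esym/orP[]/eqP aE.
- by rewrite aE bE eqxx in nab.
- by right; rewrite aE bE !eqxx.
- by left; rewrite aE bE !eqxx.
- by rewrite aE bE eqxx in nab.
Qed.

Section Convert.
Variable G : sgraph.
Implicit Types (s : seq G) (E : {set G}) (D : seq (seq G)).

Lemma path_edges_cons x y s E :
  (E \in path_edges [:: x, y & s]) = (E == [set x; y]) || (E \in path_edges (y :: s)).
Proof. by rewrite /path_edges [pairmap _ _ _]/= !inE. Qed.

Lemma path_edgesP s E :
  reflect (exists a b, 0 < ed s a b /\ E = [set a; b]) (E \in path_edges s).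
Proof.
case: s => [|x s]; first by rewrite inE; apply: ReflectF => -[a [b []]].
elim: s x => [|y s IH] x; first by rewrite inE; apply: ReflectF => -[a [b []]].
rewrite path_edges_cons; apply: (iffP orP) => [[/eqP->|/IH[a [b [h ->]]]]|[a [b [h EE]]]].
- by exists x, y; rewrite ed_cons2 /link !eqxx.
- by exists a, b; rewrite ed_cons2 addn_gt0 h orbT.
move: h; rewrite ed_cons2 addn_gt0 lt0b => /orP[h|h]; last by right; apply/IH; exists a, b.
by left; rewrite EE; case/orP: h => /andP[/eqP-> /eqP->]; rewrite // setUC.
Qed.

Lemma mem_bigcup_seq D E :
  (E \in \bigcup_(s <- D) path_edges s) = has (fun s => E \in path_edges s) D.
Proof. by elim: D => [|s D IH]; rewrite ?big_nil ?in_set0 // big_cons in_setU IH. Qed.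

Lemma ed_set2 s a b c d : [set a; b] = [set c; d] -> 0 < ed s a b -> uniq s -> 0 < ed s c d.
Proof.
move=> /setP E h us; have nab : a != b by apply: contraTneq h => ->; rewrite ed_refl.
have := E a; have := E b; rewrite !inE !eqxx orbT /= => /esym/orP[]/eqP bE /esym/orP[]/eqP aE.
- by rewrite aE bE eqxx in nab.
- by rewrite -aE -bE ed_sym.
- by rewrite -aE -bE.
- by rewrite aE bE eqxx in nab.
Qed.

(** Empty lists are discarded because a path has at least one vertex. Two paths are edge-disjoint
    since the multiplicities of an edge add up to at most one. *)
Lemma decomp_path_decomposition D : decomp (fun a b => @adj G a b) D ->
  path_decomposition [seq s <- D | s != [::]].
Proof.
case=> /allP uD hD; set D' := filter _ _.
have hD' a b : \sum_(s <- D') ed s a b = @adj G a b.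
  rewrite -hD big_filter [RHS](bigID (fun s => s != [::])) /= [X in _ = _ + X]big1 ?addn0 //.
  by move=> s; rewrite negbK => /eqP->.
have uD' s : s \in D' -> uniq s by rewrite mem_filter => /andP[_ /uD].
have le_sum s a b : s \in D' -> ed s a b <= @adj G a b.
  by move=> sD; rewrite -hD' (big_rem s sD) leq_addr.
apply/and3P; split.
- apply/allP => s sD; have us := uD' s sD; move: (sD); rewrite mem_filter.
  case: s sD us => // x s sD us _; rewrite /is_path us andbT; apply: ed_path => a b.
  by move/leq_trans/(_ (le_sum _ a b sD)); rewrite lt0b.
- have {hD' le_sum} : forall a b, \sum_(s <- D') ed s a b <= 1 by move=> a b; rewrite hD'; case: adj.
  elim: {D hD uD} D' uD' => // s D IH uD h; rewrite /=; apply/andP; split; last first.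
    apply: IH => [t tD|a b]; first by apply: uD; rewrite inE tD orbT.
    by apply: leq_trans (h a b); rewrite big_cons leq_addl.
  apply/allP => t tD; rewrite -setI_eq0; apply/eqP/setP => E; rewrite in_set0 in_setI.
  apply/negP => /andP[/path_edgesP[a [b [ab ->]]] /path_edgesP[c [d [cd Ecd]]]].
  have {}cd : 0 < ed t a b.
    by apply: ed_set2 (esym Ecd) cd _; apply: uD; rewrite inE tD orbT.
  have := h a b; rewrite big_cons (big_rem t tD) /=; move: ab cd; clear; lia.
- apply/eqP/setP => E; rewrite mem_bigcup_seq inE; apply/hasP/existsP.
    case=> s sD /path_edgesP[a [b [ab ->]]]; exists a; apply/existsP; exists b.
    by have := leq_trans ab (le_sum _ a b sD); rewrite lt0b eqxx andbT.
  case=> a /existsP[b /andP[ab /eqP->]]; have hab : \sum_(s <- D') ed s a b = 1 by rewrite hD' ab.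
  have [/hasP[s sD h]|/hasPn h] := boolP (has (fun s => 0 < ed s a b) D').
    by exists s; last by apply/path_edgesP; exists a, b.
  by move: hab; rewrite big1_seq // => s /andP[_ /h]; rewrite -leqNgt leqn0 => /eqP.
Qed.

Lemma decomp_path_number D : decomp (fun a b => @adj G a b) D -> path_number G <= size D.
Proof.
move=> dD; apply: leq_trans (_ : size [seq s <- D | s != [::]] <= _); last first.
  by rewrite size_filter count_size.
rewrite /path_number; case: ex_minnP => k _; apply; apply/asboolP.
by exists [seq s <- D | s != [::]] => //; exact: decomp_path_decomposition.
Qed.

End Convert.

Lemma path_number_cprod (G H : sgraph) : bicyclic G ->
  2 * path_number (cprod G H) <= #|G| * #|H|.
Proof.
move=> /andP[/andP[_ /forallP Gc] /eqP Ge].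
have gc : conn (@adj G) by move=> x y; have /forallP := Gc x; exact.
have ga : arcs (@adj G) = 2 * #|G| + 2 by rewrite arcs_edge_set Ge mulnDr.
have [k le bk] := bicyclic_half_block (@adj_sym G) (@adj_irrefl G) gc ga.
have [N [mid [sg [uN iN hN]]]] := path_system (@adj_sym H) (@adj_irrefl H).
have [D dD sD] := product_decomp uN iN hN bk le.
apply: leq_trans sD; rewrite leq_mul2l /=; apply: (@decomp_path_number (cprod G H)).
apply: decomp_eq dD => p q; rewrite /= /cprod_adj; case: (eqVneq p.1 q.1) => [->|_].
  by rewrite adj_irrefl andbT.
by rewrite andbF orbF addn0.
Qed.

Local Open Scope ring_scope.

Theorem theorem6p1 (m n : nat) (G H : sgraph)
    (hG : bicyclic G) (hm : #|G| = m)
    (hH : connected H) (hn : #|H| = n) :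
  (path_number (cprod G H))%:R <= (m * n)%:R / 2 :> rat.
Proof.
subst m n; rewrite ler_pdivlMr // -natrM ler_nat mulnC; exact: path_number_cprod.
Qed.
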